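(* Let $\mathcal{M}$ be a $d$-dimensional $C^\infty$ compact Riemannian manifold without boundary, let $m\in\mathbb{N}$, and let $r^0<\ldots<r^m$ and $k$ be real numbers (superscripts are indices) and $\lambda_0,\ldots,\lambda_m>0$ be such that $\lambda_0+\ldots+\lambda_m=1$ and $k+\frac{2d-1}{4}\leqslant\lambda_0r^0+\ldots+\lambda_mr^m$. Then for every $x\in H_0^{2r^m}(\mathcal{M})$ there holds the sharp inequality $$\|\Delta^kx\|_{C(\mathcal{M})}\leqslant\sqrt{\mathcal{C}\cdot\prod_{j=0}^m\lambda_j^{-\lambda_j}}\cdot\prod_{j=0}^m\|\Delta^{r^j}x\|_{L_2(\mathcal{M})}^{\lambda_j},$$ where $$\mathcal{C}=\sup_{\xi\in\mathcal{M}}\ \sup_{\mathbf{h}\in\mathbb{R}_+^{m+1}}\ \prod_{j=0}^mh_j^{\lambda_j}\sum_{j=1}^\infty\frac{\mu_j^{4k}\varphi_j^2(\xi)}{\sum_{l=0}^mh_l\mu_j^{4r^l}}.$$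
   Context: $\mathbb{R}_+=(0,+\infty)$, $\mathbf{h}=(h_0,\ldots,h_m)$. $\mathcal{M}$ carries its Riemannian volume measure $\mu_g$, $L_2(\mathcal{M})=L_2(\mathcal{M},\mu_g)$ (complex-valued functions), and $\|\cdot\|_{C(\mathcal{M})}$ is the maximum norm. $\Delta$ is the positive self-adjoint Laplace–Beltrami operator ($-\mathrm{div}\,\mathrm{grad}$) on $L_2(\mathcal{M})$; its eigenvalues counted with multiplicity are $0=\mu_0^2<\mu_1^2\leqslant\mu_2^2\leqslant\ldots$ with $\mu_j\geqslant0$ (in particular $\mathcal{M}$ is connected), and $\{\varphi_j\}_{j=0}^\infty$ is an $L_2$-orthonormal basis of real $C^\infty$ eigenfunctions, $\Delta\varphi_j=\mu_j^2\varphi_j$. For $x\in L_2(\mathcal{M})$ put $a_j=(x,\varphi_j)_{L_2(\mathcal{M})}$. For $s\in\mathbb{R}$, $H^s(\mathcal{M})$ is the set of functions $x$ with $\sum_{j=1}^\infty|a_j|^2\mu_j^{2s}<\infty$, and $H_0^s(\mathcal{M}):=\{x\in H^s(\mathcal{M}):a_0=0\}$. For $x\in H_0^{2s}(\mathcal{M})$, $\Delta^sx:=\sum_{j=1}^\infty a_j\mu_j^{2s}\varphi_j$. Sharp means that the constant in front of the product of norms cannot be reduced. *)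

(* Defs.v *)
From HB Require Import structures.
From mathcomp Require Import all_boot all_order all_algebra.
From mathcomp Require Import all_classical all_reals all_analysis.
From mathcomp.real_closed Require Import complex.

Set Implicit Arguments.
Unset Strict Implicit.
Unset Printing Implicit Defensive.

Import Order.TTheory GRing.Theory Num.Theory.
Import numFieldNormedType.Exports.

Local Open Scope classical_set_scope.
Local Open Scope ring_scope.
Local Open Scope complex_scope.

Section euclidean.
Variables (R : realType) (d : nat).

Definition partial (i : 'I_d) (f : 'rV[R]_d -> R) : 'rV[R]_d -> R :=
  fun x => 'D_(delta_mx 0 i) f x.

(* For U open: all iterated partial derivatives of f exist and are continuous
   at every point of U, i.e. f is C^oo on U. *)
Definition smooth_on (U : set 'rV[R]_d) (f : 'rV[R]_d -> R) : Prop :=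
  forall (s : seq 'I_d) (x : 'rV[R]_d), U x ->
    {for x, continuous (foldr partial f s)} /\
    forall i, derivable (foldr partial f s) x (delta_mx 0 i).

End euclidean.

(* Lebesgue integral over R^d as an iterated one-dimensional Lebesgue integral;
   for nonnegative Borel f this is the d-dimensional integral by Tonelli. *)
Fixpoint integral_rV (R : realType) (d : nat) :
    ('rV[R]_d -> \bar R) -> \bar R :=
  match d with
  | 0%N => fun f => f 0
  | d'.+1 => fun f =>
      (\int[@lebesgue_measure R]_t
        integral_rV (fun v : 'rV[R]_d' => f (row_mx (t%:M : 'rV[R]_1) v)))%E
  end.

Record chart (R : realType) (d : nat) (T : ptopologicalType) := Chart {
  dom : set T;
  coord : T -> 'rV[R]_d;
  coordV : 'rV[R]_d -> T;
  dom_open : open dom;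
  img_open : open (coord @` dom);
  coordK : {in dom, cancel coord coordV};
  coord_continuous : {within dom, continuous coord};
  coordV_continuous : {within coord @` dom, continuous coordV}
}.

Section charts.
Variables (R : realType) (d : nat) (T : ptopologicalType).
Implicit Types c : chart R d T.

Definition img c : set 'rV[R]_d := coord c @` dom c.

Definition overlap c c' : set 'rV[R]_d := coord c @` (dom c `&` dom c').

Definition transition c c' : 'rV[R]_d -> 'rV[R]_d := coord c' \o coordV c.

End charts.

(* metric c x is the Gram matrix, at the point of coordinates x in the chart c,
   of the coordinate vector fields of c; only its values for c in the atlas and
   x in img c are relevant. The Jacobian 'J f x acts on row vectors on the
   right, so its (i, j) entry is the i-th partial derivative of f_j. *)
Record compactRiemannianManifold (R : realType) (d : nat) := RiemannianManifold {
  carrier :> ptopologicalType;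
  carrier_hausdorff : hausdorff_space carrier;
  carrier_compact : compact [set: carrier];
  atlas : set (chart R d carrier);
  atlas_cover : forall p : carrier, exists2 c, atlas c & dom c p;
  atlas_smooth : forall c c', atlas c -> atlas c' -> forall j,
    smooth_on (overlap c c') (fun x => transition c c' x 0 j);
  metric : chart R d carrier -> 'rV[R]_d -> 'M[R]_d;
  metric_smooth : forall c, atlas c -> forall i j,
    smooth_on (img c) (fun x => metric c x i j);
  metric_sym : forall c x, atlas c -> img c x -> (metric c x)^T = metric c x;
  metric_pos : forall c x (v : 'rV[R]_d), atlas c -> img c x -> v != 0 ->
    0 < (v *m metric c x *m v^T) 0 0;
  metric_compat : forall c c' x, atlas c -> atlas c' -> overlap c c' x ->
    let J := 'J (transition c c') x in
    metric c x = J *m metric c' (transition c c' x) *m J^T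
}.

Notation borel M := (g_sigma_algebraType (@open M)).

Section riemannian.
Variables (R : realType) (d : nat) (M : compactRiemannianManifold R d).

Definition density (c : chart R d M) (x : 'rV[R]_d) : R :=
  Num.sqrt (\det (metric c x)).

(* These values on Borel subsets of chart domains determine vol. *)
Definition is_volume (vol : {measure set (borel M) -> \bar R}) : Prop :=
  forall (c : chart R d M) (A : set (borel M)),
    atlas c -> measurable A -> A `<=` dom c ->
    vol A = integral_rV (fun x => (\1_(coord c @` A) x * density c x)%:E).

Definition smooth (u : M -> R) : Prop :=
  forall c, atlas c -> smooth_on (img c) (u \o coordV c).

(* - div grad u in the coordinates of c *)
Definition laplace_chart (c : chart R d M) (u : M -> R) (x : 'rV[R]_d) : R :=
  - ((density c x)^-1 *
     \sum_(i < d) partial i (fun y => density c y *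
       \sum_(j < d) invmx (metric c y) i j * partial j (u \o coordV c) y) x).

Definition laplace_eigenfunction (a : R) (u : M -> R) : Prop :=
  smooth u /\
  forall c p, atlas c -> dom c p -> laplace_chart c u (coord c p) = a * u p.

End riemannian.

Section spectral.
Variables (R : realType) (d : nat) (M : compactRiemannianManifold R d).
Variable vol : {measure set (borel M) -> \bar R}.
Implicit Types x y : M -> R[i].

Definition cabs (z : R[i]) : R := Normc.normc z.

(* Elements of L_2 are handled through Borel representatives; L2, L2norm and
   coef only depend on the class modulo vol-a.e. equality. *)
Definition L2 x : Prop :=
  ((fun p : borel M => complex.Re (x p)) \in Lfun vol 2%:E) /\
  ((fun p : borel M => complex.Im (x p)) \in Lfun vol 2%:E).

Definition L2norm x : R :=
  fine ('N[vol]_2%:E[(fun p : borel M => (cabs (x p))%:E)])%E.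

(* y is a continuous representative of the class of x *)
Definition continuous_repr x y : Prop :=
  continuous (y : M -> R[i]^o) /\ {ae vol, forall p, x p = y p}.

Definition supnorm y : R := sup [set cabs (y p) | p in [set: M]].

Variables (mu : nat -> R) (phi : nat -> M -> R).

(* (x, phi_j)_{L_2}, phi_j being real-valued *)
Definition coef (j : nat) x : R[i] :=
  (\int[vol]_p (complex.Re (x p) * phi j p)) +i*
  (\int[vol]_p (complex.Im (x p) * phi j p)).

Definition L2_basis : Prop :=
  (forall i j, \int[vol]_p (phi i p * phi j p) = (i == j)%:R) /\
  forall x, L2 x ->
    (fun n => L2norm (fun p => x p - \sum_(0 <= j < n) coef j x * (phi j p)%:C))
      @ \oo --> (0 : R).

(* Since the phi j form a basis, this forces the mu j ^+ 2 to be all the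
   eigenvalues, counted with multiplicity; 0 < mu 1 forces M to be connected. *)
Definition laplace_spectral_basis : Prop :=
  [/\ mu 0%N = 0, 0 < mu 1%N, forall j, mu j <= mu j.+1,
      forall j, laplace_eigenfunction (mu j ^+ 2) (phi j) & L2_basis].

Definition Hs (s : R) x : Prop :=
  L2 x /\ (\sum_(1 <= j <oo) (cabs (coef j x) ^+ 2 * mu j `^ (2 * s))%:E < +oo)%E.

Definition Hs0 (s : R) x : Prop := Hs s x /\ coef 0 x = 0.

Definition is_laplace_pow (s : R) x y : Prop :=
  L2 y /\
  (fun n => L2norm (fun p =>
     y p - \sum_(1 <= j < n) coef j x * (mu j `^ (2 * s) * phi j p)%:C))
    @ \oo --> (0 : R).

(* A representative of the class Delta^s x; for x in Hs0 (2 * s) the series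
   converges in L_2, so that the default value is not used. *)
Definition laplace_pow (s : R) x : M -> R[i] :=
  xget (fun=> 0) [set y | is_laplace_pow s x y].

Definition sharp_const (m : nat) (r lam : 'I_m.+1 -> R) (k : R) : \bar R :=
  ereal_sup [set ereal_sup
    [set ((\prod_(j < m.+1) h j `^ lam j)%:E *
          \sum_(1 <= j <oo) (mu j `^ (4 * k) * phi j xi ^+ 2 /
              \sum_(l < m.+1) h l * mu j `^ (4 * r l))%:E)%E
     | h in [set h : 'I_m.+1 -> R | forall l, 0 < h l]]
   | xi in [set: M]].

End spectral.

(* Main.v *)
(* The finiteness of the constant rests on the local Weyl bound
   [\sum_(mu_j <= T) phi_j(p)^2 <= c T^d], uniform in [p], which is obtained from
   the maximum principle alone. If [E = \sum_j phi_j^2] is maximal at [p] then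
   [u = \sum_j phi_j(p) phi_j] satisfies [|u| <= u(p) = E(p)] and
   [|Delta u| <= T^2 E(p)], so by doubling of variables (Ishii and Lions)
   [u >= E(p) / 2] on a coordinate cube of side of order [1 / T]; since
   [\int u^2 = E(p)], this gives [E(p) <= c T^d]. Dyadic summation over the
   [mu_j] then bounds the series in the constant, as
   [4 (\sum_j lam_j r_j - k) >= 2 d - 1 >= d].

   The inequality is Cauchy-Schwarz with weights [\sum_l h_l mu_j^(4 r_l)],
   where [h_l = lam_l / N_l^2] and [N_l] is the L2-norm of [Delta^(r_l) x].
   It is sharp because for the finite sums
   [x = \sum_j mu_j^(2 k) phi_j(xi) / (\sum_l h_l mu_j^(4 r_l)) phi_j]
   Cauchy-Schwarz is an equality at [xi], and [\prod_l N_l^(lam_l)] is estimated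
   by the weighted arithmetic-geometric inequality. *)

Require Import Defs.
From HB Require Import structures.
From mathcomp Require Import all_boot all_order all_algebra.
From mathcomp Require Import all_classical all_reals all_analysis.
From mathcomp.real_closed Require Import complex.
From mathcomp Require Import measurable_realfun.
From mathcomp Require Import ring lra.

Set Implicit Arguments.
Unset Strict Implicit.
Unset Printing Implicit Defensive.

Import Order.TTheory GRing.Theory Num.Theory.
Import numFieldNormedType.Exports.

Local Open Scope classical_set_scope.
Local Open Scope ring_scope.

(** * Doubling of variables for an operator close to the flat Laplacian *)

Section dot_product.
Variables (R : rcfType) (d : nat).
Implicit Types (a b p z v : 'rV[R]_d) (H : 'M[R]_d).

(** The penalty in the doubling is a multiple of [|x - y|^(1/2)], a concave power of the Euclidean
    distance. At a maximum with distinct [x] and [y] its gradient has order [|x - y|^(-1/2)], while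
    its second derivative along [x - y] is negative of order [|x - y|^(-3/2)]. Close to the
    diagonal, concavity therefore beats the drift and the right-hand side. The second-order
    coefficients perturb the trace by the same order [-3/2], so they only have to stay within a
    fixed tolerance, depending on [d] alone, of the identity. Hence one linear normalisation at a
    point serves all neighbouring points and every scale [1 / T].

    The estimate is one-sided and starts from a single point, which is all the cube argument asks
    for. The constant is a supremum of infinite series over all [h]; it is handled through finite
    sublists of indices with bounds independent of [h] and of the sublist. *)

Definition dotv a b : R := \sum_i a 0 i * b 0 i.
Definition quadf H p : R := (p *m H *m p^T) 0 0.

Lemma dotvDZ z v (t : R) :
  dotv (z + t *: v) (z + t *: v) = dotv z z + t * (2 * dotv z v + t * dotv v v).
Proof.
rewrite /dotv !mulr_sumr -big_split mulr_sumr -big_split /=.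
by apply: eq_bigr => i _; rewrite !mxE; ring.
Qed.

Lemma dotvZZ z (t : R) : dotv (t *: z) (t *: z) = t ^+ 2 * dotv z z.
Proof. by rewrite /dotv mulr_sumr; apply: eq_bigr => i _; rewrite !mxE; ring. Qed.

Lemma dotv_ge0 z : 0 <= dotv z z.
Proof. by apply: sumr_ge0 => i _; rewrite -expr2 sqr_ge0. Qed.

Lemma dotv_coord z i : z 0 i ^+ 2 <= dotv z z.
Proof.
rewrite /dotv (bigD1 i) //= -expr2 lerDl.
by apply: sumr_ge0 => j _; rewrite -expr2 sqr_ge0.
Qed.

Lemma dotv_gt0 z : z != 0 -> 0 < dotv z z.
Proof.
move=> z0; rewrite lt_neqAle dotv_ge0 andbT eq_sym.
apply: contra z0 => /eqP z0; apply/eqP/rowP => i; rewrite mxE; apply/eqP.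
by rewrite -sqrf_eq0 eq_le sqr_ge0 andbT -z0 dotv_coord.
Qed.

Lemma dotv_delta z i : dotv z (delta_mx 0 i) = z 0 i.
Proof.
rewrite /dotv (bigD1 i) //= mxE !eqxx mulr1 big1 ?addr0 // => j ji.
by rewrite mxE eqxx (negbTE ji) mulr0.
Qed.

(** The square root of the Euclidean length, as a fourth root of [dotv z z]: through [psi4], bounds
    on it become polynomial inequalities. *)
Definition psi z : R := Num.sqrt (Num.sqrt (dotv z z)).

Lemma psi_ge0 z : 0 <= psi z. Proof. exact: sqrtr_ge0. Qed.

Lemma psi4 z : psi z ^+ 4 = dotv z z.
Proof. by rewrite /psi (exprM _ 2 2) !sqr_sqrtr ?sqrtr_ge0 ?dotv_ge0. Qed.

Lemma psi_gt0 z : z != 0 -> 0 < psi z.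
Proof. by move=> z0; rewrite !sqrtr_gt0 dotv_gt0. Qed.

Lemma psi0 : psi 0 = 0.
Proof.
rewrite /psi /dotv big1 ?sqrtr0 // => i _; by rewrite mxE mul0r.
Qed.

Lemma psi_coord z i : `|z 0 i| <= psi z ^+ 2.
Proof.
rewrite -[leRHS]ger0_norm ?sqr_ge0 // -ler_sqr ?nnegrE // !real_normK ?num_real //.
by rewrite -exprM psi4 dotv_coord.
Qed.

(* Concavity of [q |-> q ^ (1/4)] at [q = dotv z z]. *)
Lemma psi_tangent z v (t : R) : z != 0 ->
  psi (z + t *: v) <= psi z + t * (2 * dotv z v + t * dotv v v) / (4 * psi z ^+ 3).
Proof.
move=> z0; have A0 := psi_gt0 z0.
have := dotvDZ z v t; rewrite -(psi4 z) -(psi4 (z + _)) => e.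
have B0 := psi_ge0 (z + t *: v).
set A := psi z in A0 e *; set B := psi _ in B0 e *.
have {}e : t * (2 * dotv z v + t * dotv v v) = B ^+ 4 - A ^+ 4 by rewrite e; ring.
rewrite -lerBlDl ler_pdivlMr ?mulr_gt0 ?exprn_gt0 // e -subr_ge0.
rewrite [leRHS](_ : _ = (B - A) ^+ 2 * ((B + A) ^+ 2 + 2 * A ^+ 2)); last by ring.
apply: mulr_ge0; [exact: sqr_ge0|apply: addr_ge0; [exact: sqr_ge0|]].
by apply: mulr_ge0; [exact: ler0n|exact: sqr_ge0].
Qed.

(** The tangent bounds at [t] and [- t] are added, and the terms linear in [t] cancel. *)
Lemma psi_diff2 z v (t : R) : z != 0 ->
  psi (z + t *: v) + psi (z - t *: v) - 2 * psi z
    <= t ^+ 2 * (dotv v v / (2 * psi z ^+ 3)).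
Proof.
move=> z0; have A0 := psi_gt0 z0.
have h1 := psi_tangent v t z0; have h2 := psi_tangent v (- t) z0.
rewrite scaleNr in h2.
have -> : t ^+ 2 * (dotv v v / (2 * psi z ^+ 3)) =
  t * (2 * dotv z v + t * dotv v v) / (4 * psi z ^+ 3) +
  (- t) * (2 * dotv z v + (- t) * dotv v v) / (4 * psi z ^+ 3).
  by field; rewrite gt_eqF.
lra.
Qed.

Lemma psi_radial z (c : R) : 0 <= 1 + c -> psi (z + c *: z) = Num.sqrt (1 + c) * psi z.
Proof.
move=> c0; rewrite /psi (_ : z + c *: z = (1 + c) *: z); last by rewrite scalerDl scale1r.
rewrite dotvZZ sqrtrM ?sqr_ge0 //.
by rewrite sqrtr_sqr ger0_norm // sqrtrM.
Qed.

(** The square of the left side is [2 + 2 * (a * b)], where [a * b] is the root of [1 - c ^+ 2] and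
    so at most [1 - c ^+ 2 / 2]. This is the strict concavity that the tangent bound does not
    see. *)
Lemma sqrt_diff2 (c : R) : `|c| <= 1 ->
  Num.sqrt (1 + c) + Num.sqrt (1 - c) <= 2 - c ^+ 2 / 4.
Proof.
rewrite ler_norml => /andP[c1 c2].
have c3 : c ^+ 2 <= 1 by nra.
have h1 : Num.sqrt (1 + c) ^+ 2 = 1 + c by rewrite sqr_sqrtr; lra.
have h2 : Num.sqrt (1 - c) ^+ 2 = 1 - c by rewrite sqr_sqrtr; lra.
have a0 := sqrtr_ge0 (1 + c); have b0 := sqrtr_ge0 (1 - c).
set a := Num.sqrt (1 + c) in h1 a0 *; set b := Num.sqrt (1 - c) in h2 b0 *.
have hab : (a * b) ^+ 2 = 1 - c ^+ 2 by rewrite exprMn h1 h2; ring.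
have h3 : a * b <= 1 - c ^+ 2 / 2.
  rewrite -ler_sqr ?nnegrE ?mulr_ge0 //; first by rewrite hab; nra.
  lra.
have p0 : 0 <= 2 - c ^+ 2 / 4 by lra.
have q0 : 0 <= a + b by exact: addr_ge0.
rewrite -ler_sqr ?nnegrE //; nra.
Qed.

Lemma psi_diff2_radial z (c : R) : z != 0 -> `|c| <= 1 ->
  psi (z + c *: z) + psi (z - c *: z) - 2 * psi z <= - c ^+ 2 / 4 * psi z.
Proof.
move=> z0 c1; have A0 := psi_gt0 z0; have h := sqrt_diff2 c1.
move: c1; rewrite ler_norml => /andP[c1 c2].
rewrite -scaleNr !psi_radial; try lra.
nra.
Qed.

End dot_product.

(** * Traces against matrices close to the identity *)

Section trace_bounds.
Variables (R : rcfType) (d : nat).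
Implicit Types (p z : 'rV[R]_d) (H B : 'M[R]_d).

Local Notation e i := (delta_mx 0 i : 'rV[R]_d).

Lemma quadf_sum H p : quadf H p = \sum_i \sum_j p 0 i * H i j * p 0 j.
Proof.
rewrite /quadf mxE exchange_big /=; apply: eq_bigr => j _.
by rewrite !mxE mulr_suml.
Qed.

Lemma quadfN H p : quadf (- H) p = - quadf H p.
Proof. by rewrite /quadf mulmxN mulNmx mxE. Qed.

Lemma quadf_delta H i : quadf H (e i) = H i i.
Proof.
by rewrite /quadf trmx_delta -rowE -colE !mxE.
Qed.

Lemma quadf_delta2 H i j (s : R) : s ^+ 2 = 1 ->
  quadf H (e i + s *: e j) = H i i + H j j + s * (H i j + H j i).
Proof.
move=> s2; rewrite /quadf mulmxDl linearD /= mulmxDr !mulmxDl !linearZ /=.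
rewrite -!scalemxAl !linearZ /= !trmx_delta -!rowE -!colE !mxE /=.
by rewrite [s * (s * _)]mulrA -expr2 s2; ring.
Qed.

Lemma dotv_delta2 i j (s : R) : s ^+ 2 = 1 -> dotv (e i + s *: e j) (e i + s *: e j) <= 4.
Proof.
move=> s2; rewrite dotvDZ !dotv_delta !mxE !eqxx /=.
have : `|s| <= 1 by rewrite -ler_sqr ?nnegrE // expr1n real_normK ?num_real // s2.
rewrite ler_norml => /andP[h1 h2].
case: eqVneq => _ /=; nra.
Qed.

Section near_identity.
Variables (H B : 'M[R]_d) (eps c : R).
Hypotheses (Bsym : B^T = B)
  (Bid : forall i j, `|B i j - (i == j)%:R| <= eps).

(** With signs matched to the entries of [B - 1], the vectors [e i + sg i j *: e j] reproduce the
    off-diagonal pairing up to diagonal terms. What results is a combination of values of the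
    quadratic form of [H] with nonnegative weights under [Bid], apart from the leading multiple of
    the trace. *)
Lemma trace_split :
  let D i j : R := B i j - (i == j)%:R in
  let sg i j : R := if 0 <= D i j then 1 else -1 in
  \sum_i \sum_j B i j * H i j =
  (1 - d%:R * eps) * \tr H +
  (\sum_i (d%:R * eps - \sum_j `|D i j|) * H i i +
   \sum_i \sum_j `|D i j| / 2 * quadf H (e i + sg i j *: e j)).
Proof.
move=> D sg.
have sg2 i j : sg i j ^+ 2 = 1 by rewrite /sg; case: ifP => _; rewrite ?expr1n // sqrrN expr1n.
have sgD i j : `|D i j| * sg i j = D i j.
  rewrite /sg; case: ifP => h; first by rewrite ger0_norm ?mulr1.
  by rewrite ltr0_norm ?mulrN1 ?opprK // ltNge h.
have DC i j : D i j = D j i by rewrite /D -[in LHS]Bsym mxE eq_sym.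
have -> : \sum_i \sum_j B i j * H i j = \tr H + \sum_i \sum_j D i j * H i j.
  rewrite -big_split /=; apply: eq_bigr => i _.
  rewrite (bigD1 i) //= [in RHS](bigD1 i) //= /D eqxx /= addrA.
  congr (_ + _); first by ring.
  by apply: eq_bigr => j ji; rewrite eq_sym (negbTE ji) /= subr0.
have -> : \sum_i \sum_j `|D i j| / 2 * quadf H (e i + sg i j *: e j) =
  \sum_i (\sum_j `|D i j|) * H i i + \sum_i \sum_j D i j * H i j.
  transitivity (\sum_i \sum_j (`|D i j| / 2 * H i i + D i j / 2 * H i j) +
                \sum_i \sum_j (`|D i j| / 2 * H j j + D i j / 2 * H j i)).
    rewrite -big_split; apply: eq_bigr => i _; rewrite -big_split /=.
    apply: eq_bigr => j _; rewrite quadf_delta2 //.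
    by move: (D i j) (sg i j) `|D i j| (sgD i j) => b sij a <-; field.
  rewrite [X in _ + X]exchange_big /=.
  have -> : \sum_j \sum_i (`|D i j| / 2 * H j j + D i j / 2 * H j i) =
            \sum_i \sum_j (`|D i j| / 2 * H i i + D i j / 2 * H i j).
    by apply: eq_bigr => j _; apply: eq_bigr => i _; rewrite DC.
  rewrite -!big_split; apply: eq_bigr => i _ /=; rewrite mulr_suml -!big_split /=.
  by apply: eq_bigr => j _; field.
have -> : \sum_i (d%:R * eps - \sum_j `|D i j|) * H i i =
  d%:R * eps * \tr H - \sum_i (\sum_j `|D i j|) * H i i.
  rewrite /mxtrace mulr_sumr -sumrN -big_split /=.
  by apply: eq_bigr => i _; ring.
ring.
Qed.

(** At a maximum the form of [H] is controlled from one side only, whence the nonnegative weights of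
    [trace_split]. The diagonal terms cost [d^2 eps c] and the others [2 d^2 eps c]. *)
Lemma trace_upper : 0 <= c -> (forall p, quadf H p <= c * dotv p p) ->
  \sum_i \sum_j B i j * H i j <=
  (1 - d%:R * eps) * \tr H + c * (3 * d%:R ^+ 2 * eps).
Proof.
move=> c0 Hc; rewrite trace_split lerD2l.
have sumd (x : R) : \sum_(i < d) x = d%:R * x by rewrite sumr_const card_ord mulr_natl.
have -> : c * (3 * d%:R ^+ 2 * eps) =
  \sum_(i < d) d%:R * eps * c + \sum_(i < d) \sum_(j < d) eps / 2 * (c * 4).
  by rewrite !sumd; field.
apply: lerD; apply: ler_sum => i _; last first.
  apply: ler_sum => j _; set s : R := if _ then _ else _.
  have s2 : s ^+ 2 = 1 by rewrite /s; case: ifP => _; rewrite ?expr1n // sqrrN expr1n.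
  apply: (@le_trans _ _ (`|B i j - (i == j)%:R| / 2 * (c * 4))).
    apply: ler_wpM2l; first by rewrite divr_ge0.
    by apply: (le_trans (Hc _)); apply: ler_wpM2l => //; exact: dotv_delta2.
  apply: ler_wpM2r; first by rewrite mulr_ge0.
  by rewrite ler_pM2r ?invr_gt0 ?ltr0n.
have Hi : H i i <= c.
  have := Hc (e i); rewrite quadf_delta dotv_delta mxE !eqxx mulr1; exact.
have D0 : 0 <= \sum_j `|B i j - (i == j)%:R| by apply: sumr_ge0.
have D1 : \sum_j `|B i j - (i == j)%:R| <= d%:R * eps.
  by rewrite -sumd; apply: ler_sum.
set Dt := \sum_j _ in D0 D1 *.
nra.
Qed.

End near_identity.

(* The vectors [e i - (s * z 0 i) *: z] are the images of the [e i] under the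
   reflection along [z]. *)
Lemma reflection_trace H z (s : R) : s * dotv z z = 2 ->
  \sum_i quadf H (e i - (s * z 0 i) *: z) = \tr H.
Proof.
move=> sz; pose Rz := 1%:M - s *: (z^T *m z).
have Rt : Rz^T = Rz.
  by rewrite /Rz linearB /= linearZ /= trmx1 trmx_mul trmxK.
have zz : z *m z^T = (dotv z z)%:M.
  by rewrite [LHS]mx11_scalar mxE; congr (_%:M); apply: eq_bigr => i _; rewrite mxE.
have R1 : Rz *m Rz = 1%:M.
  rewrite /Rz mulmxBl mul1mx mulmxBr mulmx1 -scalemxAl -scalemxAr.
  rewrite mulmxA -(mulmxA z^T) zz mul_mx_scalar -scalemxAl !scalerA.
  rewrite sz mulr_natr mulr2n scalerDl; set X := s *: _.
  by rewrite (_ : X - (X + X) = - X) ?opprK ?subrK // opprD addrA subrr sub0r.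
transitivity (\tr (Rz *m H *m Rz)).
  apply: eq_bigr => i _; rewrite /quadf.
  have -> : e i - (s * z 0 i) *: z = row i Rz.
    by apply/rowP => j; rewrite !mxE big_ord1 !mxE eq_sym; ring.
  rewrite -row_mul tr_row Rt [LHS]mxE [RHS]mxE.
  by apply: eq_bigr => j _; rewrite [row _ _ _ _]mxE [col _ _ _ _]mxE.
by rewrite -mulmxA mxtrace_mulC -mulmxA R1 mulmx1.
Qed.

End trace_bounds.

Lemma cvg_sumr (R : realType) (T I : Type) (F : set_system T) {FF : Filter F} (s : seq I)
    (P : pred I) (f : I -> T -> R) (l : I -> R) :
  (forall i, P i -> f i t @[t --> F] --> l i) ->
  \sum_(i <- s | P i) f i t @[t --> F] --> \sum_(i <- s | P i) l i.
Proof.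
move=> fl; elim: s => [|i s IHs].
  by under eq_fun do rewrite big_nil; rewrite big_nil; exact: cvg_cst.
under eq_fun do rewrite big_cons; rewrite big_cons; case: ifPn => // Pi.
by apply: cvgD => //; exact: fl.
Qed.

(** * The sup norm on row vectors and one-sided limits *)

Section row_norm.
Variables (R : realType) (d : nat).
Implicit Types x p : 'rV[R]_d.

Lemma rV_norm_lt x (e : R) : 0 < e -> (forall i, `|x 0 i| < e) -> `|x| < e.
Proof.
move=> e0 h; rewrite [`|x|]mx_normrE; apply/bigmax_ltP; split => // -[i j] _ /=.
by rewrite ord1.
Qed.

Lemma rV_norm_coord x i : `|x 0 i| <= `|x|.
Proof.
rewrite [leRHS]mx_normrE; exact: (le_bigmax _ (fun ij => `|x ij.1 ij.2|) (0, i)).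
Qed.

Lemma rV_unit_ball_line x p : `|x| < 1 ->
  exists2 e : R, 0 < e & forall t, `|t| < e -> `|x + t *: p| <= 1.
Proof.
move=> x1; have p0 : 0 < `|p| + 1 by rewrite ltr_wpDl.
exists ((1 - `|x|) / (`|p| + 1)); first by rewrite divr_gt0 ?subr_gt0.
move=> t; rewrite ltr_pdivlMr // => ht; apply: (le_trans (ler_normD _ _)).
rewrite normrZ; have := normr_ge0 t; have := normr_ge0 p; nra.
Qed.

Lemma dotv_continuous : continuous (fun x => dotv x x).
Proof.
move=> x; apply: (cvg_sumr (F := nbhs x) (f := fun i (z : 'rV[R]_d) => z 0 i * z 0 i)).
by move=> i _; apply: cvgM; exact: coord_continuous.
Qed.

Lemma psi_continuous : continuous (@psi R d).
Proof.
move=> x; rewrite /psi.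
apply: (@continuous_comp _ _ _ (fun x => Num.sqrt (dotv x x)) Num.sqrt);
  last exact: sqrt_continuous.
apply: (@continuous_comp _ _ _ (fun x => dotv x x) Num.sqrt);
  last exact: sqrt_continuous.
exact: dotv_continuous.
Qed.

(** Turns the comparison of values at a maximum into a bound on a derivative; [c] carries the
    next-order remainder, which vanishes with [t]. *)
Lemma cvg_dnbhs_le (f : R -> R) (a b c : R) : f t @[t --> 0^'] --> a ->
  (exists2 e : R, 0 < e & forall t, 0 < t < e -> f t <= b + t * c) -> a <= b.
Proof.
move=> fa [e e0 fe].
have sub : (0 : R)^'+ `=>` 0^'.
  move=> A; rewrite /at_right /dnbhs /within /=; apply: filterS => t h t0.
  by apply: h; rewrite gt_eqF.
have fa' : f t @[t --> 0^'+] --> a by apply: cvg_trans fa; exact: cvg_app.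
have gb : b + t * c @[t --> (0:R)^'+] --> b.
  rewrite [X in _ --> X](_ : b = b + 0 * c); last by rewrite mul0r addr0.
  apply: cvgD; first exact: cvg_cst.
  apply: cvgM; last exact: cvg_cst.
  by apply: cvg_at_right_filter; exact: cvg_id.
apply: (ler_cvg_to fa' gb); near=> t; apply: fe; apply/andP; split.
  by near: t; exact: nbhs_right_gt.
by near: t; exact: nbhs_right_lt.
Unshelve. all: by end_near. Qed.

End row_norm.

(** Adding the two equations, [X] appears with coefficient about [- 11 / 12 + 1 / 4]: concavity
    against the two errors of [trace_upper]. All other terms are of order [D], and
    [100 * D <= X]. *)
Lemma doubling_arith (R : realFieldType) (D A X th trx try Sx Sy gx gy : R) :
  1 <= D -> 0 < A -> 100 * D * A < 2 -> 100 * D <= X -> 11 / 12 <= th -> th <= 1 ->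
  trx - try <= - X + 16 * D -> Sx <= th * trx + (X / 2 + 16) * (1 / 4) ->
  Sy <= th * - try + X / 2 * (1 / 4) -> gx <= X / 2 * (D * A ^+ 2) + 16 * D ->
  - gy <= X / 2 * (D * A ^+ 2) -> -1 <= Sx + gx -> - Sy + gy <= 1 -> 2 <= 1 :> R.
Proof.
move=> D1 A0 DA DX th1 th2 t3 t1 t2 g1 g2 Ex Ey.
have X0 : 0 <= X by lra.
have DA2 : D * A ^+ 2 <= 1 / 2500.
  have h1 : D * A <= 1 / 50 by lra.
  have h2 : A <= 1 / 50 by nra.
  rewrite expr2 mulrA; nra.
have t5 : X / 2 * (D * A ^+ 2) <= X / 2 * (1 / 2500) by apply: ler_wpM2l => //; lra.
have t4 : th * (trx - try) <= th * (- X + 16 * D) by apply: ler_wpM2l => //; lra.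
have t6 : th * (- X + 16 * D) <= 11 / 12 * (- X + 16 * D) by nra.
lra.
Qed.

Definition dquot (R : realType) d (u : 'rV[R]_d -> R) x p t := t^-1 * (u (x + t *: p) - u x).
Definition dquot2 (R : realType) d (u : 'rV[R]_d -> R) x p t :=
  t^-1 ^+ 2 * (u (x + t *: p) + u (x - t *: p) - 2 * u x).

(** * The maximum principle for the doubled function *)

Section doubling.
Variables (R : realType) (d : nat) (u : 'rV[R]_d -> R).
Variables (b Du : 'rV[R]_d -> 'rV[R]_d) (B H : 'rV[R]_d -> 'M[R]_d).
Hypothesis d0 : (0 < d)%N.
Hypothesis cu : forall x, `|x| <= 1 -> {for x, continuous u}.
Hypothesis u1 : forall x, `|x| <= 1 -> `|u x| <= 1.
Hypothesis uD : forall x p, `|x| < 1 -> dquot u x p t @[t --> 0^'] --> dotv (Du x) p.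
Hypothesis uH : forall x p, `|x| < 1 -> dquot2 u x p t @[t --> 0^'] --> quadf (H x) p.
Hypothesis Bsym : forall x, `|x| < 1 -> (B x)^T = B x.
Hypothesis Bid : forall x i j, `|x| < 1 ->
  `|B x i j - (i == j)%:R| <= (12 * d%:R ^+ 2)^-1.
Hypothesis b1 : forall x i, `|x| < 1 -> `|b x 0 i| <= 1.
Hypothesis eqn : forall x, `|x| < 1 ->
  `|\sum_i \sum_j B x i j * H x i j + dotv (b x) (Du x)| <= 1.

(* A positive maximum of [Z] is interior, by the size of [K] and the term
   [8 |x|^2], and then contradicts the equation; so [0 >= Z 0 y]. *)
Let K : R := 100 * d%:R.
Let Z x y : R := u x - u y - K * psi (x - y) - 8 * dotv x x.

Section at_max.
Variables (x y : 'rV[R]_d).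
Hypotheses (x1 : `|x| < 1) (y1 : `|y| < 1) (xy : x - y != 0).
Hypothesis Zmax : forall x' y', `|x'| <= 1 -> `|y'| <= 1 -> Z x' y' <= Z x y.
Let z := x - y.
Let A := psi z.
Let A0 : 0 < A. Proof. exact: psi_gt0. Qed.
Let K0 : 0 < K. Proof. by rewrite mulr_gt0 // ltr0n. Qed.

Lemma max_grad_l p : dotv (Du x) p <= K * (2 * dotv z p) / (4 * A ^+ 3) + 16 * dotv x p.
Proof.
apply: (cvg_dnbhs_le (c := (K / (4 * A ^+ 3) + 8) * dotv p p)); first exact: uD.
have [e e0 he] := rV_unit_ball_line p x1; exists e => // t /andP[t0 te].
have := Zmax (he t _) (ltW y1); rewrite gtr0_norm // => /(_ te).
rewrite /Z dotvDZ (_ : x + t *: p - y = z + t *: p); last by rewrite addrAC.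
have := psi_tangent p t xy; rewrite -/z -/A => h1 h2.
rewrite /dquot mulrC ler_pdivrMr //.
have h3 : K * psi (z + t *: p) <= K * (A + t * (2 * dotv z p + t * dotv p p) / (4 * A ^+ 3)).
  by rewrite ler_pM2l.
have -> : (K * (2 * dotv z p) / (4 * A ^+ 3) + 16 * dotv x p +
   t * ((K / (4 * A ^+ 3) + 8) * dotv p p)) * t =
   K * (A + t * (2 * dotv z p + t * dotv p p) / (4 * A ^+ 3)) - K * A +
   8 * (t * (2 * dotv x p + t * dotv p p)).
  by field; rewrite gt_eqF.
lra.
Qed.

Lemma max_grad_r p : - dotv (Du y) p <= - (K * (2 * dotv z p) / (4 * A ^+ 3)).
Proof.
apply: (cvg_dnbhs_le (f := fun t => - dquot u y p t)
   (c := (K / (4 * A ^+ 3)) * dotv p p)); first by apply: cvgN; exact: uD.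
have [e e0 he] := rV_unit_ball_line p y1; exists e => // t /andP[t0 te].
have := Zmax (ltW x1) (he t _); rewrite gtr0_norm // => /(_ te).
rewrite /Z (_ : x - (y + t *: p) = z + (- t) *: p); last by rewrite opprD addrA scaleNr.
have := psi_tangent p (- t) xy; rewrite -/z -/A => h1 h2.
rewrite /dquot mulrC -mulNr ler_pdivrMr //.
have h3 : K * psi (z + - t *: p) <= K * (A + - t * (2 * dotv z p + - t * dotv p p) / (4 * A ^+ 3)).
  by rewrite ler_pM2l.
have -> : (- (K * (2 * dotv z p) / (4 * A ^+ 3)) +
   t * (K / (4 * A ^+ 3) * dotv p p)) * t =
   K * (A + - t * (2 * dotv z p + - t * dotv p p) / (4 * A ^+ 3)) - K * A.
  by field; rewrite gt_eqF.
lra.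
Qed.

(** Both points move together, so [x - y] moves along [p - q], and the choice of [q] against [p]
    decides which second difference of [psi] appears. *)
Lemma max_hess p q c : (exists2 e : R, 0 < e & forall t, 0 < t < e ->
    psi (z + t *: (p - q)) + psi (z - t *: (p - q)) - 2 * A <= t ^+ 2 * c) ->
  quadf (H x) p - quadf (H y) q <= K * c + 16 * dotv p p.
Proof.
move=> [e0 e00 hc].
apply: (cvg_dnbhs_le (f := fun t => dquot2 u x p t - dquot2 u y q t) (c := 0)).
  by apply: cvgB; exact: uH.
have [e1 e10 he1] := rV_unit_ball_line p x1.
have [e2 e20 he2] := rV_unit_ball_line q y1.
exists (Num.min e0 (Num.min e1 e2)); first by rewrite !lt_min e00 e10 e20.
move=> t /andP[t0]; rewrite !lt_min => /and3P[te0 te1 te2].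
have tn : `|t| = t by rewrite gtr0_norm.
have := Zmax (he1 t _) (he2 t _); rewrite tn => /(_ te1 te2).
have := Zmax (he1 (- t) _) (he2 (- t) _); rewrite normrN tn => /(_ te1 te2).
rewrite /Z !dotvDZ.
rewrite (_ : x + - t *: p - (y + - t *: q) = z - t *: (p - q)); last first.
  by rewrite /z scalerBr !scaleNr !opprD !opprK addrACA.
rewrite (_ : x + t *: p - (y + t *: q) = z + t *: (p - q)); last first.
  by rewrite /z scalerBr !opprD addrACA.
rewrite !scaleNr => h1 h2; have := hc t _; rewrite t0 => /(_ te0) h3.
rewrite -/z -/A in h1 h2.
have {h3} : K * (psi (z + t *: (p - q)) + psi (z - t *: (p - q)) - 2 * A) <= K * (t ^+ 2 * c).
  by rewrite ler_pM2l.
move=> h3; rewrite mulr0 addr0 /dquot2 -mulrBr mulrC exprVn ler_pdivrMr ?exprn_gt0 //.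
lra.
Qed.

Lemma max_hess_gen p q :
  quadf (H x) p - quadf (H y) q <= K * (dotv (p - q) (p - q) / (2 * A ^+ 3)) + 16 * dotv p p.
Proof. by apply: max_hess; exists 1 => // t _; exact: psi_diff2. Qed.

Lemma max_hess_radial p q (s : R) : p - q = s *: z ->
  quadf (H x) p - quadf (H y) q <= K * (- s ^+ 2 / 4 * A) + 16 * dotv p p.
Proof.
(* This radius ensures [|t * s| <= 1], the range of [sqrt_diff2]. *)
move=> pq; apply: max_hess; rewrite pq; exists (`|s| + 1)^-1.
  by rewrite invr_gt0 ltr_wpDl.
move=> t /andP[t0]; rewrite -[_^-1]mul1r ltr_pdivlMr ?ltr_wpDl // => ts.
rewrite scalerA (_ : t ^+ 2 * _ = - (t * s) ^+ 2 / 4 * psi z); last by rewrite /A; ring.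
apply: psi_diff2_radial => //; rewrite normrM (gtr0_norm t0).
have := normr_ge0 s; nra.
Qed.

(* The second-order conditions are used in the directions [(e i, R (e i))], with
   [R] the reflection along [x - y], where the strict concavity of [psi] on
   [x - y] makes [\tr (H x) - \tr (H y)] very negative; [trace_upper] controls the
   deviation of [B] from the identity. *)
Lemma max_absurd : K * A < 2 -> False.
Proof.
move=> KA; have d1 : 1 <= d%:R :> R by rewrite ler1n.
set D : R := d%:R in d1.
have Kd : K = 100 * D by [].
have sumd (a : R) : \sum_(i < d) a = D * a by rewrite sumr_const card_ord mulr_natl.
have quadf0 (G : 'M[R]_d) : quadf G 0 = 0 by rewrite /quadf !mul0mx mxE.
have dotvN (p : 'rV[R]_d) : dotv (- p) (- p) = dotv p p.
  by apply: eq_bigr => i _; rewrite !mxE mulrNN.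
have A30 : 0 < A ^+ 3 by rewrite exprn_gt0.
set X := K / A ^+ 3.
have X0 : 0 < X by rewrite divr_gt0.
(* Moving one point alone gives one-sided bounds on [H x] and on [- H y], in the form required by
   [trace_upper]. *)
have c1 p : quadf (H x) p <= (X / 2 + 16) * dotv p p.
  have := max_hess_gen p 0; rewrite quadf0 !subr0 /X => h; apply: (le_trans h).
  by rewrite le_eqVlt; apply/orP; left; apply/eqP; field; rewrite gt_eqF.
have c2 q : quadf (- H y) q <= X / 2 * dotv q q.
  have := max_hess_gen 0 q; rewrite quadf0 !sub0r dotvN (_ : dotv 0 0 = 0); last first.
    by rewrite /dotv big1 // => i _; rewrite mxE mul0r.
  rewrite mulr0 addr0 quadfN => h; apply: (le_trans h).
  by rewrite /X le_eqVlt; apply/orP; left; apply/eqP; field; rewrite gt_eqF.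
have Dn0 : D != 0 by rewrite gt_eqF //; lra.
have X16 : 0 <= X / 2 + 16 by lra.
have X20 : 0 <= X / 2 by lra.
have t1 := trace_upper (Bsym x1) (fun i j => Bid i j x1) X16 c1.
have t2 := trace_upper (Bsym y1) (fun i j => Bid i j y1) X20 c2.
(* The tolerance in [Bid] is chosen so that the error of [trace_upper] is [c / 4]. *)
have e1 : 3 * D ^+ 2 * (12 * D ^+ 2)^-1 = 1 / 4 by field.
rewrite -/D e1 in t1 t2.
have -> : False = (2 <= 1 :> R) by rewrite propeqE; split => //; lra.
(* With [s_i = 2 z_i / A^4] the sum of the [s_i^2] is [4 / A^4], because [dotv z z = A^4]; so the
   radial gains [- K s_i^2 A / 4] add up to exactly [- X]. *)
have t3 : \tr (H x) - \tr (H y) <= - X + 16 * D.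
  have zz : (2 / A ^+ 4) * dotv z z = 2 by rewrite -psi4 -/A divfK // expf_neq0 // gt_eqF.
  rewrite -(reflection_trace (H y) zz) /mxtrace -sumrB.
  have -> : - X + 16 * D = \sum_i (K * (- (2 / A ^+ 4 * z 0 i) ^+ 2 / 4 * A) + 16).
    rewrite big_split /= sumd -mulr_sumr [D * 16]mulrC; congr (_ + _).
    have -> : \sum_(i < d) - (2 / A ^+ 4 * z 0 i) ^+ 2 / 4 * A =
      - (A ^+ 7)^-1 * dotv z z.
      rewrite /dotv mulr_sumr; apply: eq_bigr => i _.
      by field; rewrite gt_eqF.
    by rewrite -psi4 -/A /X; field; rewrite gt_eqF.
  apply: ler_sum => i _; rewrite -quadf_delta.
  have := @max_hess_radial (delta_mx 0 i) (delta_mx 0 i - (2 / A ^+ 4 * z 0 i) *: z) (2 / A ^+ 4 * z 0 i).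
  have -> : dotv (delta_mx 0 i : 'rV[R]_d) (delta_mx 0 i) = 1 by rewrite dotv_delta mxE !eqxx.
  rewrite mulr1; apply; by rewrite opprB addrC subrK.
have KA' : 100 * D * A < 2 by rewrite -Kd.
have A2 : A < 1 / (50 * D) by rewrite ltr_pdivlMr; lra.
have dotb (v w : 'rV[R]_d) (c : R) : 0 <= c -> (forall i, `|v 0 i| <= c) ->
    (forall i, `|w 0 i| <= 1) -> `|dotv v w| <= D * c.
  move=> c0 hv hw; apply: (le_trans (ler_norm_sum _ _ _)); rewrite -sumd.
  apply: ler_sum => i _; rewrite normrM -[leRHS]mulr1; exact: ler_pM.
have zA i : `|z 0 i| <= A ^+ 2 by exact: psi_coord.
have g1 := max_grad_l (b x); have g2 := max_grad_r (b y).
have b1x := dotb z (b x) _ (sqr_ge0 A) zA (fun i => b1 i x1).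
have b1y := dotb z (b y) _ (sqr_ge0 A) zA (fun i => b1 i y1).
have b2 := dotb x (b x) 1 ler01
  (fun i => le_trans (rV_norm_coord x i) (ltW x1)) (fun i => b1 i x1).
have bC (v w : 'rV[R]_d) : dotv v w = dotv w v by apply: eq_bigr => i _; rewrite mulrC.
have := eqn x1; have := eqn y1; rewrite !(bC (b _)).
have gX v : K * (2 * v) / (4 * A ^+ 3) = X / 2 * v by rewrite /X; field; rewrite gt_eqF.
rewrite !gX in g1 g2.
have -> : \sum_i \sum_j B y i j * H y i j = - \sum_i \sum_j B y i j * (- H y) i j.
  rewrite -sumrN; apply: eq_bigr => i _; rewrite -sumrN; apply: eq_bigr => j _.
  by rewrite mxE mulrN opprK.
move: b1x b1y b2; rewrite !ler_norml => /andP[_ b1x] /andP[b1y _] /andP[_ b2].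
move=> /andP[_ Ey] /andP[Ex _].
have Ny : \tr (- H y) = - \tr (H y) by rewrite raddfN.
rewrite Ny in t2.
have g1' : dotv (Du x) (b x) <= X / 2 * (D * A ^+ 2) + 16 * D.
  by apply: (le_trans g1); apply: lerD; [apply: ler_wpM2l|rewrite ler_pM2l // -[leRHS]mulr1].
have g2' : - dotv (Du y) (b y) <= X / 2 * (D * A ^+ 2).
  by apply: (le_trans g2); rewrite -mulrN; apply: ler_wpM2l => //; lra.
set th := 1 - D * (12 * D ^+ 2)^-1 in t1 t2.
have th1 : 11 / 12 <= th.
  rewrite /th (_ : D * _ = D^-1 / 12); last by field.
  have D1 : D^-1 <= 1 by rewrite invf_le1 // ltr0n.
  lra.
have th2 : th <= 1.
  by rewrite /th gerBl mulr_ge0 ?invr_ge0 ?mulr_ge0 ?ler0n ?sqr_ge0.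
have XK : K <= X.
  rewrite /X ler_pdivlMr // -[leRHS]mulr1 ler_pM2l //; apply: exprn_ile1; first exact: ltW.
  apply: (le_trans (ltW A2)); rewrite ler_pdivrMr ?mulr_gt0 ?ltr0n // mul1r.
  by apply: (le_trans d1); rewrite ler_peMl // ler1n.
by have := doubling_arith d1 A0 KA' XK th1 th2 t3 t1 t2 g1' g2' Ex Ey.
Qed.

End at_max.

Lemma doubling y : `|y| <= 1 -> u 0 - u y <= 100 * d%:R * psi y.
Proof.
move=> y1; rewrite -/K leNgt; apply/negP => uy.
have dotv00 : dotv (0 : 'rV[R]_d) 0 = 0 by rewrite /dotv big1 // => i _; rewrite mxE mul0r.
have psiN (p : 'rV[R]_d) : psi (- p) = psi p.
  by rewrite /psi; do 2 congr Num.sqrt; apply: eq_bigr => i _; rewrite !mxE mulrNN.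
have Zy : 0 < Z 0 y by rewrite /Z sub0r psiN dotv00 mulr0 subr0 subr_gt0.
pose C := [set x : 'rV[R]_d | `|x| <= 1].
have Cc : compact C.
  have CE : C = closed_ball 0 1.
    by rewrite closed_ballE //; apply/seteqP; split => x; rewrite /C /closed_ball_ /= sub0r normrN.
  apply: bounded_closed_compact; last by rewrite CE; exact: closed_ball_closed.
  by exists 1; split => [|M M1 x /= x1]; [exact: num_real|exact: (le_trans x1 (ltW M1))].
have C0 : C 0 by rewrite /C /= normr0.
have [|||[x x'] /set_mem [/= x1 x'1] Zmax] := @compact_EVT_max _ R (fun w : 'rV[R]_d * 'rV[R]_d => Z w.1 w.2) (C `*` C).
- by exists (0, 0).
- exact: compact_setX.
- apply: continuous_in_subspaceT => -[v w] /set_mem[/= v1 w1].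
  apply: cvgB; first apply: cvgB; first apply: cvgB.
  + by apply: (@continuous_comp _ _ _ fst u); [exact: cvg_fst|exact: cu].
  + by apply: (@continuous_comp _ _ _ snd u); [exact: cvg_snd|exact: cu].
  + apply: cvgM; first exact: cvg_cst.
    apply: (@continuous_comp _ _ _ (fun w : 'rV[R]_d * 'rV[R]_d => w.1 - w.2) (@psi R d)); last exact: psi_continuous.
    by apply: cvgB; [exact: cvg_fst|exact: cvg_snd].
  + apply: cvgM; first exact: cvg_cst.
    apply: (@continuous_comp _ _ _ fst (fun x : 'rV[R]_d => dotv x x)); [exact: cvg_fst|exact: dotv_continuous].
have {}Zmax v w : `|v| <= 1 -> `|w| <= 1 -> Z v w <= Z x x'.
  by move=> v1 w1; apply: (Zmax (v, w)); rewrite inE.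
have Zp : 0 < Z x x' by apply: (lt_le_trans Zy); apply: Zmax => //; rewrite normr0.
have d1 : 1 <= d%:R :> R by rewrite ler1n.
have := u1 x1; have := u1 x'1; rewrite !ler_norml => /andP[h1 h2] /andP[h3 h4].
have pg := psi_ge0 (x - x'); have dg := dotv_ge0 x.
(* Positivity of [Z] and [u x - u x' <= 2] leave each penalty below [2]: the coefficient [8] then
   puts [x] in the half cube, and the factor [100] keeps [x'] close to [x]. *)
have Kp : 100 * psi (x - x') <= K * psi (x - x').
  by apply: ler_wpM2r => //; rewrite /K; lra.
have hK : K * psi (x - x') < 2 by move: Zp; rewrite /Z; lra.
have hx : dotv x x < 1 / 4 by move: Zp; rewrite /Z; lra.
have hxi i : `|x 0 i| < 1 / 2.
  have := dotv_coord x i; rewrite -ltr_sqr ?nnegrE // real_normK ?num_real //.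
  move=> h; apply: (le_lt_trans h); lra.
have x1' : `|x| < 1 by apply: rV_norm_lt => // i; have := hxi i; lra.
have x1'' : `|x'| < 1.
  apply: rV_norm_lt => // i.
  have : `|(x - x') 0 i| < 1 / 2.
    apply: (le_lt_trans (psi_coord _ i)); nra.
  have := hxi i; rewrite !mxE !ltr_norml => /andP[? ?] /andP[? ?]; lra.
have xx' : x - x' != 0.
  apply/eqP => e; move: Zp; rewrite /Z e psi0 mulr0 subr0 (_ : x' = x).
    by rewrite subrr sub0r; lra.
  by move/eqP: e; rewrite subr_eq0 => /eqP.
exact: (max_absurd x1' x1'' xx' Zmax hK).
Qed.
End doubling.

(** * Difference quotients of functions with continuous partial derivatives *)

Section partial_derivatives.
Variables (R : realType) (d : nat).
Implicit Types (f : 'rV[R]_d -> R) (x y p : 'rV[R]_d).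

Local Notation e i := (delta_mx 0 i : 'rV[R]_d).

(** Partial derivatives exist nearby but are continuous only at [x]. This pointwise form is stable
    under sums, products, inverses and square roots. *)
Definition C1_at f x := [/\ \forall y \near x, forall i, derivable f y (e i),
  f y @[y --> x] --> f x & forall i, partial i f y @[y --> x] --> partial i f x].

Lemma smooth_on_C1_at (O : set 'rV[R]_d) f (s : seq 'I_d) x : open O -> smooth_on O f ->
  O x -> C1_at (foldr (@partial R d) f s) x.
Proof.
move=> oO fO Ox; split; [|by have [] := fO s _ Ox|by move=> i; have [] := fO (i :: s) _ Ox].
have : nbhs x O by exact: open_nbhs_nbhs.
by apply: filterS => y Oy i; have [_] := fO s _ Oy; exact.
Qed.

Lemma is_derive_line f y i (s : R) : derivable f (y + s *: e i) (e i) ->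
  is_derive s 1 (fun t : R => f (y + t *: e i)) (partial i f (y + s *: e i)).
Proof.
move=> df.
have eqf : (fun h : R => h^-1 *: (((fun t : R => f (y + t *: e i)) \o shift s) (h *: 1) - f (y + s *: e i)))
  = (fun h : R => h^-1 *: ((f \o shift (y + s *: e i)) (h *: e i) - f (y + s *: e i))).
  apply/funext => h /=; congr (_ *: (f _ - _)).
  by rewrite [h *: 1]mulr1 scalerDl addrCA.
by apply: DeriveDef; [rewrite /derivable eqf|rewrite /partial /derive eqf].
Qed.

(** Mean value theorem on the segment, which stays in the ball by convexity. A negative [s] is
    reduced to a positive one by exchanging the end points. *)
Lemma partial_increment f x i (c del eps : R) :
  (forall y, `|y - x| < del -> derivable f y (e i) /\ `|partial i f y - c| <= eps) ->
  forall y s, `|y - x| < del -> `|y + s *: e i - x| < del ->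
  `|f (y + s *: e i) - f y - c * s| <= eps * `|s|.
Proof.
move=> fx.
suff pos y s : 0 < s -> `|y - x| < del -> `|y + s *: e i - x| < del ->
    `|f (y + s *: e i) - f y - c * s| <= eps * `|s|.
  move=> y s yx ysx; have [s0|s0|->] := ltgtP s 0; last first.
  - by rewrite scale0r addr0 subrr mulr0 subrr normr0 mulr0.
  - exact: pos.
  - have := pos (y + s *: e i) (- s); rewrite oppr_gt0 => /(_ s0 ysx).
    rewrite [- s *: _]scaleNr addrK => /(_ yx).
    rewrite normrN => h; rewrite -[leLHS]normrN (_ : - (f (y + s *: e i) - f y - c * s) = f y - f (y + s *: e i) - c * - s) //.
    by ring.
move=> s0 yx ysx.
have conv t : 0 <= t <= s -> `|y + t *: e i - x| < del.
  move=> /andP[t0 ts].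
  have -> : y + t *: e i - x = (1 - t / s) *: (y - x) + (t / s) *: (y + s *: e i - x).
    by apply/rowP => j; rewrite !mxE; field; rewrite gt_eqF.
  apply: (le_lt_trans (ler_normD _ _)); rewrite (normrZ (1 - t / s)) (normrZ (t / s)).
  have t1 : 0 <= t / s by rewrite divr_ge0 // ltW.
  have t2 : t / s <= 1 by rewrite ler_pdivrMr // mul1r.
  rewrite (ger0_norm t1) (@ger0_norm _ (1 - t / s)) ?subr_ge0 //.
  apply: (@le_lt_trans _ _ (Num.max `|y - x| `|y + s *: e i - x|)); last by rewrite gt_max yx.
  have m1 : `|y - x| <= Num.max `|y - x| `|y + s *: e i - x| by rewrite le_max lexx.
  have m2 : `|y + s *: e i - x| <= Num.max `|y - x| `|y + s *: e i - x| by rewrite le_max lexx orbT.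
  set a := t / s in t1 t2 *; nra.
pose g (t : R) : R := f (y + t *: e i); pose dg (t : R) : R := partial i f (y + t *: e i).
have dgP (t : R) : t \in `[0, s]%R -> is_derive t 1 g (dg t).
  rewrite in_itv /= => ts; apply: is_derive_line.
  by have [] := fx _ (conv _ ts).
have cg : {within `[0, s], continuous g}.
  by apply: derivable_within_continuous => t ts; have [] := dgP t ts.
have [t] := MVT s0 (fun t (tin : t \in `]0, s[%R) => dgP t (subset_itv_oo_cc tin)) cg.
rewrite in_itv /= => /andP[t0 ts]; rewrite /g /dg scale0r addr0 subr0 => ->.
rewrite -mulrBl normrM ler_wpM2r //.
by have [|_] := fx (y + t *: e i); first by apply: conv; rewrite !ltW.
Qed.

Lemma C1_at_ball f x : C1_at f x -> forall eps, 0 < eps ->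
  exists2 del, 0 < del & forall i y, `|y - x| < del ->
    derivable f y (e i) /\ `|partial i f y - partial i f x| <= eps.
Proof.
move=> [fd _ fc] eps eps0.
have : \forall y \near x, (forall i, derivable f y (e i)) /\
    forall i, `|partial i f y - partial i f x| <= eps.
  near=> y; split; first by near: y.
  near: y; apply: filter_forall => i.
  have /cvgrPdist_le /(_ eps eps0) := fc i.
  by apply: filterS => y; rewrite distrC.
move=> /nbhs_ballP[del /= del0 h]; exists del => // i y yx.
have [|h1 h2] := h y; first by rewrite -ball_normE /= distrC.
by split; [exact: h1|exact: h2].
Unshelve. all: by end_near. Qed.

(** The increment is travelled one coordinate at a time, by induction over the list of coordinates;
    [partial_increment] controls each new leg, uniformly in its starting point near [x]. *)
Lemma dquot_cvg f x p : C1_at f x ->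
  dquot f x p t @[t --> 0^'] --> dotv (\row_i partial i f x) p.
Proof.
move=> fC1; rewrite {1}(row_sum_delta p) /dotv.
under [X in _ --> X]eq_bigr do rewrite mxE.
move: (index_enum _) => r; elim: r => [|i r IHr].
  rewrite big_nil (_ : (fun _ => _) = cst 0); first exact: cvg_cst.
  by apply/funext => t; rewrite /dquot big_nil scaler0 addr0 subrr mulr0.
rewrite !big_cons; set v := \sum_(j <- r) p 0 j *: e j in IHr *.
rewrite (_ : (fun _ => _) = (fun t => t^-1 * (f (x + t *: v + (t * p 0 i) *: e i) - f (x + t *: v)) + dquot f x v t)); last first.
  apply/funext => t; rewrite /dquot -mulrDr addrA subrK scalerDr scalerA; congr (_ * (f _ - _)).
  by rewrite addrA addrAC.
apply: cvgD => //; apply/cvgrPdist_le => eps eps0.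
have eps1 : 0 < eps / (`|p 0 i| + 1) by rewrite divr_gt0 // ltr_wpDl.
have [del del0 h] := C1_at_ball fC1 eps1.
near=> t; have t0 : t != 0 by near: t; exact: nbhs_dnbhs_neq.
have td : `|t| * (`|v| + `|p 0 i| * `|e i| + 1) < del.
  rewrite -ltr_pdivlMr ?ltr_wpDl ?addr_ge0 ?mulr_ge0 //.
  near: t; apply: dnbhs0_lt; by rewrite divr_gt0 // ltr_wpDl ?addr_ge0 ?mulr_ge0.
have e1 : `|x + t *: v - x| < del.
  rewrite addrAC subrr add0r normrZ; apply: le_lt_trans td.
  by rewrite ler_wpM2l // -addrA lerDl addr_ge0 ?mulr_ge0.
have e2 : `|x + t *: v + (t * p 0 i) *: e i - x| < del.
  rewrite addrAC (addrAC x) subrr add0r; apply: le_lt_trans td; apply: (le_trans (ler_normD _ _)).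
  by rewrite !normrZ -mulrA -mulrDr ler_wpM2l // lerDl.
have := partial_increment (h i) e1 e2; set a := f _ - f _ => ha.
rewrite distrC (_ : _ - _ = t^-1 * (a - partial i f x * (t * p 0 i))); last by field.
rewrite normrM normrV ?unitfE // ler_pdivrMl ?normr_gt0 //; apply: (le_trans ha).
rewrite normrM mulrCA ler_wpM2l // mulrAC ler_pdivrMr ?ltr_wpDl // ler_pM2l //.
by rewrite lerDl.
Unshelve. all: by end_near. Qed.

Definition grad f x : 'rV[R]_d := \row_i partial i f x.
Definition hess f x : 'M[R]_d := \matrix_(i, j) partial i (partial j f) x.

Lemma is_derive_C1_line f x p (t : R) : C1_at f (x + t *: p) ->
  is_derive t 1 (fun s : R => f (x + s *: p)) (dotv (grad f (x + t *: p)) p).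
Proof.
move=> /(@dquot_cvg _ _ p) h.
have eqf : (fun h : R => h^-1 *: (((fun s : R => f (x + s *: p)) \o shift t) (h *: 1) - f (x + t *: p)))
  = dquot f (x + t *: p) p.
  apply/funext => s /=; rewrite /dquot; congr (_ * (f _ - _)).
  by rewrite [s *: 1]mulr1 scalerDl addrCA addrC.
apply: DeriveDef; first by rewrite /derivable eqf; apply/cvg_ex; eexists; exact: h.
by rewrite /derive eqf; exact: (cvg_lim _ h).
Qed.

(** Apply the mean value theorem to [g], the symmetric second difference minus [q * s ^+ 2]. Its
    derivative is [s * (G s - 2 * q)], where [G] is made of difference quotients of the first
    partial derivatives based at [x], so [dquot_cvg] applies to them. *)
Lemma dquot2_cvg f x p : (\forall y \near x, C1_at f y) ->
  (forall i, C1_at (partial i f) x) ->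
  dquot2 f x p t @[t --> 0^'] --> quadf (hess f x) p.
Proof.
move=> f1 f2; set q := quadf _ _.
pose G t := \sum_i p 0 i * (dquot (partial i f) x p t - dquot (partial i f) x (- p) t).
have Gq : G t @[t --> 0^'] --> 2 * q.
  have -> : 2 * q = \sum_i p 0 i * (dotv (grad (partial i f) x) p - dotv (grad (partial i f) x) (- p)).
    rewrite /q quadf_sum exchange_big mulr_sumr; apply: eq_bigr => i _ /=.
    rewrite /dotv -sumrB !mulr_sumr; apply: eq_bigr => j _.
    by rewrite !mxE; ring.
  apply: cvg_sumr => i _; apply: cvgM; first exact: cvg_cst.
  by apply: cvgB; exact: dquot_cvg.
have : \forall y \near x, C1_at f y by [].
move=> /nbhs_ballP[d1 /= d10 hd1].
apply/cvgrPdist_le => eps eps0.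
have /cvgrPdist_le /(_ eps eps0) := Gq.
move=> /nbhs_ballP[d2 /= d20 hd2].
(* The second difference is even in [t], so positive [t] suffices. *)
suff main : \forall t \near (0 : R)^', `|q - dquot2 f x p `|t| | <= eps.
  apply: filterS main => t; have [t0|t0] := lerP 0 t; first by rewrite (ger0_norm t0).
  rewrite (ltr0_norm t0) (_ : dquot2 f x p (- t) = dquot2 f x p t) //.
  by rewrite /dquot2 invrN sqrrN !scaleNr opprK [f _ + _]addrC.
near=> t.
have : t != 0 by near: t; exact: nbhs_dnbhs_neq.
rewrite -normr_gt0; have : `|t| < d2 by near: t; exact: dnbhs0_lt.
have : `|t| < d1 / (`|p| + 1) by near: t; apply: dnbhs0_lt; rewrite divr_gt0 // ltr_wpDl.
move: `|t| => T td1 td2 T0.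
pose g (s : R) : R := f (x + s *: p) + f (x + s *: - p) - (2 * f x + q * s ^+ 2).
pose dg (s : R) : R := dotv (grad f (x + s *: p)) p + dotv (grad f (x + s *: - p)) (- p) - q * (2 * s).
have dgP (s : R) : s \in `[0, T]%R -> is_derive s 1 g (dg s).
  rewrite in_itv /= => /andP[s0 st].
  have sd1 : s * `|p| < d1.
    apply: le_lt_trans (_ : T * (`|p| + 1) < _); last by rewrite -ltr_pdivlMr // ltr_wpDl.
    by apply: ler_pM => //; rewrite lerDl.
  have h1 : C1_at f (x + s *: p).
    by apply: hd1; rewrite -ball_normE /= opprD addrA subrr add0r normrN normrZ ger0_norm.
  have h2 : C1_at f (x + s *: - p).
    by apply: hd1; rewrite -ball_normE /= opprD addrA subrr add0r normrN normrZ normrN ger0_norm.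
  have l1 := is_derive_C1_line h1; have l2 := is_derive_C1_line h2.
  rewrite /g; apply: is_derive_eq; rewrite /dg /=.
  congr (_ - _); rewrite /GRing.scale /=; ring.
have cg : {within `[0, T], continuous g}.
  by apply: derivable_within_continuous => s sT; have [] := dgP s sT.
have [s] := MVT T0 (fun s (sin : s \in `]0, T[%R) => dgP s (subset_itv_oo_cc sin)) cg.
rewrite in_itv /= => /andP[s0 sT]; rewrite subr0.
have -> : g 0 = 0 by rewrite /g !scale0r addr0; ring.
rewrite subr0 => gT.
have dgs : dg s = s * (G s - 2 * q).
  rewrite /dg mulrBr; congr (_ - _); last by ring.
  rewrite /G mulr_sumr /dotv -big_split /=; apply: eq_bigr => i _.
  by rewrite !mxE /dquot; field; rewrite gt_eqF.
have : `|2 * q - G s| <= eps.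
  apply: hd2; last by rewrite gt_eqF.
  rewrite -ball_normE /= sub0r normrN gtr0_norm //; exact: lt_trans td2.
have -> : q - dquot2 f x p T = - (T ^+ 2)^-1 * g T.
  by rewrite /dquot2 /g scalerN; field; rewrite gt_eqF.
rewrite gT dgs => h.
rewrite (_ : - _ * _ = (s / T) * (2 * q - G s)); last by field; rewrite gt_eqF.
have sT0 : 0 <= s / T by rewrite divr_ge0 // ltW.
rewrite normrM (ger0_norm sT0); apply: (le_trans _ h).
by rewrite ler_piMl // ler_pdivrMr // mul1r ltW.
Unshelve. all: by end_near. Qed.

Lemma continuous_near_eq f g x : (\forall y \near x, f y = g y) ->
  f y @[y --> x] --> f x -> g y @[y --> x] --> g x.
Proof.
move=> fg fc; rewrite -(nbhs_singleton fg).
exact: cvg_trans (near_eq_cvg fg) fc.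
Qed.

Lemma C1_at_near_eq f g x : (\forall y \near x, f y = g y) -> C1_at f x -> C1_at g x.
Proof.
move=> fg [fd fc f'c].
have fg2 : \forall y \near x, \forall z \near y, f z = g z by exact: near_join.
split.
- by apply: filterS2 fd fg2 => y fy fgy i; exact: (near_eq_derivable fgy (fy i)).
- exact: continuous_near_eq fc.
- move=> i; have e1 : \forall y \near x, partial i f y = partial i g y.
    by apply: filterS fg2 => y fgy; exact: near_eq_derive.
  by apply: (continuous_near_eq e1).
Unshelve. all: by end_near. Qed.

Lemma C1_at_cst (c : R) x : C1_at (fun=> c) x.
Proof.
split; first by near=> y => i; exact: derivable_cst.
  exact: (@cvg_cst _ c _ (nbhs x)).
move=> i; rewrite (_ : partial i _ = cst 0); first exact: (@cvg_cst _ (0 : R) _ (nbhs x)).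
by apply/funext => y; rewrite /partial; exact: derive_cst.
Unshelve. all: by end_near. Qed.

Lemma C1_atD f g x : C1_at f x -> C1_at g x -> C1_at (fun y => f y + g y) x.
Proof.
move=> [fd fc f'c] [gd gc g'c]; split.
- by apply: filterS2 fd gd => y fy gy i; exact: (derivableD (fy i) (gy i)).
- exact: (cvgD fc gc).
- move=> i; have e1 : \forall y \near x, partial i f y + partial i g y = partial i (fun y => f y + g y) y.
    by apply: filterS2 fd gd => y fy gy; rewrite /partial [RHS](deriveD (fy i) (gy i)).
  exact: (continuous_near_eq e1 (cvgD (f'c i) (g'c i))).
Unshelve. all: by end_near. Qed.

Lemma C1_atM f g x : C1_at f x -> C1_at g x -> C1_at (fun y => f y * g y) x.
Proof.
move=> [fd fc f'c] [gd gc g'c]; split.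
- by apply: filterS2 fd gd => y fy gy i; exact: (derivableM (fy i) (gy i)).
- exact: (cvgM fc gc).
- move=> i; have e1 : \forall y \near x,
      f y * partial i g y + g y * partial i f y = partial i (fun y => f y * g y) y.
    by apply: filterS2 fd gd => y fy gy; rewrite /partial [RHS](deriveM (fy i) (gy i)).
  exact: (continuous_near_eq e1 (cvgD (cvgM fc (g'c i)) (cvgM gc (f'c i)))).
Unshelve. all: by end_near. Qed.

Lemma C1_atV f x : f x != 0 -> C1_at f x -> C1_at (fun y => (f y)^-1) x.
Proof.
move=> fx0 [fd fc f'c].
have fn0 : \forall y \near x, f y != 0 by exact: (cvgr_neq0 _ fc).
split.
- by apply: filterS2 fd fn0 => y fy yn0 i; exact: (derivableV yn0 (fy i)).
- exact: (cvgV fx0 fc).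
- move=> i; have e1 : \forall y \near x,
      - (f y * f y)^-1 * partial i f y = partial i (fun y => (f y)^-1) y.
    by apply: filterS2 fd fn0 => y fy yn0; rewrite /partial (deriveV yn0 (fy i)).
  have f2 : f x * f x != 0 by rewrite mulf_neq0.
  exact: (continuous_near_eq e1 (cvgM (cvgN (cvgV f2 (cvgM fc fc))) (f'c i))).
Unshelve. all: by end_near. Qed.

(** Multiplication by the conjugate writes the quotient as [Q h] over a sum of two roots. Continuity
    of [f] along the line is read off from the convergence of [Q]. *)
Lemma derive_sqrt_cvg f y v : 0 < f y -> derivable f y v ->
  h^-1 *: (((fun z => Num.sqrt (f z)) \o shift y) (h *: v) - Num.sqrt (f y)) @[h --> 0^']
    --> (2 * Num.sqrt (f y))^-1 * 'D_v f y.
Proof.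
move=> fy0 fd.
pose Q (h : R) : R := h^-1 *: ((f \o shift y) (h *: v) - f y).
have Qc : Q h @[h --> 0^'] --> 'D_v f y by exact: fd.
have fc : f (h *: v + y) @[h --> (0 : R)^'] --> f y.
  have e1 : \forall h \near (0 : R)^', f y + h * Q h = f (h *: v + y).
    near=> h; have h0 : h != 0 by near: h; exact: nbhs_dnbhs_neq.
    by rewrite /Q /GRing.scale /= mulrA divff // mul1r addrC subrK.
  apply: cvg_trans; first exact: (near_eq_cvg e1).
  have l0 : h @[h --> (0 : R)^'] --> (0 : R) by apply: cvg_within_filter; exact: cvg_id.
  have := cvgD (cvg_cst (f y)) (cvgM l0 Qc); rewrite mul0r addr0; exact.
have sc : Num.sqrt (f (h *: v + y)) @[h --> (0 : R)^'] --> Num.sqrt (f y).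
  by apply: continuous_cvg => //; exact: sqrt_continuous.
have s0 : 0 < Num.sqrt (f y) by rewrite sqrtr_gt0.
have e2 : \forall h \near (0 : R)^', (Num.sqrt (f (h *: v + y)) + Num.sqrt (f y))^-1 * Q h =
  h^-1 *: (((fun z => Num.sqrt (f z)) \o shift y) (h *: v) - Num.sqrt (f y)).
  near=> h; have h0 : h != 0 by near: h; exact: nbhs_dnbhs_neq.
  have fp : 0 < f (h *: v + y) by near: h; exact: (cvgr_gt _ fc).
  rewrite /Q /GRing.scale /=; set a := f _ in fp *.
  have ea := sqr_sqrtr (ltW fp); have ey := sqr_sqrtr (ltW fy0).
  have : Num.sqrt a + Num.sqrt (f y) != 0 by rewrite gt_eqF // ltr_wpDl // sqrtr_ge0.
  move: (Num.sqrt a) (Num.sqrt (f y)) ea ey => sa sy <- <- n0.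
  by field; rewrite h0 n0.
apply: cvg_trans; first exact: (near_eq_cvg e2).
apply: cvgM => //; apply: cvgV; first by rewrite mulf_neq0 // gt_eqF.
by rewrite mulr_natl mulr2n; apply: cvgD => //; exact: cvg_cst.
Unshelve. all: by end_near. Qed.

Lemma C1_at_sqrt f x : 0 < f x -> C1_at f x -> C1_at (fun y => Num.sqrt (f y)) x.
Proof.
move=> fx0 [fd fc f'c].
have fp : \forall y \near x, 0 < f y by exact: (cvgr_gt _ fc).
have sc : Num.sqrt (f y) @[y --> x] --> Num.sqrt (f x).
  exact: (continuous_cvg _ (@sqrt_continuous R (f x)) fc).
split; [|exact: sc|].
- apply: filterS2 fd fp => y fy y0 i; apply/cvg_ex; eexists.
  exact: (derive_sqrt_cvg y0 (fy i)).
- move=> i; have e1 : \forall y \near x,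
      (2 * Num.sqrt (f y))^-1 * partial i f y = partial i (fun y => Num.sqrt (f y)) y.
    apply: filterS2 fd fp => y fy y0; apply/esym/cvg_lim => //.
    exact: (derive_sqrt_cvg y0 (fy i)).
  have f2 : 2 * Num.sqrt (f x) != 0 by rewrite mulf_neq0 // gt_eqF // sqrtr_gt0.
  exact: (continuous_near_eq e1 (cvgM (cvgV f2 (cvgM (cvg_cst (2 : R)) sc)) (f'c i))).
Unshelve. all: by end_near. Qed.

Lemma C1_at_sum (I : Type) (r : seq I) (P : pred I) (F : I -> 'rV[R]_d -> R) x :
  (forall i, C1_at (F i) x) -> C1_at (fun y => \sum_(i <- r | P i) F i y) x.
Proof.
move=> h; elim: r => [|i r IH].
  by under eq_fun do rewrite big_nil; exact: C1_at_cst.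
by case Pi : (P i); under eq_fun do rewrite big_cons Pi; [exact: C1_atD|].
Qed.

Lemma C1_at_prod (I : Type) (r : seq I) (P : pred I) (F : I -> 'rV[R]_d -> R) x :
  (forall i, C1_at (F i) x) -> C1_at (fun y => \prod_(i <- r | P i) F i y) x.
Proof.
move=> h; elim: r => [|i r IH].
  by under eq_fun do rewrite big_nil; exact: C1_at_cst.
by case Pi : (P i); under eq_fun do rewrite big_cons Pi; [exact: C1_atM|].
Qed.

Lemma C1_at_det n (G : 'rV[R]_d -> 'M[R]_n) x :
  (forall i j, C1_at (fun y => G y i j) x) -> C1_at (fun y => \det (G y)) x.
Proof.
move=> h; rewrite /determinant; apply: C1_at_sum => s.
by apply: C1_atM; [exact: C1_at_cst|exact: C1_at_prod].
Qed.

Lemma C1_at_invmx n (G : 'rV[R]_d -> 'M[R]_n) x :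
  (\forall y \near x, G y \in unitmx) -> (forall i j, C1_at (fun y => G y i j) x) ->
  forall i j, C1_at (fun y => invmx (G y) i j) x.
Proof.
move=> Gu h i j.
have : C1_at (fun y => (\det (G y))^-1 * cofactor (G y) j i) x.
  apply: C1_atM.
    apply: C1_atV; last exact: C1_at_det.
    by rewrite -unitfE -unitmxE; exact: nbhs_singleton Gu.
  apply: C1_atM; first exact: C1_at_cst.
  apply: C1_at_det => i' j'.
  by apply: C1_at_near_eq (h (lift j i') (lift i j')); near=> y; rewrite !mxE.
apply: C1_at_near_eq; apply: filterS Gu => y Gyu.
by rewrite /invmx Gyu !mxE.
Unshelve. all: by end_near. Qed.

End partial_derivatives.

(** Induction through the Schur complement: its form at [v] is the form of [G] at [v] preceded by
    the coordinate [- a^-1 * (v *m b)]. The factor [V] later serves as the linear change of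
    coordinates that makes the metric Euclidean at one point. *)
Lemma cholesky (R : rcfType) n (G : 'M[R]_n) : G^T = G ->
  (forall v : 'rV[R]_n, v != 0 -> 0 < (v *m G *m v^T) 0 0) ->
  exists2 V : 'M[R]_n, V \in unitmx & G = V *m V^T.
Proof.
elim: n G => [|n IHn] G Gsym Gpos.
  by exists 1%:M; [exact: unitmx1|apply/matrixP => -[]].
pose G' : 'M[R]_(1 + n) := G.
pose a : R := G 0 0; pose b : 'cV[R]_n := dlsubmx G'; pose C : 'M[R]_n := drsubmx G'.
have ulE : ulsubmx G' = a%:M by rewrite [LHS]mx11_scalar !mxE /a; congr (G _ _)%:M; apply/val_inj.
have G'sym : G'^T = G' by exact: Gsym.
have urE : ursubmx G' = b^T by rewrite /b trmx_dlsub G'sym.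
have Csym : C^T = C by rewrite /C trmx_drsub G'sym.
have GE : G' = block_mx a%:M b^T b C by rewrite -[LHS]submxK ulE urE.
have quad (s : R) (v : 'rV[R]_n) :
    ((row_mx s%:M v) *m G' *m (row_mx s%:M v)^T) 0 0 =
    s ^+ 2 * a + 2 * s * (v *m b) 0 0 + (v *m C *m v^T) 0 0.
  have bv : b^T *m v^T = ((v *m b) 0 0)%:M.
    by rewrite -trmx_mul {1}[v *m b]mx11_scalar tr_scalar_mx.
  rewrite GE mul_row_block tr_row_mx mul_row_col tr_scalar_mx.
  rewrite -scalar_mxM mul_mx_scalar mulmxDl -(mulmxA _ b^T) bv -scalar_mxM.
  move: (v *m b) (v *m C *m v^T) => be ga; rewrite !mxE !eqxx !mulr1n; ring.
have a0 : 0 < a.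
  have := Gpos (row_mx 1%:M 0 : 'rV_(1 + n)); rewrite -/G' => h.
  have e : (row_mx 1%:M 0 *m G' *m (row_mx 1%:M 0)^T) 0 0 = a.
    rewrite quad !mul0mx [X in _ + X]mxE [X in _ + _ * X + _]mxE.
    by rewrite mulr0 !addr0 expr1n mul1r.
  rewrite -e; apply: h; apply/eqP => /matrixP /(_ 0 0); rewrite mxE.
  by case: splitP => // j _; rewrite !mxE !ord1 => /eqP; rewrite oner_eq0.
have [||V' V'u V'E] := IHn (C - a^-1 *: (b *m b^T)).
- by rewrite linearB /= linearZ /= trmx_mul trmxK Csym.
- move=> v v0.
  have n0 : (row_mx (- (a^-1 * (v *m b) 0 0))%:M v : 'rV_(1 + n)) != 0.
    apply: contra v0 => /eqP; rewrite -row_mx0 => /eq_row_mx[_ ->]; exact: eqxx.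
  have := Gpos _ n0; rewrite -/G' quad.
  have bb : v *m (b *m b^T) *m v^T = ((v *m b) 0 0 ^+ 2)%:M.
    have bv : b^T *m v^T = ((v *m b) 0 0)%:M.
      by rewrite -trmx_mul {1}[v *m b]mx11_scalar tr_scalar_mx.
    by rewrite mulmxA -mulmxA bv mul_mx_scalar {2}[v *m b]mx11_scalar scale_scalar_mx.
  rewrite mulmxBr mulmxBl -scalemxAr -scalemxAl bb.
  move: ((v *m b) 0 0) (v *m C *m v^T) => s q; rewrite !mxE !eqxx !mulr1n => h.
  rewrite (_ : _ - _ = (- (a^-1 * s)) ^+ 2 * a + 2 * - (a^-1 * s) * s + q 0 0) //.
  by field; rewrite gt_eqF.
have s0 : Num.sqrt a != 0 by rewrite gt_eqF // sqrtr_gt0.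
pose V : 'M[R]_(1 + n) := block_mx (Num.sqrt a)%:M 0 ((Num.sqrt a)^-1 *: b) V'.
exists V.
  have detV : \det V = Num.sqrt a * \det V'.
    by rewrite -[Num.sqrt a in RHS]det_scalar1; exact: det_lblock.
  by rewrite unitmxE [X in X \is a _]detV unitrM unitfE s0 /= -unitmxE.
suff : G' = @mulmx R (1 + n) (1 + n) (1 + n) V (@trmx R (1 + n) (1 + n) V) by [].
rewrite GE /V (@tr_block_mx _ 1 n 1 n) mulmx_block !trmx0 !mulmx0 !mul0mx !addr0 tr_scalar_mx.
rewrite -scalar_mxM -expr2 sqr_sqrtr ?ltW //; congr block_mx.
- by rewrite mul_scalar_mx linearZ /= scalerA mulfV // scale1r.
- by rewrite mul_mx_scalar scalerA mulfV // scale1r.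
- rewrite -V'E linearZ /= -scalemxAl -scalemxAr scalerA -invfM -expr2 sqr_sqrtr ?ltW //.
  by rewrite addrC subrK.
Qed.

Lemma posdef_det_gt0 (R : rcfType) n (G : 'M[R]_n) : G^T = G ->
  (forall v : 'rV[R]_n, v != 0 -> 0 < (v *m G *m v^T) 0 0) -> 0 < \det G.
Proof.
move=> Gs Gp; have [V Vu ->] := cholesky Gs Gp.
by rewrite det_mulmx det_tr -expr2 lt_neqAle sqr_ge0 andbT eq_sym sqrf_eq0 -unitfE -unitmxE.
Qed.

(** * The Laplacian in a chart *)

Section chart_operator.
Variables (R : realType) (d : nat) (M : compactRiemannianManifold R d).
Variables (c : chart R d M) (hc : atlas c).
Implicit Types x y : 'rV[R]_d.

Lemma open_img : open (img c). Proof. exact: img_open. Qed.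

Lemma metric_det_gt0 x : img c x -> 0 < \det (metric c x).
Proof.
by move=> Ox; apply: posdef_det_gt0 => [|v]; [exact: (Defs.metric_sym hc Ox)|exact: (metric_pos hc Ox)].
Qed.

Lemma density_gt0 x : img c x -> 0 < density c x.
Proof. by move=> Ox; rewrite sqrtr_gt0 metric_det_gt0. Qed.

Lemma metric_unit x : img c x -> metric c x \in unitmx.
Proof. by move=> Ox; rewrite unitmxE unitfE gt_eqF // metric_det_gt0. Qed.

Lemma C1_at_metric x i j : img c x -> C1_at (fun y => metric c y i j) x.
Proof.
by move=> Ox; exact: (@smooth_on_C1_at _ _ _ _ [::] _ open_img (metric_smooth hc i j) Ox).
Qed.

Lemma C1_at_density x : img c x -> C1_at (density c) x.
Proof.
move=> Ox; apply: C1_at_sqrt; first exact: metric_det_gt0.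
by apply: C1_at_det => i j; exact: C1_at_metric.
Qed.

Lemma C1_at_inv_metric x i j : img c x -> C1_at (fun y => invmx (metric c y) i j) x.
Proof.
move=> Ox; apply: C1_at_invmx => [|i' j']; last exact: C1_at_metric.
have : nbhs x (img c) by exact: open_nbhs_nbhs (conj open_img Ox).
by apply: filterS => y; exact: metric_unit.
Qed.

(** The first-order coefficients that the product rule leaves when the divergence is expanded. *)
Definition drift x : 'rV[R]_d := \row_j ((density c x)^-1 *
  \sum_i partial i (fun y => density c y * invmx (metric c y) i j) x).

Lemma C1_at_derivable (f : 'rV[R]_d -> R) x i : C1_at f x -> derivable f x (delta_mx 0 i).
Proof. by case=> fd _ _; exact: (nbhs_singleton fd). Qed.

(** The maximum principle applies to this non-divergence form. Expanding the divergence takes one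
    derivative of the density and of the inverse metric, the purpose of the [C1_at] lemmas above. *)
Lemma laplace_chartE (f : M -> R) x : smooth f -> img c x ->
  laplace_chart c f x = - (\sum_i \sum_j invmx (metric c x) i j * hess (f \o coordV c) x i j +
     dotv (drift x) (grad (f \o coordV c) x)).
Proof.
move=> fs Ox; rewrite /laplace_chart; congr (- _).
set U := f \o coordV c; set rho := density c x.
have rho0 : rho != 0 by rewrite gt_eqF // density_gt0.
have Us : smooth_on (img c) U by exact: fs.
pose F i j y := density c y * invmx (metric c y) i j.
have FC1 i j : C1_at (F i j) x by apply: C1_atM; [exact: C1_at_density|exact: C1_at_inv_metric].
have UC1 j : C1_at (partial j U) x.
  exact: (@smooth_on_C1_at _ _ _ _ [:: j] _ open_img Us Ox).
have dE i : partial i (fun y => density c y * \sum_j invmx (metric c y) i j * partial j U y) x =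
    \sum_j (rho * invmx (metric c x) i j * hess U x i j + partial i (F i j) x * partial j U x).
  have -> : (fun y => density c y * \sum_j invmx (metric c y) i j * partial j U y) =
     \sum_j (fun y => F i j y * partial j U y).
    apply/funext => y; rewrite fct_sumE mulr_sumr; apply: eq_bigr => j _; by rewrite mulrA.
  rewrite /partial derive_sum => [|j]; last first.
    by apply: derivableM; apply: C1_at_derivable; [exact: FC1|exact: UC1].
  apply: eq_bigr => j _.
  rewrite [LHS](deriveM (C1_at_derivable (FC1 i j)) (C1_at_derivable (UC1 j))).
  by rewrite /GRing.scale /= mxE [X in _ + X]mulrC.
under eq_bigr do rewrite dE big_split /=.
rewrite big_split mulrDr /=; congr (_ + _).
  rewrite mulr_sumr; apply: eq_bigr => i _; rewrite mulr_sumr; apply: eq_bigr => j _.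
  by rewrite !mulrA mulVf // mul1r.
rewrite exchange_big /dotv mulr_sumr; apply: eq_bigr => j _ /=.
by rewrite !mxE -mulr_suml mulrA.
Qed.

Lemma drift_continuous x i : img c x -> drift y 0 i @[y --> x] --> drift x 0 i.
Proof.
move=> Ox; have e j y : drift y 0 j = (density c y)^-1 *
  \sum_i partial i (fun y => density c y * invmx (metric c y) i j) y by rewrite mxE.
under eq_fun do rewrite e; rewrite e.
have [_ rc _] := C1_at_density Ox.
have rn : density c x != 0 by rewrite gt_eqF // density_gt0.
apply: (cvgM (cvgV rn rc)); apply: (cvg_sumr (F := nbhs x)) => j _.
by have [_ _] := C1_atM (C1_at_density Ox) (C1_at_inv_metric j i Ox); apply.
Qed.

End chart_operator.

(** * Linear change of variables and rescaling *)

Lemma mulmx_bound (R : realType) (d : nat) (W : 'M[R]_d) :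
  exists2 w : R, 0 < w & forall z : 'rV[R]_d, `|z *m W| <= w * `|z|.
Proof.
pose w := \sum_i \sum_j `|W i j|.
have w0 : 0 <= w by apply: sumr_ge0 => i _; apply: sumr_ge0.
exists (w + 1); first by rewrite ltr_wpDl.
move=> z; rewrite [leLHS]mx_normrE; apply/bigmax_leP.
split=> [|[i j] _ /=]; first by rewrite mulr_ge0 // addr_ge0.
rewrite mxE; apply: (le_trans (ler_norm_sum _ _ _)).
apply: (@le_trans _ _ (w * `|z|)); last by rewrite ler_wpM2r // lerDl.
rewrite /w mulr_suml; apply: ler_sum => k _.
rewrite normrM mulrC (ord1 i); apply: ler_pM => //; last exact: rV_norm_coord.
by rewrite (bigD1 j) //= lerDl sumr_ge0.
Qed.

Section dotv_mulmx.
Variables (R : rcfType) (d : nat).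
Implicit Types (v w p : 'rV[R]_d) (B C H W : 'M[R]_d) (t : R).

Lemma dotvE v w : dotv v w = (v *m w^T) 0 0.
Proof. by rewrite mxE; apply: eq_bigr => i _; rewrite mxE. Qed.

Lemma dotvC v w : dotv v w = dotv w v.
Proof. by apply: eq_bigr => i _; rewrite mulrC. Qed.

Lemma dotvZl t v w : dotv (t *: v) w = t * dotv v w.
Proof. by rewrite /dotv mulr_sumr; apply: eq_bigr => i _; rewrite mxE mulrA. Qed.

Lemma dotvZr t v w : dotv v (t *: w) = t * dotv v w.
Proof. by rewrite /dotv mulr_sumr; apply: eq_bigr => i _; rewrite mxE mulrCA. Qed.

Lemma dotv_mulmx v w W : dotv (v *m W^T) w = dotv v (w *m W).
Proof. by rewrite !dotvE trmx_mul mulmxA. Qed.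

Lemma quadfZ t H p : quadf (t *: H) p = t * quadf H p.
Proof. by rewrite /quadf -scalemxAr -scalemxAl mxE. Qed.

Lemma quadfZr t H p : quadf H (t *: p) = t ^+ 2 * quadf H p.
Proof. by rewrite /quadf linearZ /= -!scalemxAl -scalemxAr scalerA mxE. Qed.

Lemma quadf_mulmx H W p : quadf (W *m H *m W^T) p = quadf H (p *m W).
Proof. by rewrite /quadf trmx_mul !mulmxA. Qed.

Lemma sum_mxtrace B C : \sum_i \sum_j B i j * C i j = \tr (B *m C^T).
Proof. by apply: eq_bigr => i _; rewrite mxE; apply: eq_bigr => j _; rewrite mxE. Qed.

End dotv_mulmx.

Section oscillation.
Variables (R : realType) (d : nat) (d0 : (0 < d)%N).
Variables (U : 'rV[R]_d -> R) (b DU : 'rV[R]_d -> 'rV[R]_d) (a HU : 'rV[R]_d -> 'M[R]_d).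
Variables (x1 : 'rV[R]_d) (V : 'M[R]_d) (rho A : R).
Hypotheses (Vu : V \in unitmx) (rho0 : 0 < rho) (A0 : 0 < A).
Let W := invmx V.
Let q (z : 'rV[R]_d) : 'rV[R]_d := x1 + rho *: (z *m W).
Hypothesis Uc : forall z, `|z| <= 1 -> {for q z, continuous U}.
Hypothesis UA : forall z, `|z| <= 1 -> `|U (q z)| <= A.
Hypothesis U1 : forall z p, `|z| < 1 -> dquot U (q z) p t @[t --> 0^'] --> dotv (DU (q z)) p.
Hypothesis U2 : forall z p, `|z| < 1 -> dquot2 U (q z) p t @[t --> 0^'] --> quadf (HU (q z)) p.
Hypothesis asym : forall z, `|z| < 1 -> (a (q z))^T = a (q z).
Hypothesis aid : forall z i j, `|z| < 1 ->
  `|(V^T *m a (q z) *m V) i j - (i == j)%:R| <= (12 * d%:R ^+ 2)^-1.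
Hypothesis b1 : forall z i, `|z| < 1 -> `|rho * (b (q z) *m V) 0 i| <= 1.
Hypothesis eqn : forall z, `|z| < 1 ->
  `|\sum_i \sum_j a (q z) i j * HU (q z) i j + dotv (b (q z)) (DU (q z))| <= A / rho ^+ 2.

(** The map [q] pulls a neighbourhood of size [rho] back to the unit cube. There the coefficients
    become [V^T a V] and [rho b V], the Hessian [W H W^T] up to a scalar, and the trace pairing is
    preserved. Dividing [U] by [A] and multiplying the equation by [rho ^+ 2] normalises both bounds
    to [1]. *)
Lemma oscillation z : `|z| <= 1 -> U x1 - U (q z) <= A * (100 * d%:R * psi z).
Proof.
move=> z1.
have qD (y p : 'rV[R]_d) t : q (y + t *: p) = q y + t *: (rho *: (p *m W)).
  by rewrite /q mulmxDl -scalemxAl scalerDr addrA !scalerA [t * _]mulrC.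
have VW : V *m W = 1%:M by exact: mulmxV.
have q0 : q 0 = x1 by rewrite /q mul0mx scaler0 addr0.
have qc y : q t @[t --> y] --> q y.
  have [w w0 hw] := mulmx_bound W.
  apply/(cvgrPdist_le (F := nbhs y)) => e e0; near=> t.
  rewrite /q opprD addrACA subrr add0r -scalerBr -mulmxBl normrZ gtr0_norm //.
  have e1 : rho * `|(y - t) *m W| <= rho * (w * `|y - t|) by rewrite ler_pM2l.
  apply: (le_trans e1); rewrite mulrA mulrC -ler_pdivlMr ?mulr_gt0 //; near: t.
  by apply: cvgr_dist_le; [exact: cvg_id|rewrite divr_gt0 ?mulr_gt0].
pose u y := A^-1 * U (q y).
have := @doubling R d u (fun y => rho *: (b (q y) *m V))
  (fun y => (A^-1 * rho) *: (DU (q y) *m W^T)) (fun y => V^T *m a (q y) *m V)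
  (fun y => (A^-1 * rho ^+ 2) *: (W *m HU (q y) *m W^T)) d0.
move=> dbl; suff : u 0 - u z <= 100 * d%:R * psi z.
  by rewrite /u q0 -mulrBr mulrC ler_pdivrMr // [_ * A]mulrC.
apply: dbl => //.
- move=> y y1; have Uq := @continuous_comp _ _ _ q U y (qc y) (Uc y1).
  exact: (cvgM (cvg_cst (A^-1)) Uq).
- move=> y y1; rewrite /u normrM gtr0_norm ?invr_gt0 // mulrC ler_pdivrMr // mul1r.
  exact: UA.
- move=> y p y1.
  have -> : dquot u y p = (fun t => A^-1 * dquot U (q y) (rho *: (p *m W)) t).
    by apply/funext => t; rewrite /dquot /u qD; ring.
  rewrite dotvZl dotv_mulmx -mulrA -dotvZr.
  by apply: (cvgM (cvg_cst (A^-1))); exact: U1.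
- move=> y p y1.
  have -> : dquot2 u y p = (fun t => A^-1 * dquot2 U (q y) (rho *: (p *m W)) t).
    apply/funext => t; rewrite /dquot2 /u qD (_ : y - t *: p = y + (- t) *: p); last by rewrite scaleNr.
    by rewrite qD scaleNr; ring.
  rewrite quadfZ quadf_mulmx -mulrA -quadfZr.
  by apply: (cvgM (cvg_cst (A^-1))); exact: U2.
- by move=> y y1; rewrite !trmx_mul trmxK asym // mulmxA.
- move=> y i y1; rewrite mxE; exact: b1.
- move=> y y1; rewrite sum_mxtrace linearZ /= -scalemxAr mxtraceZ.
  have -> : \tr (V^T *m a (q y) *m V *m (W *m HU (q y) *m W^T)^T) =
     \sum_i \sum_j a (q y) i j * HU (q y) i j.
    rewrite sum_mxtrace !trmx_mul trmxK !mulmxA -[V^T *m _ *m V *m W]mulmxA VW mulmx1.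
    by rewrite -!mulmxA mxtrace_mulC -!mulmxA -trmx_mul VW trmx1 mulmx1.
  rewrite dotvZl dotvZr dotvC dotv_mulmx -mulmxA VW mulmx1 dotvC.
  have := eqn y1; set S := \sum_i _; set T := dotv _ _ => h.
  rewrite (_ : _ + _ = (A^-1 * rho ^+ 2) * (S + T)); last by ring.
  have r2 : 0 < rho ^+ 2 by rewrite exprn_gt0.
  rewrite normrM gtr0_norm ?mulr_gt0 ?invr_gt0 // mulrC.
  have -> : A^-1 * rho ^+ 2 = (A / rho ^+ 2)^-1 by rewrite invfM invrK.
  by rewrite ler_pdivrMr ?divr_gt0 // mul1r.
Unshelve. all: by end_near. Qed.

End oscillation.

(** The integral of a nonnegative function is a supremum over simple functions below it, hence
    monotone for arbitrary functions. The inner integrals in [integral_rV] are functions of the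
    outer variable whose measurability is not established. *)
Lemma ge0_le_integral_nonmeas (d : measure_display) (T : measurableType d) (R : realType)
    (mu : {measure set T -> \bar R}) (f g : T -> \bar R) :
  (forall x, (0 <= f x)%E) -> (forall x, (f x <= g x)%E) ->
  (\int[mu]_x f x <= \int[mu]_x g x)%E.
Proof.
move=> f0 fg; have g0 x : (0 <= g x)%E by exact: le_trans (f0 x) (fg x).
rewrite !ge0_integralTE //=; apply: ereal_sup_le => _ [h hf <-].
by exists h => // x; exact: le_trans (hf x) (fg x).
Qed.

Lemma integral_rV_ge0 (R : realType) d (f : 'rV[R]_d -> \bar R) :
  (forall x, (0 <= f x)%E) -> (0 <= integral_rV f)%E.
Proof.
elim: d f => [|d IH] f f0 /=; first exact: f0.
by apply: integral_ge0 => t _; exact: IH.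
Qed.

Lemma le_integral_rV (R : realType) d (f g : 'rV[R]_d -> \bar R) :
  (forall x, (0 <= f x)%E) -> (forall x, (f x <= g x)%E) ->
  (integral_rV f <= integral_rV g)%E.
Proof.
elim: d f g => [|d IH] f g f0 fg /=; first exact: fg.
apply: ge0_le_integral_nonmeas => t; first exact: integral_rV_ge0.
exact: IH.
Qed.

Lemma integral_rV_cube (R : realType) d (x : 'rV[R]_d) (e c : R) : 0 < e -> 0 <= c ->
  integral_rV (fun y => (c * \1_[set y | forall i, `|y 0 i - x 0 i| < e] y)%:E) =
  (c * (2 * e) ^+ d)%:E.
Proof.
move=> e0; elim: d x c => [|d IH] x c c0 /=.
  by rewrite indicE mem_set ?expr0 // => -[].
pose x' : 'rV[R]_d := \row_i x 0 (rshift 1 i).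
have E (t : R) (v : 'rV[R]_d) :
  c * \1_[set y : 'rV[R]_d.+1 | forall i, `|y 0 i - x 0 i| < e] (row_mx (t%:M : 'rV_1) v : 'rV_(1 + d)) =
  c * \1_(`]x 0 0 - e, x 0 0 + e[%classic) t * \1_[set y | forall i, `|y 0 i - x' 0 i| < e] v.
  have row0 : (row_mx (t%:M : 'rV_1) v : 'rV_(1 + d)) 0 0 = t.
    rewrite (_ : 0 = lshift d (0 : 'I_1)); last exact/val_inj.
    by rewrite row_mxEl mxE eqxx.
  have rowS i : (row_mx (t%:M : 'rV_1) v : 'rV_(1 + d)) 0 (rshift 1 i) = v 0 i by rewrite row_mxEr.
  rewrite -mulrA; congr (_ * _); rewrite !indicE -natrM mulnb; congr (_%:R); congr nat_of_bool.
  apply/idP/andP; rewrite !inE /=.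
    move=> h; split; last by move=> i; rewrite -rowS [X in _ - X]mxE; exact: h.
    by have := h 0; rewrite row0 in_itv /= ltr_distl.
  move=> [h1 h2] i; case: (@splitP 1 d i) => j ij.
    have -> : i = 0 by apply/val_inj => /=; rewrite ij ord1.
    by rewrite row0; move: h1; rewrite in_itv /= ltr_distl.
  have -> : i = rshift 1 j by exact/val_inj.
  by rewrite rowS; have := h2 j; rewrite mxE.
under eq_integral => t _.
  under eq_fun do rewrite E.
  rewrite IH ?mulr_ge0 ?indicE //.
  rewrite (_ : _%:E = ((c * (2 * e) ^+ d)%:E * (\1_(`]x 0 0 - e, x 0 0 + e[%classic) t)%:E)%E); last first.
    by rewrite indicE -EFinM; congr _%:E; ring.
  over.
have xe : x 0 0 - e < x 0 0 + e by lra.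
rewrite ge0_integralZl_EFin //=; first last.
- by rewrite mulr_ge0 // exprn_ge0 // mulr_ge0 // ltW.
- by apply/measurable_EFinP; exact: measurable_indic.
rewrite integral_indic // setIT.
have leb : lebesgue_measure `]x 0 0 - e, x 0 0 + e[%classic = (2 * e)%:E.
  have := lebesgue_measure_itv `]x 0 0 - e, x 0 0 + e[%R.
  rewrite /= lte_fin xe -EFinD => h; apply: (etrans h); congr _%:E; ring.
transitivity ((c * (2 * e) ^+ d)%:E * (2 * e)%:E)%E; first by congr (_ * _)%E; exact: leb.
by rewrite -EFinM exprS; congr _%:E; ring.
Qed.

(** * Continuity and Borel measurability on the manifold *)

Section continuity.
Variables (R : realType) (d : nat) (M : compactRiemannianManifold R d).

Lemma coord_continuous_at (c : chart R d M) (p : M) : Defs.dom c p ->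
  Defs.coord c q @[q --> p] --> Defs.coord c p.
Proof.
move=> cp; have := @Defs.coord_continuous R d M c.
by rewrite (continuous_open_subspace _ (dom_open c)); apply; exact: mem_set.
Qed.

Lemma coordKV (c : chart R d M) (p : M) : Defs.dom c p -> coordV c (Defs.coord c p) = p.
Proof. by move=> cp; rewrite coordK // mem_set. Qed.

Lemma img_coord (c : chart R d M) (p : M) : Defs.dom c p -> img c (Defs.coord c p).
Proof. by move=> cp; exists p. Qed.

Lemma smooth_continuous (f : M -> R) : smooth f -> continuous f.
Proof.
move=> fs p; have [c hc cp] := atlas_cover p.
have cO : img c (Defs.coord c p) by exact: img_coord.
have [_ fc _] := @smooth_on_C1_at _ _ _ _ [::] _ (@img_open _ _ _ c) (fs c hc) cO.
have h : (f \o coordV c) (Defs.coord c q) @[q --> p] --> f p.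
  rewrite -[X in _ --> f X](coordKV cp).
  exact: (continuous_comp (coord_continuous_at cp) fc).
apply: cvg_trans h; apply: near_eq_cvg.
have : nbhs p (Defs.dom c) by exact: open_nbhs_nbhs (conj (dom_open c) cp).
by apply: filterS => q cq /=; rewrite coordKV.
Qed.

Lemma measurable_continuous (f : M -> R) : continuous f ->
  measurable_fun [set: borel M] (f : borel M -> R).
Proof.
move=> fc; apply: (measurability _ (RGenOInfty.measurableE R)).
move=> _ [_ [a ->] <-]; rewrite setTI; apply: sub_sigma_algebra.
by apply: (proj1 (continuousP f) fc); exact: interval_open.
Qed.

End continuity.

(** * Finite sums over an orthonormal system *)

Section orthonormal.
Variables (d : measure_display) (T : measurableType d) (R : realType).
Variables (mu : {measure set T -> \bar R}) (phi : nat -> T -> R).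
Hypothesis mphi : forall j, measurable_fun setT (phi j).
Hypothesis orth : forall i j, \int[mu]_p (phi i p * phi j p) = (i == j)%:R.

(** [orth] speaks of [fine] of the integral, which is [0] at infinity; the value [1] excludes this,
    so orthonormality by itself yields square-integrability. *)
Lemma int_phi_sqr j : (\int[mu]_p (phi j p ^+ 2)%:E = 1)%E.
Proof.
have : (0 <= \int[mu]_p (phi j p ^+ 2)%:E)%E.
  by apply: integral_ge0 => p _; rewrite lee_fin sqr_ge0.
have : fine (\int[mu]_p (phi j p ^+ 2)%:E)%E = 1.
  by have := orth j j; rewrite eqxx.
case: (\int[mu]_p _)%E => [r||] //=; first by move=> ->.
by move=> /esym /eqP; rewrite oner_eq0.
Qed.

Lemma integrable_phi i j : mu.-integrable setT (fun p => (phi i p * phi j p)%:E).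
Proof.
apply/integrableP; split.
  by apply/measurable_EFinP; exact: measurable_funM.
apply: (@le_lt_trans _ _ (\int[mu]_p ((phi i p ^+ 2)%:E + (phi j p ^+ 2)%:E))%E).
  apply: ge0_le_integral => //=.
  - apply/measurable_EFinP; apply: measurableT_comp => //.
    exact: measurable_funM.
  - by apply: emeasurable_funD; apply/measurable_EFinP; exact: measurable_funX.
  - move=> p _; rewrite -EFinD lee_fin normrM -[phi i p ^+ 2]real_normK ?num_real // -[phi j p ^+ 2]real_normK ?num_real //.
    have := sqr_ge0 (`|phi i p| - `|phi j p|); have := sqr_ge0 (`|phi i p| + `|phi j p|); nra.
rewrite ge0_integralD //=; first by rewrite !int_phi_sqr -EFinD ltry.
- by move=> p _; rewrite lee_fin sqr_ge0.
- by apply/measurable_EFinP; exact: measurable_funX.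
- by move=> p _; rewrite lee_fin sqr_ge0.
- by apply/measurable_EFinP; exact: measurable_funX.
Qed.

Lemma int_sum_phi_sqr (J : seq nat) (c : nat -> R) : uniq J ->
  (\int[mu]_p ((\sum_(j <- J) c j * phi j p) ^+ 2)%:E = (\sum_(j <- J) c j ^+ 2)%:E)%E.
Proof.
move=> uJ.
have -> : (fun p => ((\sum_(j <- J) c j * phi j p) ^+ 2)%:E) =
   (fun p => \sum_(i <- J) \sum_(j <- J) (c i * c j)%:E * (phi i p * phi j p)%:E)%E.
  apply/funext => p; rewrite expr2 mulr_suml -sumEFin; apply: eq_bigr => i _.
  rewrite mulr_sumr -sumEFin; apply: eq_bigr => j _; rewrite -EFinM; congr _%:E; ring.
rewrite integral_sum //=; last first.
  by move=> i; apply: integrable_sum => // j _; apply: integrableZl => //; exact: integrable_phi.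
rewrite -sumEFin; apply: eq_big_seq => i iJ.
rewrite integral_sum //=; last by move=> j; apply: integrableZl => //; exact: integrable_phi.
have intE j : (\int[mu]_x (phi i x * phi j x)%:E)%E = ((i == j)%:R)%:E.
  by rewrite -orth /Rintegral fineK //; exact: integrable_fin_num (integrable_phi i j).
rewrite (bigD1_seq i) //= big1_seq ?adde0.
  by rewrite integralZl //; [rewrite intE eqxx -EFinM mulr1 expr2|exact: integrable_phi].
move=> j /andP[ji _]; rewrite integralZl //; last exact: integrable_phi.
by rewrite intE eq_sym (negbTE ji) mule0.
Qed.

End orthonormal.

(** * Local Weyl bound *)

Section local_weyl.
Variables (R : realType) (d : nat) (M : compactRiemannianManifold R d) (d0 : (0 < d)%N).
Variables (vol : {measure set (borel M) -> \bar R}) (hvol : is_volume vol).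
Variables (mu : nat -> R) (phi : nat -> M -> R).
Hypothesis mu0 : forall j, 0 <= mu j.
Hypothesis eig : forall j, laplace_eigenfunction (mu j ^+ 2) (phi j).
Hypothesis orth : forall i j, \int[vol]_p (phi i p * phi j p) = (i == j)%:R.

(* [V] makes the metric Euclidean at [x0]: [V^T g^-1 V = 1] there. *)
Lemma chart_data (c : chart R d M) (x0 : 'rV[R]_d) : atlas c -> img c x0 ->
  exists V : 'M[R]_d, exists R0 be de : R,
  [/\ V \in unitmx, 0 < R0, 0 < be, 0 < de &
   forall y, `|y - x0| < R0 ->
   [/\ img c y,
      forall i j, `|(V^T *m invmx (metric c y) *m V) i j - (i == j)%:R| <= (12 * d%:R ^+ 2)^-1,
      forall i, `|(drift c y *m V) 0 i| <= be & de <= density c y]].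
Proof.
move=> hc Ox0; have [V Vu gV] := cholesky (Defs.metric_sym hc Ox0) (fun v => metric_pos hc Ox0).
(* The added [1] absorbs the variation of the drift near [x0] and makes [be] positive. *)
pose be := 1 + \sum_i `|(drift c x0 *m V) 0 i|.
have be0 : 0 < be by rewrite ltr_wpDr // sumr_ge0.
have de0 : 0 < density c x0 / 2 by rewrite divr_gt0 // (density_gt0 hc).
have e0 : 0 < (12 * d%:R ^+ 2)^-1 :> R by rewrite invr_gt0 mulr_gt0 ?exprn_gt0 ?ltr0n.
have n1 : \forall y \near x0, img c y by exact: open_nbhs_nbhs (conj (@Defs.img_open _ _ _ c) Ox0).
have n2 i j : \forall y \near x0,
    `|(V^T *m invmx (metric c y) *m V) i j - (i == j)%:R| <= (12 * d%:R ^+ 2)^-1.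
  have h : (V^T *m invmx (metric c y) *m V) i j @[y --> x0] --> ((i == j)%:R : R).
    have -> : (i == j)%:R = (V^T *m invmx (metric c x0) *m V) i j.
      have VT : V^T \in unitmx by rewrite unitmx_tr.
      have -> : invmx (metric c x0) = invmx V^T *m invmx V.
        apply: (can_inj (mulKmx (metric_unit hc Ox0))); rewrite mulmxV ?metric_unit //.
        by rewrite gV mulmxA mulmxK // mulmxV.
      by rewrite mulmxA mulmxV // mul1mx mulVmx // mxE.
    have mE y : (V^T *m invmx (metric c y) *m V) i j =
        \sum_k (\sum_l V l i * invmx (metric c y) l k) * V k j.
      rewrite mxE; apply: eq_bigr => k _; rewrite mxE; congr (_ * _).
      by apply: eq_bigr => l _; rewrite mxE.
    under eq_fun do rewrite mE; rewrite mE.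
    apply: (cvg_sumr (F := nbhs x0)) => k _; apply: (fun h => cvgM h (cvg_cst (V k j))).
    apply: (cvg_sumr (F := nbhs x0)) => l _; apply: (cvgM (cvg_cst (V l i))).
    by have [_] := C1_at_inv_metric hc l k Ox0.
  have /(cvgrPdist_le (F := nbhs x0)) /(_ _ e0) := h.
  by apply: filterS => y; rewrite distrC.
have n3 i : \forall y \near x0, `|(drift c y *m V) 0 i| <= be.
  have h : (drift c y *m V) 0 i @[y --> x0] --> (drift c x0 *m V) 0 i.
    have mE y : (drift c y *m V) 0 i = \sum_k drift c y 0 k * V k i by rewrite mxE.
    under eq_fun do rewrite mE; rewrite mE.
    apply: (cvg_sumr (F := nbhs x0)) => k _; apply: (fun h => cvgM h (cvg_cst (V k i))).
    exact: drift_continuous.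
  have /(cvgrPdist_le (F := nbhs x0)) /(_ _ ltr01) := h.
  apply: filterS => y hy; rewrite -[X in `|X|](subrK ((drift c x0 *m V) 0 i)).
  apply: (le_trans (ler_normD _ _)); apply: lerD; first by rewrite distrC.
  by rewrite (bigD1 i) //= lerDl sumr_ge0.
have n4 : \forall y \near x0, density c x0 / 2 <= density c y.
  have [_ h _] := C1_at_density hc Ox0.
  apply: (cvgr_ge _ h); have := density_gt0 hc Ox0; lra.
have : \forall y \near x0, [/\ img c y,
      forall i j, `|(V^T *m invmx (metric c y) *m V) i j - (i == j)%:R| <= (12 * d%:R ^+ 2)^-1,
      forall i, `|(drift c y *m V) 0 i| <= be & density c x0 / 2 <= density c y].
  have n2' : \forall y \near x0, forall i j, `|(V^T *m invmx (metric c y) *m V) i j - (i == j)%:R| <= (12 * d%:R ^+ 2)^-1.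
    by near=> y; near: y; apply: filter_forall => i; near=> y; near: y; apply: filter_forall => j; exact: n2.
  have n3' : \forall y \near x0, forall i, `|(drift c y *m V) 0 i| <= be.
    by near=> y; near: y; apply: filter_forall => i; exact: n3.
  by near=> y; split; near: y.
move=> /nbhs_ballP[R0 /= R00 hR]; exists V, R0, be, (density c x0 / 2); split => // y yx.
by apply: hR; rewrite -ball_normE /= distrC.
Unshelve. all: by end_near. Qed.

Section at_max.
Variables (c : chart R d M) (hc : atlas c) (x0 : 'rV[R]_d) (V : 'M[R]_d) (R0 be de : R).
Hypotheses (Vu : V \in unitmx) (de0 : 0 < de).
Hypothesis data : forall y, `|y - x0| < R0 ->
   [/\ img c y,
      forall i j, `|(V^T *m invmx (metric c y) *m V) i j - (i == j)%:R| <= (12 * d%:R ^+ 2)^-1,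
      forall i, `|(drift c y *m V) 0 i| <= be & de <= density c y].
Variables (w v : R).
Hypotheses (w0 : 0 < w) (v0 : 0 < v)
  (hw : forall z : 'rV[R]_d, `|z *m invmx V| <= w * `|z|)
  (hv : forall z : 'rV[R]_d, `|z *m V| <= v * `|z|).
Variables (p : M) (J : seq nat) (T rho : R).
Let x1 := Defs.coord c p.
Let e := fun q => \sum_(j <- J) phi j q ^+ 2.
Let A := e p.
Hypotheses (cp : Defs.dom c p) (px0 : `|x1 - x0| < R0 / 2) (uJ : uniq J)
  (muT : forall j, j \in J -> mu j <= T) (pmax : forall q, e q <= e p) (A0 : 0 < A)
  (T0 : 0 <= T) (rho0 : 0 < rho) (rhoT : rho * T <= 1) (rhobe : rho * be <= 1) (rhow : rho * w <= R0 / 2).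
Let u := fun q => \sum_(j <- J) phi j p * phi j q.

(** With the absolute values inside the sum, one bound serves both [u] and, after the factors
    [mu j ^+ 2 <= T ^+ 2], its Laplacian. *)
Lemma sum_abs_phi q : \sum_(j <- J) `|phi j p * phi j q| <= A.
Proof.
apply: (@le_trans _ _ (\sum_(j <- J) (phi j p ^+ 2 / 2 + phi j q ^+ 2 / 2))).
  apply: ler_sum => j _.
  rewrite normrM -[phi j p ^+ 2]real_normK ?num_real // -[phi j q ^+ 2]real_normK ?num_real //.
  have := sqr_ge0 (`|phi j p| - `|phi j q|); nra.
rewrite big_split -!mulr_suml -/(e q) -/(e p) -/A /=.
have := pmax q; rewrite -/A; lra.
Qed.

(** The argument of [psi] is the rescaled coordinate that [q] sends to [y]; the radius [rho / v]
    keeps it in the unit cube. The condition [rho * T <= 1] turns [T ^+ 2 * A], the bound on the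
    Laplacian, into [A / rho ^+ 2]. *)
Lemma eigensum_drop y : `|y - x1| <= rho / v -> A - u (coordV c y) <= A * (100 * d%:R * psi (rho^-1 *: ((y - x1) *m V))).
Proof.
move=> yx1.
pose U (y : 'rV[R]_d) := \sum_(j <- J) phi j p * (phi j \o coordV c) y.
pose DU (y : 'rV[R]_d) : 'rV[R]_d := \sum_(j <- J) phi j p *: grad (phi j \o coordV c) y.
pose HU (y : 'rV[R]_d) : 'M[R]_d := \sum_(j <- J) phi j p *: hess (phi j \o coordV c) y.
pose q (z : 'rV[R]_d) : 'rV[R]_d := x1 + rho *: (z *m invmx V).
have qx0 z : `|z| <= 1 -> `|q z - x0| < R0.
  move=> z1; rewrite /q addrAC (splitr R0).
  apply: (le_lt_trans (ler_normD _ _)); apply: ltr_leD => //.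
  rewrite normrZ gtr0_norm //; apply: le_trans rhow; rewrite ler_pM2l //.
  by apply: (le_trans (hw z)); rewrite ler_piMr // ltW.
have qO z : `|z| <= 1 -> img c (q z) by move=> /qx0 /data [].
have sm j : smooth_on (img c) (phi j \o coordV c) by exact: (eig j).1.
have C1j j (x : 'rV[R]_d) : img c x -> C1_at (phi j \o coordV c) x.
  by move=> xO; exact: (@smooth_on_C1_at _ _ _ _ [::] _ (@Defs.img_open _ _ _ c) (sm j) xO).
have C1pj j i (x : 'rV[R]_d) : img c x -> C1_at (partial i (phi j \o coordV c)) x.
  by move=> xO; exact: (@smooth_on_C1_at _ _ _ _ [:: i] _ (@Defs.img_open _ _ _ c) (sm j) xO).
have nO (x : 'rV[R]_d) : img c x -> nbhs x (img c).
  by move=> xO; exact: open_nbhs_nbhs (conj (@Defs.img_open _ _ _ c) xO).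
have z1 : `|rho^-1 *: ((y - x1) *m V)| <= 1.
  rewrite normrZ gtr0_norm ?invr_gt0 // mulrC ler_pdivrMr // mul1r.
  by apply: (le_trans (hv _)); rewrite mulrC -ler_pdivlMr.
have qz : q (rho^-1 *: ((y - x1) *m V)) = y.
  rewrite /q -scalemxAl scalerA divff ?gt_eqF // scale1r mulmxK // addrC subrK //.
have Up : U x1 = A.
  by apply: eq_bigr => j _; rewrite /= coordKV // expr2.
have := @oscillation R d d0 U (drift c) DU (fun y => invmx (metric c y)) HU x1 V rho A Vu rho0 A0.
move=> osc; rewrite -{1}Up (_ : u _ = U (q (rho^-1 *: ((y - x1) *m V)))); last by rewrite qz.
apply: osc => //.
- move=> z zle1; apply: (cvg_sumr (F := nbhs (q z)) (f := fun j x => phi j p * (phi j \o coordV c) x)) => j _.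
  have [_ h _] := C1j j _ (qO _ zle1).
  exact: (cvgM (cvg_cst (phi j p)) h).
- move=> z zle1; apply: (le_trans (ler_norm_sum _ _ _)); exact: sum_abs_phi.
- move=> z h zlt1; have zO := qO z (ltW zlt1).
  have -> : dquot U (q z) h = (fun t => \sum_(j <- J) phi j p * dquot (phi j \o coordV c) (q z) h t).
    apply/funext => t; rewrite /dquot /U -sumrB mulr_sumr; apply: eq_bigr => j _; ring.
  have -> : dotv (DU (q z)) h = \sum_(j <- J) phi j p * dotv (grad (phi j \o coordV c) (q z)) h.
    rewrite /DU; elim: (J) => [|j J' IH].
      by rewrite !big_nil /dotv big1 // => i _; rewrite mxE mul0r.
    by rewrite !big_cons -IH -dotvZl /dotv -big_split; apply: eq_bigr => i _; rewrite mxE mulrDl.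
  apply: cvg_sumr => j _; apply: (cvgM (cvg_cst (phi j p))); apply: dquot_cvg; exact: C1j.
- move=> z h zlt1; have zO := qO z (ltW zlt1).
  have -> : dquot2 U (q z) h = (fun t => \sum_(j <- J) phi j p * dquot2 (phi j \o coordV c) (q z) h t).
    apply/funext => t; rewrite /dquot2 /U -big_split mulr_sumr -sumrB mulr_sumr /=.
    by apply: eq_bigr => j _; ring.
  have -> : quadf (HU (q z)) h = \sum_(j <- J) phi j p * quadf (hess (phi j \o coordV c) (q z)) h.
    rewrite /HU; elim: (J) => [|j J' IH].
      by rewrite !big_nil /quadf mulmx0 mul0mx mxE.
    by rewrite !big_cons -IH -quadfZ /quadf mulmxDr mulmxDl mxE.
  apply: cvg_sumr => j _; apply: (cvgM (cvg_cst (phi j p))); apply: dquot2_cvg => [|i].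
    by apply: filterS (nO _ zO) => x; exact: C1j.
  exact: C1pj.
- by move=> z zlt1; rewrite trmx_inv (Defs.metric_sym hc (qO z (ltW zlt1))).
- by move=> z i j zlt1; have [_ + _ _] := data (qx0 _ (ltW zlt1)); apply.
- move=> z i zlt1; have [_ _ + _] := data (qx0 _ (ltW zlt1)) => /(_ i) h.
  rewrite normrM gtr0_norm //; apply: le_trans rhobe; by rewrite ler_pM2l.
- move=> z zlt1; have zO := qO z (ltW zlt1).
  have -> : \sum_i \sum_j invmx (metric c (q z)) i j * HU (q z) i j + dotv (drift c (q z)) (DU (q z)) =
     - \sum_(j <- J) mu j ^+ 2 * (phi j p * phi j (coordV c (q z))).
    have [pz cpz qE] := zO.
    have lap j : mu j ^+ 2 * phi j (coordV c (q z)) =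
       - (\sum_i \sum_k invmx (metric c (q z)) i k * hess (phi j \o coordV c) (q z) i k +
        dotv (drift c (q z)) (grad (phi j \o coordV c) (q z))).
      rewrite -(laplace_chartE hc (eig j).1 zO) -qE coordKV //.
      by rewrite -((eig j).2 c pz hc cpz).
    rewrite /HU /DU; elim: (J) => [|j J' IH].
      rewrite !big_nil oppr0 /dotv big1 => [|i _]; last by rewrite big1 // => k _; rewrite mxE mulr0.
      by rewrite add0r big1 // => i _; rewrite [X in _ * X]mxE mulr0.
    rewrite !big_cons opprD -IH mulrCA lap mulrN opprK mulrDr.
    rewrite [RHS]addrACA; congr (_ + _).
      rewrite mulr_sumr -big_split; apply: eq_bigr => i _ /=.
      rewrite mulr_sumr -big_split; apply: eq_bigr => k _ /=.
      by rewrite [X in _ * X = _]mxE [X in _ * (X + _) = _]mxE; ring.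
    rewrite -dotvZr /dotv -big_split; apply: eq_bigr => i _ /=.
    by rewrite [X in _ * X = _]mxE; ring.
  rewrite normrN; apply: (le_trans (ler_norm_sum _ _ _)).
  apply: (@le_trans _ _ (T ^+ 2 * A)).
    apply: (@le_trans _ _ (\sum_(j <- J) T ^+ 2 * `|phi j p * phi j (coordV c (q z))|)).
      rewrite !big_seq; apply: ler_sum => j jJ; rewrite normrM normrX ger0_norm //.
      apply: ler_wpM2r => //; apply: lerXn2r; rewrite ?nnegrE //; last exact: muT.
    rewrite -mulr_sumr; apply: ler_wpM2l; [exact: sqr_ge0|exact: sum_abs_phi].
  rewrite ler_pdivlMr ?exprn_gt0 // (_ : T ^+ 2 * A * rho ^+ 2 = (rho * T) ^+ 2 * A); last by ring.
  by rewrite ler_piMl ?(ltW A0) // exprn_ile1 // mulr_ge0 // ltW.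
Qed.

Let r0 : R := ((200 * d%:R) ^+ 3)^-1.

(** [psi z <= (200 d)^-1] means a Euclidean length of at most [(200 d)^-2]; the third factor in [r0]
    absorbs the [sqrt d] between the Euclidean and the sup norm. *)
Lemma psi_small (z : 'rV[R]_d) : `|z| <= r0 -> 100 * d%:R * psi z <= 1 / 2.
Proof.
move=> z1; have d1 : 0 < d%:R :> R by rewrite ltr0n.
set D := 200 * d%:R : R; have D0 : 0 < D by rewrite mulr_gt0 ?ltr0n.
suff : psi z <= D^-1.
  by move=> h; apply: (@le_trans _ _ (100 * d%:R * D^-1)); [rewrite ler_pM2l // mulr_gt0|rewrite /D le_eqVlt; apply/orP; left; apply/eqP; field; rewrite gt_eqF].
rewrite -(@ler_pXn2r _ 4) // ?nnegrE ?psi_ge0 ?invr_ge0 ?(ltW D0) // psi4.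
apply: (@le_trans _ _ (d%:R * r0 ^+ 2)).
  rewrite /dotv -[d in d%:R]card_ord mulr_natl -sumr_const; apply: ler_sum => i _.
  rewrite -expr2 -real_normK ?num_real //; apply: lerXn2r; rewrite ?nnegrE //.
    by rewrite invr_ge0 exprn_ge0 ?(ltW D0).
  exact: le_trans (rV_norm_coord z i) z1.
rewrite /r0 -/D -exprVn -exprM (_ : (3 * 2 = 4 + 2)%N) // exprD mulrCA.
rewrite ler_piMr ?exprn_ge0 ?invr_ge0 ?(ltW D0) //.
rewrite exprVn -[_ / _]/(_ / _) ler_pdivrMr ?exprn_gt0 // mul1r /D.
have : 1 <= d%:R :> R by rewrite ler1n.
by move=> d2; nra.
Qed.

Lemma weyl_at_max : A * (de * (2 * (rho * r0 / v)) ^+ d) <= 4.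
Proof.
have r00 : 0 < r0 by rewrite invr_gt0 exprn_gt0 ?mulr_gt0 ?ltr0n.
set s := rho * r0 / v; have s0 : 0 < s by rewrite divr_gt0 // mulr_gt0.
have r01 : r0 <= 1.
  rewrite invf_le1 ?exprn_gt0 ?mulr_gt0 ?ltr0n // exprn_ege1 //.
  have : 1 <= d%:R :> R by rewrite ler1n.
  lra.
pose cube := [set y : 'rV[R]_d | forall i, `|y 0 i - x1 0 i| < s].
have cubeE y : cube y -> `|y - x1| < s.
  by move=> cy; apply: rV_norm_lt => // i; rewrite !mxE.
have sv : s <= rho / v.
  by rewrite /s ler_pM2r ?invr_gt0 // ler_piMr ?(ltW rho0).
have cube_x0 y : cube y -> `|y - x0| < R0.
  move=> /cubeE yx1; have -> : y - x0 = (y - x1) *m V *m invmx V + (x1 - x0).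
    by rewrite mulmxK // addrA subrK.
  rewrite (splitr R0); apply: (le_lt_trans (ler_normD _ _)); apply: ler_ltD => //.
  apply: (le_trans (hw _)); apply: le_trans rhow; rewrite mulrC ler_pM2r //.
  apply: (le_trans (hv _)); rewrite mulrC -ler_pdivlMr //; apply: le_trans sv; exact: ltW.
pose S : set (borel M) := [set q | Defs.dom c q /\ cube (Defs.coord c q)].
have Sdom : S `<=` Defs.dom c by move=> q [].
have SE : Defs.coord c @` S = cube.
  apply/seteqP; split=> [_ [q [_ h] <-] //|y cy].
  have [[q cq qy] _ _ _] := data (cube_x0 y cy).
  by exists q => //; split => //; rewrite qy.
have mS : measurable S.
  apply: sub_sigma_algebra; rewrite openE => q [cq cubeq].
  have n1 : nbhs q (Defs.dom c) by exact: open_nbhs_nbhs (conj (dom_open c) cq).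
  have n2 : \forall q' \near q, cube (Defs.coord c q').
    have h i : \forall q' \near q, `|Defs.coord c q' 0 i - x1 0 i| < s.
      have ci : Defs.coord c q' 0 i @[q' --> q] --> Defs.coord c q 0 i.
        exact: (continuous_comp (coord_continuous_at cq) (@matrix_normedtype.coord_continuous _ _ _ 0 i _)).
      have ci2 : `|Defs.coord c q' 0 i - x1 0 i| @[q' --> q] --> `|Defs.coord c q 0 i - x1 0 i|.
        by apply: cvg_norm; apply: cvgB => //; exact: cvg_cst.
      by apply: (cvgr_lt _ ci2); exact: cubeq.
    by near=> q'; near: q'; apply: filter_forall => i; exact: h.
  by near=> q'; split; near: q'.
have uS q : S q -> A / 2 <= u q.
  move=> [cq cubeq]; have qx := cubeE _ cubeq.
  have := @eigensum_drop (Defs.coord c q) (le_trans (ltW qx) sv).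
  rewrite coordKV // => h.
  have : 100 * d%:R * psi (rho^-1 *: ((Defs.coord c q - x1) *m V)) <= 1 / 2.
    apply: psi_small; rewrite normrZ gtr0_norm ?invr_gt0 // mulrC ler_pdivrMr //.
    apply: (le_trans (hv _)); rewrite mulrC -ler_pdivlMr // [r0 * _]mulrC; exact: ltW.
  move=> h2; have : A * (100 * d%:R * psi (rho^-1 *: ((Defs.coord c q - x1) *m V))) <= A * (1 / 2).
    by rewrite ler_pM2l.
  lra.
have volS : ((de * (2 * s) ^+ d)%:E <= vol S)%E.
  rewrite (hvol hc mS Sdom) SE -(integral_rV_cube x1 s0 (ltW de0)).
  apply: le_integral_rV => y; first by rewrite lee_fin mulr_ge0 ?(ltW de0) // indicE.
  rewrite lee_fin -[X in de * X]/(\1_cube y) !indicE; case: (boolP (y \in cube)) => [/set_mem cy|_]; last by rewrite /= mulr0 mul0r.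
  by have [_ _ _] := data (cube_x0 y cy); rewrite /= mulr1 mul1r.
have phic j : continuous (phi j) by exact: smooth_continuous (eig j).1.
have mphi j : measurable_fun setT (phi j : borel M -> R) by exact: measurable_continuous.
have intu := @int_sum_phi_sqr _ (borel M) R vol phi mphi orth J (fun j => phi j p) uJ.
have : (((A / 2) ^+ 2 * (de * (2 * s) ^+ d))%:E <= A%:E)%E.
  rewrite [leRHS](_ : _ = (\int[vol]_q ((u q) ^+ 2)%:E)%E); last by rewrite intu.
  apply: (@le_trans _ _ (\int[vol]_q (((A / 2) ^+ 2)%:E * (\1_S q)%:E))%E).
    rewrite ge0_integralZl_EFin ?sqr_ge0 //=; last by apply/measurable_EFinP; exact: measurable_indic.
    rewrite integral_indic // setIT EFinM; apply: lee_wpmul2l => //.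
    by rewrite lee_fin sqr_ge0.
  apply: ge0_le_integral_nonmeas => q; first by rewrite -EFinM lee_fin mulr_ge0 ?sqr_ge0 // indicE.
  rewrite indicE; case: (boolP (q \in S)) => [/set_mem Sq|_]; last by rewrite /= mule0 lee_fin sqr_ge0.
  rewrite /= mule1 lee_fin; apply: lerXn2r; rewrite ?nnegrE ?uS //.
    by rewrite divr_ge0 // ltW.
  by apply: le_trans (uS _ Sq); rewrite divr_ge0 // ltW.
rewrite lee_fin expr2 => h.
have : A * (A * (de * (2 * s) ^+ d)) <= A * 4 by move: h; set X := de * _; lra.
by rewrite ler_pM2l.
Unshelve. all: by end_near. Qed.

End at_max.

(** A property of [p] only for those sums that are maximal at [p], where the doubling argument runs;
    the maximum point varies with [J], so the constant must be uniform in [p] before [J] is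
    chosen. *)
Definition weyl_bound_at (T0 C : R) (p : M) := forall (J : seq nat) (T : R),
  uniq J -> T0 <= T -> (forall j, j \in J -> mu j <= T) ->
  (forall q, \sum_(j <- J) phi j q ^+ 2 <= \sum_(j <- J) phi j p ^+ 2) ->
  \sum_(j <- J) phi j p ^+ 2 <= C * T ^+ d.

Lemma local_weyl (T0 : R) (p0 : M) : 0 < T0 ->
  exists C0 : R, \forall p \near p0, forall C, C0 <= C -> weyl_bound_at T0 C p.
Proof.
move=> T00; have [c hc cp0] := atlas_cover p0.
have [V [R0 [be [de [Vu R00 be0 de0 data]]]]] := chart_data hc (img_coord cp0).
have [w w0 hw] := mulmx_bound (invmx V); have [v v0 hv] := mulmx_bound V.
(* For [rho = ka / T] and [T0 <= T] the three entries give [rho * T <= 1], [rho * be <= 1] and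
   [rho * w <= R0 / 2]. *)
pose ka := Num.min 1 (Num.min (T0 / be) (T0 * R0 / (2 * w))).
have ka0 : 0 < ka by rewrite !lt_min ltr01 !divr_gt0 ?mulr_gt0.
pose r0 : R := ((200 * d%:R) ^+ 3)^-1.
have r00 : 0 < r0 by rewrite invr_gt0 exprn_gt0 ?mulr_gt0 ?ltr0n.
pose B := de * (2 * (ka * r0 / v)) ^+ d.
have B0 : 0 < B by rewrite mulr_gt0 // exprn_gt0 // mulr_gt0 // divr_gt0 // mulr_gt0.
exists (4 / B).
have n1 : \forall p \near p0, Defs.dom c p by exact: open_nbhs_nbhs (conj (dom_open c) cp0).
have n2 : \forall p \near p0, `|Defs.coord c p - Defs.coord c p0| < R0 / 2.
  have /(cvgrPdist_lt (F := nbhs p0)) /(_ _ (divr_gt0 R00 (ltr0n _ 2))) := coord_continuous_at cp0.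
  by apply: filterS => p; rewrite distrC.
apply: filterS2 n1 n2 => p cp px C C0C J T uJ T0T muT pmax.
have T0' : 0 < T by exact: lt_le_trans T0T.
set A := \sum_(j <- J) phi j p ^+ 2.
have A0 : 0 <= A by apply: sumr_ge0 => j _; rewrite sqr_ge0.
apply: (@le_trans _ _ (4 / B * T ^+ d)); last by rewrite ler_wpM2r // exprn_ge0 // ltW.
(* The rescaling divides by [A]. *)
have [->|An0] := eqVneq A 0; first by rewrite mulr_ge0 ?divr_ge0 ?exprn_ge0 ?(ltW B0) ?(ltW T0').
have {An0}A0 : 0 < A by rewrite lt_neqAle eq_sym An0.
have kT : ka / T <= ka / T0 by rewrite ler_pM2l // lef_pV2 ?posrE.
have ka1 : ka <= 1 by rewrite ge_min lexx.
have ka2 : ka / T * be <= 1.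
  apply: (@le_trans _ _ (ka / T0 * be)); first by rewrite ler_pM2r.
  apply: (@le_trans _ _ ((T0 / be) / T0 * be)); last first.
    by rewrite le_eqVlt; apply/orP; left; apply/eqP; field; rewrite !gt_eqF.
  by rewrite ler_pM2r // ler_pM2r ?invr_gt0 // ge_min; apply/orP; right; rewrite ge_min lexx.
have ka3 : ka / T * w <= R0 / 2.
  apply: (@le_trans _ _ (ka / T0 * w)); first by rewrite ler_pM2r.
  apply: (@le_trans _ _ ((T0 * R0 / (2 * w)) / T0 * w)); last first.
    by rewrite le_eqVlt; apply/orP; left; apply/eqP; field; rewrite !gt_eqF.
  by rewrite ler_pM2r // ler_pM2r ?invr_gt0 // ge_min; apply/orP; right; rewrite ge_min lexx orbT.
have ka4 : ka / T * T <= 1 by rewrite divfK // gt_eqF.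
have h := weyl_at_max hc Vu de0 data w0 v0 hw hv cp px uJ muT pmax A0 (ltW T0') (divr_gt0 ka0 T0') ka4 ka2 ka3.
have e1 : de * (2 * (ka / T * r0 / v)) ^+ d = B / T ^+ d.
  rewrite /B -[RHS]mulrA -expr_div_n; congr (_ * _ ^+ d); ring.
have Td : 0 < T ^+ d by rewrite exprn_gt0.
by rewrite mulrAC ler_pdivlMr // -ler_pdivrMr // -mulrA -e1.
Qed.

(** Compactness is used in its near-covering form: with the constant running along the filter at
    infinity, the local bounds merge into one. A maximum point of the sum then transfers the bound
    to every point. *)
Lemma global_weyl (T0 : R) : 0 < T0 -> exists2 C : R, 0 < C &
  forall (J : seq nat) (T : R) p, uniq J -> T0 <= T -> (forall j, j \in J -> mu j <= T) ->
  \sum_(j <- J) phi j p ^+ 2 <= C * T ^+ d.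
Proof.
move=> T00; have /compact_near_coveringP := @carrier_compact R d M.
move=> /(_ R +oo (weyl_bound_at T0) _) cov.
have {cov} : \forall C \near +oo, [set: M] `<=` weyl_bound_at T0 C.
  apply: cov => p0 _; have [C0 hC0] := local_weyl p0 T00.
  exists ([set p | forall C, C0 <= C -> weyl_bound_at T0 C p], [set C | C0 <= C]).
    by split => //=; apply: nbhs_pinfty_ge; exact: num_real.
  by move=> [p C] [/= h]; exact: h.
move=> [C1 [_ hC1]]; pose C := Num.max C1 0 + 1.
have C0 : 0 < C by rewrite ltr_wpDl // le_max lexx orbT.
have C1C : C1 < C by apply: (@le_lt_trans _ _ (Num.max C1 0)); rewrite ?le_max ?lexx // ltrDl.
exists C => // J T p uJ T0T muT.
have phic j : continuous (phi j) by exact: smooth_continuous (eig j).1.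
have Ec : continuous (fun q : M => \sum_(j <- J) phi j q ^+ 2).
  move=> q; apply: (cvg_sumr (F := nbhs q)) => j _.
  exact: (cvgM (phic j q) (phic j q)).
have [|||pm _ pmax] := @compact_EVT_max M R (fun q : M => \sum_(j <- J) phi j q ^+ 2) [set: M].
- by exists point.
- exact: carrier_compact.
- exact: continuous_subspaceT.
apply: (le_trans (pmax p _)); first by rewrite inE.
by apply: (hC1 C C1C pm I) => // q; apply: pmax; rewrite inE.
Qed.

End local_weyl.

(** * Finiteness of the constant *)

Section dyadic_sums.
Variables (R : realType) (d : nat) (m : nat -> R) (K : R).
Hypotheses (K0 : 0 <= K).

(* The Weyl bound, as a property of the sequence of values [f j = phi_j(p)^2]. *)
Definition growth (f : nat -> R) (J : seq nat) := forall (J' : seq nat) (T : R),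
  uniq J' -> {subset J' <= J} -> 0 < T -> (forall j, j \in J' -> m j <= T) ->
  \sum_(j <- J') f j <= K * T ^+ d.

Lemma growth_filter f J (a : pred nat) : growth f J -> growth f [seq j <- J | a j].
Proof.
move=> gJ J' T uJ' sJ'; apply: gJ => // j /sJ'; by rewrite mem_filter => /andP[].
Qed.

Lemma exists_max_seq (J : seq nat) : J != [::] ->
  exists2 j0, j0 \in J & forall j, j \in J -> m j <= m j0.
Proof.
elim: J => // i [|i' J] IH _.
  by exists i; rewrite ?mem_head // => j; rewrite inE => /eqP ->.
have [//|j0 j0J h] := IH; have [le|lt] := lerP (m i) (m j0).
  exists j0; first by rewrite inE j0J orbT.
  by move=> j; rewrite inE => /orP[/eqP -> //|]; exact: h.
exists i; first exact: mem_head.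
by move=> j; rewrite inE => /orP[/eqP -> //|/h /le_trans]; apply; exact: ltW.
Qed.

Lemma exists_min_seq (J : seq nat) : J != [::] ->
  exists2 j0, j0 \in J & forall j, j \in J -> m j0 <= m j.
Proof.
elim: J => // i [|i' J] IH _.
  by exists i; rewrite ?mem_head // => j; rewrite inE => /eqP ->.
have [//|j0 j0J h] := IH; have [le|lt] := lerP (m j0) (m i).
  exists j0; first by rewrite inE j0J orbT.
  by move=> j; rewrite inE => /orP[/eqP -> //|]; exact: h.
exists i; first exact: mem_head.
by move=> j; rewrite inE => /orP[/eqP -> //|/h]; apply: le_trans; exact: ltW.
Qed.

Lemma powR_mono (s a b : R) : 0 <= s -> 0 <= a -> a <= b -> a `^ s <= b `^ s.
Proof. by move=> s0 a0 ab; rewrite ge0_ler_powR // nnegrE // (le_trans a0). Qed.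

Lemma powRN_mono (s a b : R) : 0 <= s -> 0 < a -> a <= b ->
  b `^ (- s) <= a `^ (- s).
Proof.
move=> s0 a0 ab; have b0 := lt_le_trans a0 ab.
by rewrite !powRN lef_pV2 ?posrE ?powR_gt0 // powR_mono // ltW.
Qed.

Lemma powR2_lt1 (s : R) : 0 < s -> 0 < 1 - 2 `^ (- s) :> R.
Proof.
move=> s0; rewrite subr_gt0 powRN invf_lt1 ?powR_gt0 //.
have := @gt0_ltr_powR R s s0 1 2.
by rewrite !nnegrE ltr1n powR1 => /(_ ler01 (ler0n _ 2) isT).
Qed.

Lemma shell_sum f J A : uniq J -> growth f J -> 0 < A -> (forall j, 0 <= f j) ->
  (forall j, j \in J -> A <= m j <= 2 * A) ->
  \sum_(j <- J) f j / m j ^+ d <= 2 ^+ d * K.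
Proof.
move=> uJ gJ A0 f0 mA.
apply: (@le_trans _ _ (\sum_(j <- J) f j / A ^+ d)).
  rewrite !big_seq; apply: ler_sum => j /mA /andP[Aj _]; apply: ler_wpM2l => //.
  by rewrite lef_pV2 ?posrE ?exprn_gt0 ?(lt_le_trans A0) // lerXn2r // nnegrE ltW // (lt_le_trans A0).
rewrite -mulr_suml ler_pdivrMr ?exprn_gt0 //.
apply: (le_trans (gJ _ (2 * A) uJ (fun _ h => h) _ _)).
- by rewrite mulr_gt0.
- by move=> j /mA /andP[].
- by rewrite exprMn mulrA (mulrC K).
Qed.

(** Induction on the length of [J]: the top shell, between half the largest value [T1] and [T1], is
    split off, and the rest is bounded at [T1 / 2]. As [T1] is attained, the list shrinks. [C] is
    the solution of [C = C * 2 ^ (- s) + 2 ^ d * K], which closes the induction. *)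
Lemma dyadic_lower (s : R) : 0 < s -> exists2 C : R, 0 <= C & forall f J T,
  uniq J -> growth f J -> 0 < T -> (forall j, 0 <= f j) ->
  (forall j, j \in J -> 0 < m j <= T) ->
  \sum_(j <- J) f j / m j ^+ d * m j `^ s <= C * T `^ s.
Proof.
move=> s0; have q0 := powR2_lt1 s0.
pose C := 2 ^+ d * K / (1 - 2 `^ (- s)).
have C0 : 0 <= C by rewrite divr_ge0 ?mulr_ge0 // ltW.
exists C => // f J; move: {2}(size J) (leqnn (size J)) => n; elim: n J => [|n IH] J Jn T uJ gJ T0 f0 mT.
  by move: Jn; rewrite leqn0 size_eq0 => /eqP ->; rewrite big_nil mulr_ge0 // powR_ge0.
have [->|Jn0] := eqVneq J [::]; first by rewrite big_nil mulr_ge0 // powR_ge0.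
have [j0 j0J jmax] := exists_max_seq Jn0.
set T1 := m j0 in jmax; have /andP[T10 T1T] := mT _ j0J; rewrite -/T1 in T10 T1T.
apply: (@le_trans _ _ (C * T1 `^ s)); last first.
  by rewrite ler_wpM2l // powR_mono // ltW.
rewrite (bigID (fun j => m j <= T1 / 2)) /= -!(big_filter J).
set J1 := [seq _ <- _ | _]; set J2 := [seq _ <- _ | _].
have T20 : 0 < T1 / 2 by rewrite divr_gt0.
have h1 : \sum_(j <- J1) f j / m j ^+ d * m j `^ s <= C * (T1 / 2) `^ s.
  apply: IH => //.
  - rewrite -ltnS; apply: leq_trans Jn; rewrite size_filter -(count_predC (fun j => m j <= T1 / 2)) -[X in (X < _)%N]addn0 ltn_add2l.
    rewrite -has_count; apply/hasP; exists j0 => //=.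
    by rewrite -ltNge -/T1 ltr_pdivrMr // ltr_pMr // ltr1n.
  - exact: filter_uniq.
  - exact: growth_filter.
  - by move=> j; rewrite mem_filter => /andP[-> jJ]; have /andP[->] := mT _ jJ.
have h2 : \sum_(j <- J2) f j / m j ^+ d * m j `^ s <= 2 ^+ d * K * T1 `^ s.
  apply: (@le_trans _ _ (\sum_(j <- J2) f j / m j ^+ d * T1 `^ s)).
    rewrite !big_seq; apply: ler_sum => j; rewrite mem_filter => /andP[_ jJ].
    have /andP[mj0 _] := mT _ jJ.
    by rewrite ler_wpM2l ?divr_ge0 ?exprn_ge0 ?(ltW mj0) // powR_mono ?jmax // ltW.
  rewrite -mulr_suml ler_wpM2r ?powR_ge0 //; apply: (@shell_sum _ _ (T1 / 2)) => //.
  - exact: filter_uniq.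
  - exact: growth_filter.
  - move=> j; rewrite mem_filter -ltNge => /andP[lt jJ]; rewrite ltW //=.
    by rewrite mulrC divfK ?pnatr_eq0 // jmax.
apply: (le_trans (lerD h1 h2)).
have -> : (T1 / 2) `^ s = 2 `^ (- s) * T1 `^ s.
  by rewrite powRM ?invr_ge0 ?(ltW T10) // mulrC -powR_inv1 // -powRrM mulN1r.
rewrite mulrA -mulrDl ler_wpM2r ?powR_ge0 //.
suff -> : 2 ^+ d * K = C * (1 - 2 `^ (- s)) by rewrite -mulrDr addrC subrK mulr1.
by rewrite /C divfK // gt_eqF.
Qed.

(** Mirror image of [dyadic_lower]: the shell just above the smallest value is split off. *)
Lemma dyadic_upper (s : R) : 0 < s -> exists2 C : R, 0 <= C & forall f J T,
  uniq J -> growth f J -> 0 < T -> (forall j, 0 <= f j) ->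
  (forall j, j \in J -> T <= m j) ->
  \sum_(j <- J) f j / m j ^+ d * m j `^ (- s) <= C * T `^ (- s).
Proof.
move=> s0; have q0 := powR2_lt1 s0.
pose C := 2 ^+ d * K / (1 - 2 `^ (- s)).
have C0 : 0 <= C by rewrite divr_ge0 ?mulr_ge0 // ltW.
exists C => // f J; move: {2}(size J) (leqnn (size J)) => n; elim: n J => [|n IH] J Jn T uJ gJ T0 f0 mT.
  by move: Jn; rewrite leqn0 size_eq0 => /eqP ->; rewrite big_nil mulr_ge0 // powR_ge0.
have [->|Jn0] := eqVneq J [::]; first by rewrite big_nil mulr_ge0 // powR_ge0.
have [j0 j0J jmin] := exists_min_seq Jn0.
set T1 := m j0 in jmin; have T1T := mT _ j0J; rewrite -/T1 in T1T.
have T10 := lt_le_trans T0 T1T.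
apply: (@le_trans _ _ (C * T1 `^ (- s))); last by rewrite ler_wpM2l // powRN_mono // ltW.
rewrite (bigID (fun j => 2 * T1 <= m j)) /= -!(big_filter J).
set J1 := [seq _ <- _ | _]; set J2 := [seq _ <- _ | _].
have T20 : 0 < 2 * T1 by rewrite mulr_gt0.
have h1 : \sum_(j <- J1) f j / m j ^+ d * m j `^ (- s) <= C * (2 * T1) `^ (- s).
  apply: IH => //.
  - rewrite -ltnS; apply: leq_trans Jn; rewrite size_filter -(count_predC (fun j => 2 * T1 <= m j)) -[X in (X < _)%N]addn0 ltn_add2l.
    rewrite -has_count; apply/hasP; exists j0 => //=.
    by rewrite -ltNge -/T1 ltr_pMl // ltr1n.
  - exact: filter_uniq.
  - exact: growth_filter.
  - by move=> j; rewrite mem_filter => /andP[-> jJ].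
have h2 : \sum_(j <- J2) f j / m j ^+ d * m j `^ (- s) <= 2 ^+ d * K * T1 `^ (- s).
  apply: (@le_trans _ _ (\sum_(j <- J2) f j / m j ^+ d * T1 `^ (- s))).
    rewrite !big_seq; apply: ler_sum => j; rewrite mem_filter => /andP[_ jJ].
    have mj0 := lt_le_trans T10 (jmin _ jJ).
    by rewrite ler_wpM2l ?divr_ge0 ?exprn_ge0 ?(ltW mj0) // powRN_mono ?jmin // ltW.
  rewrite -mulr_suml ler_wpM2r ?powR_ge0 //; apply: (@shell_sum _ _ T1) => //.
  - exact: filter_uniq.
  - exact: growth_filter.
  - by move=> j; rewrite mem_filter -ltNge => /andP[lt jJ]; rewrite jmin // ltW.
apply: (le_trans (lerD h1 h2)).
rewrite powRM ?(ltW T10) // mulrA -mulrDl ler_wpM2r ?powR_ge0 //.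
suff -> : 2 ^+ d * K = C * (1 - 2 `^ (- s)) by rewrite -mulrDr addrC subrK mulr1.
by rewrite /C divfK // gt_eqF.
Qed.

End dyadic_sums.

Lemma powR_sum (R : realType) (I : finType) (P : pred I) (x : R) (e : I -> R) :
  0 < x -> x `^ (\sum_(i | P i) e i) = \prod_(i | P i) x `^ e i.
Proof.
move=> x0; apply: (big_morph (powR x)) => [a b|]; last exact: powRr0.
by rewrite powRD // (gt_eqF x0) implybT.
Qed.

(** * Bounds uniform in the weights *)

Section weighted_sums.
Variables (R : realType) (m : nat) (lam r : 'I_m.+1 -> R).
Hypotheses (hlam : forall j, 0 < lam j) (hlam1 : \sum_(j < m.+1) lam j = 1).

Lemma prod_powR_le (X : 'I_m.+1 -> R) (S : R) (i : 'I_m.+1) :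
  (forall l, 0 < X l) -> (forall l, X l <= S) ->
  \prod_(l < m.+1) X l `^ lam l <= X i `^ lam i * S `^ (1 - lam i).
Proof.
move=> X0 XS; have S0 : 0 < S := lt_le_trans (X0 i) (XS i).
have -> : 1 - lam i = \sum_(l < m.+1 | l != i) lam l.
  by rewrite -hlam1 (bigD1 i) //= addrAC subrr add0r.
rewrite (bigD1 i) //= ler_wpM2l ?powR_ge0 // powR_sum //.
by apply: ler_prod => l _; rewrite powR_ge0 /= powR_mono // ltW.
Qed.

(* Used with the extreme indices in both orders: the weight decays geometrically
   on either side of the value of [mu] at which the two extreme terms balance. *)
Lemma prod_powR_ratio (X : 'I_m.+1 -> R) (i i' : 'I_m.+1) : i != i' ->
  (forall l, 0 < X l) ->
  \prod_(l < m.+1) X l `^ lam l / \sum_(l < m.+1) X l <= (X i / X i') `^ lam i.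
Proof.
move=> ii' X0; set S := \sum_(l < m.+1) X l.
have XS l : X l <= S by rewrite /S (bigD1 l) //= lerDl sumr_ge0 // => j _; exact: ltW.
have S0 : 0 < S := lt_le_trans (X0 i) (XS i).
rewrite ler_pdivrMr //; apply: (le_trans (prod_powR_le i X0 XS)).
rewrite powRM ?invr_ge0 ?(ltW (X0 _)) // -mulrA ler_wpM2l ?powR_ge0 //.
rewrite -[(X i')^-1]powR_inv1 ?(ltW (X0 _)) // -powRrM mulN1r.
rewrite powRD ?(gt_eqF S0) ?implybT // powRr1 ?(ltW S0) // mulrC ler_wpM2r ?(ltW S0) //.
by rewrite powRN_mono // ltW.
Qed.

Variables (d : nat) (mu : nat -> R) (K mu0 k : R).
Hypotheses (K0 : 0 <= K) (mu00 : 0 < mu0) (d0 : (0 < d)%N) (hm : (1 <= m)%N).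
Hypotheses (hr : forall i j : 'I_m.+1, (i < j)%N -> r i < r j)
  (hk : k + (2 * d%:R - 1) / 4 <= \sum_(j < m.+1) lam j * r j).

Let weight (h : 'I_m.+1 -> R) (x : R) := \sum_(l < m.+1) h l * x `^ (4 * r l).

(** Expresses the product through the summands of [weight h x], as [prod_powR_ratio] requires; the
    remaining power of [x] competes with [x ^ (4 k)]. *)
Lemma prod_weight (h : 'I_m.+1 -> R) (x : R) : (forall l, 0 < h l) -> 0 < x ->
  \prod_(l < m.+1) h l `^ lam l =
  \prod_(l < m.+1) (h l * x `^ (4 * r l)) `^ lam l *
  x `^ (- (4 * \sum_(j < m.+1) lam j * r j)).
Proof.
move=> h0 x0.
rewrite [X in _ = X * _](eq_bigr (fun l => h l `^ lam l * x `^ (4 * (lam l * r l)))); last first.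
  move=> l _; rewrite powRM ?powR_ge0 ?(ltW (h0 _)) // -powRrM.
  by rewrite -mulrA (mulrC (r l)).
rewrite big_split /= -mulrA.
have <- : x `^ (4 * \sum_(j < m.+1) lam j * r j) =
          \prod_(l < m.+1) x `^ (4 * (lam l * r l)).
  rewrite mulr_sumr.
  by rewrite powR_sum.
by rewrite powRN divff ?mulr1 // gt_eqF ?powR_gt0.
Qed.

Let i0 : 'I_m.+1 := ord0.
Let im : 'I_m.+1 := ord_max.
Let delta := 4 * (r im - r i0).

Let delta0 : 0 < delta.
Proof. by rewrite mulr_gt0 // subr_gt0 hr. Qed.

(** The decay left in each term once [x ^ d] has been set aside for the Weyl bound. Being
    nonnegative by [hk], it is paid for by a constant, since all [mu j] are at least [mu0]. *)
Let excess := 4 * (\sum_(j < m.+1) lam j * r j - k) - d%:R.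

Let excess0 : 0 <= excess.
Proof.
have d1 : (1 : R) <= d%:R by rewrite ler1n.
by rewrite /excess; move: hk d1; set S := \sum_(j < _) _; set D := d%:R; lra.
Qed.

Lemma weight_term (h : 'I_m.+1 -> R) (x : R) (i i' : 'I_m.+1) : i != i' ->
  (forall l, 0 < h l) -> mu0 <= x ->
  \prod_(l < m.+1) h l `^ lam l * (x `^ (4 * k) / weight h x) <=
  mu0 `^ (- excess) / x ^+ d *
    (h i / h i' * x `^ (4 * (r i - r i'))) `^ lam i.
Proof.
move=> ii' h0 x0; have xp := lt_le_trans mu00 x0.
have X0 l : 0 < h l * x `^ (4 * r l) by rewrite mulr_gt0 ?powR_gt0.
rewrite (prod_weight h0 xp) [_ / weight h x]mulrC mulrACA -powRD ?(gt_eqF xp) ?implybT //.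
have -> : - (4 * \sum_(j < m.+1) lam j * r j) + 4 * k = - excess - d%:R.
  by rewrite /excess; set S := \sum_(j < _) _; lra.
rewrite powRD ?(gt_eqF xp) ?implybT // powR_invn ?(ltW xp) //.
have := prod_powR_ratio ii' X0; rewrite -/(weight h x).
have -> : h i * x `^ (4 * r i) / (h i' * x `^ (4 * r i')) =
          h i / h i' * x `^ (4 * (r i - r i')).
  by rewrite invfM mulrACA mulrBr powRB // (gt_eqF xp) implybT.
move=> ratio; rewrite mulrC; apply: ler_pM => //.
- by rewrite mulr_ge0 ?powR_ge0 // invr_ge0 exprn_ge0 // ltW.
- apply: divr_ge0; first by apply: prodr_ge0 => l _; exact: powR_ge0.
  by apply: sumr_ge0 => l _; exact: ltW.
- by rewrite ler_wpM2r ?invr_ge0 ?exprn_ge0 ?(ltW xp) // powRN_mono.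
Qed.

Lemma weighted_sum_bounded : exists2 C : R, 0 <= C & forall h f J,
  (forall l, 0 < h l) -> uniq J -> growth d mu K f J -> (forall j, 0 <= f j) ->
  (forall j, j \in J -> mu0 <= mu j) ->
  \prod_(l < m.+1) h l `^ lam l *
    \sum_(j <- J) mu j `^ (4 * k) * f j / weight h (mu j) <= C.
Proof.
have s1 : 0 < delta * lam im by rewrite mulr_gt0.
have s2 : 0 < delta * lam i0 by rewrite mulr_gt0.
have [C1 C10 H1] := dyadic_lower d mu K0 s1.
have [C2 C20 H2] := dyadic_upper d mu K0 s2.
have e0 : 0 <= mu0 `^ (- excess) by exact: powR_ge0.
exists (mu0 `^ (- excess) * (C1 + C2)); first by rewrite mulr_ge0 // addr_ge0.
move=> h f J h0 uJ gJ f0 muJ.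
(* At [mu = T] the two extreme terms of the weight are equal. Below [T] a summand gains the factor
   [(mu / T)] to the power [delta * lam im], above it the factor [(T / mu)] to the power
   [delta * lam i0]; the dyadic sums cancel the powers of [T], and with them all dependence on
   [h]. *)
pose T := (h i0 / h im) `^ delta^-1.
have h00 : 0 < h i0 / h im by rewrite divr_gt0.
have T0 : 0 < T by rewrite powR_gt0.
have Td : T `^ delta = h i0 / h im.
  by rewrite -powRrM mulVf ?gt_eqF // powRr1 // ltW.
have i0m : i0 != im by rewrite -val_eqE /= eq_sym -lt0n.
have low j : j \in J -> \prod_(l < m.+1) h l `^ lam l *
    (mu j `^ (4 * k) * f j / weight h (mu j)) <=
    (mu0 `^ (- excess) * T `^ (- (delta * lam im))) *
    (f j / mu j ^+ d * mu j `^ (delta * lam im)).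
  move=> jJ; have mp := lt_le_trans mu00 (muJ _ jJ).
  have := weight_term _ h0 (muJ _ jJ) (i := im) (i' := i0); rewrite eq_sym i0m => /(_ isT) w.
  rewrite (mulrAC (mu j `^ (4 * k))) [leLHS]mulrA; apply: (le_trans (ler_wpM2r (f0 j) w)).
  have -> : h im / h i0 = T `^ (- delta) by rewrite powRN Td invf_div.
  rewrite powRM ?powR_ge0 // -!powRrM mulNr -/delta le_eqVlt; apply/orP; left; apply/eqP.
  by ring.
have upp j : j \in J -> \prod_(l < m.+1) h l `^ lam l *
    (mu j `^ (4 * k) * f j / weight h (mu j)) <=
    (mu0 `^ (- excess) * T `^ (delta * lam i0)) *
    (f j / mu j ^+ d * mu j `^ (- (delta * lam i0))).
  move=> jJ; have mp := lt_le_trans mu00 (muJ _ jJ).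
  have w := weight_term i0m h0 (muJ _ jJ).
  rewrite (mulrAC (mu j `^ (4 * k))) [leLHS]mulrA; apply: (le_trans (ler_wpM2r (f0 j) w)).
  rewrite -Td -opprB mulrN -/delta.
  rewrite powRM ?powR_ge0 // -!powRrM mulNr le_eqVlt; apply/orP; left; apply/eqP.
  by ring.
rewrite mulr_sumr (bigID (fun j => mu j <= T)) /= -!(big_filter J) mulrDr.
apply: lerD.
  apply: (@le_trans _ _ ((mu0 `^ (- excess) * T `^ (- (delta * lam im))) *
     \sum_(j <- [seq j <- J | mu j <= T]) f j / mu j ^+ d * mu j `^ (delta * lam im))).
    rewrite mulr_sumr big_seq [leRHS]big_seq; apply: ler_sum => j; rewrite mem_filter => /andP[_ jJ].
    exact: low.
  rewrite -mulrA ler_wpM2l // mulrC powRN ler_pdivrMr ?powR_gt0 //; apply: H1 => //.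
  - exact: filter_uniq.
  - exact: growth_filter.
  - by move=> j; rewrite mem_filter => /andP[-> /muJ /(lt_le_trans mu00) ->].
apply: (@le_trans _ _ ((mu0 `^ (- excess) * T `^ (delta * lam i0)) *
   \sum_(j <- [seq j <- J | ~~ (mu j <= T)]) f j / mu j ^+ d * mu j `^ (- (delta * lam i0)))).
  rewrite mulr_sumr big_seq [leRHS]big_seq; apply: ler_sum => j; rewrite mem_filter => /andP[_ jJ].
  exact: upp.
rewrite -mulrA ler_wpM2l // mulrC -ler_pdivlMr ?powR_gt0 // -powRN; apply: H2 => //.
- exact: filter_uniq.
- exact: growth_filter.
- by move=> j; rewrite mem_filter -ltNge => /andP[/ltW].
Qed.
End weighted_sums.

(** * Square-integrable functions and the Riesz-Fischer theorem *)

Section square_integral.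
Variables (dd : measure_display) (T : measurableType dd) (R : realType).
Variable mu : {measure set T -> \bar R}.
Implicit Types f g y : T -> R.

Definition sqint f : \bar R := (\int[mu]_p (f p ^+ 2)%:E)%E.

Lemma sqint_ge0 f : (0 <= sqint f)%E.
Proof. by apply: integral_ge0 => p _; rewrite lee_fin sqr_ge0. Qed.

Lemma measurable_sqrE f : measurable_fun setT f ->
  measurable_fun setT (fun p => (f p ^+ 2)%:E).
Proof. by move=> mf; apply/measurable_EFinP; exact: measurable_funX. Qed.

Lemma eq_sqint f g : f =1 g -> sqint f = sqint g.
Proof. by move=> fg; rewrite /sqint; apply: eq_integral => p _; rewrite fg. Qed.

Lemma sqint_subC f g : sqint (f \- g) = sqint (g \- f).
Proof. by apply: eq_integral => p _; rewrite /= -sqrrN opprB. Qed.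

Lemma Lfun2P f : f \in Lfun mu 2%:E <-> measurable_fun setT f /\ (sqint f < +oo)%E.
Proof.
split=> [lf|[mf qf]].
  move: (lf) => /[!inE] /andP[/[!inE]/= mf _]; split => //.
  have /integrableP[_] := Lfun2_integrable_sqr lf.
  by rewrite (eq_integral (fun p => (f p ^+ 2)%:E)) // => p _ /=; rewrite ger0_norm // sqr_ge0.
rewrite inE; apply/andP; split; first by rewrite inE.
rewrite inE /= /finite_norm unlock /Lnorm; apply: poweR_lty.
rewrite (eq_integral (fun p => (f p ^+ 2)%:E)) // => p _ /=.
by rewrite powR_mulrn // real_normK // num_real.
Qed.

(* Replaces the triangle inequality: [0 <= e^-1 * (e * f - g)^2]. *)
Lemma sqintD_le f g (e : R) : measurable_fun setT f -> measurable_fun setT g -> 0 < e ->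
  (sqint (f \+ g)%R <= (1 + e)%:E * sqint f + (1 + e^-1)%:E * sqint g)%E.
Proof.
move=> mf mg e0; have ei0 : 0 < e^-1 by rewrite invr_gt0.
have h1 : 0 <= 1 + e by rewrite addr_ge0 // ltW.
have h2 : 0 <= 1 + e^-1 by rewrite addr_ge0 // ltW.
rewrite /sqint -!ge0_integralZl //=; try exact: measurable_sqrE; try by move=> p _; rewrite lee_fin sqr_ge0.
rewrite -ge0_integralD //=; last first.
- by apply: measurable_funeM; exact: measurable_sqrE.
- by move=> p _; rewrite mule_ge0 // lee_fin // sqr_ge0.
- by apply: measurable_funeM; exact: measurable_sqrE.
- by move=> p _; rewrite mule_ge0 // lee_fin // sqr_ge0.
apply: ge0_le_integral => //=.
- by move=> p _; rewrite lee_fin sqr_ge0.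
- by apply: measurable_sqrE; exact: measurable_funD.
- by apply: emeasurable_funD; apply: measurable_funeM; exact: measurable_sqrE.
move=> p _; rewrite -!EFinM -EFinD lee_fin.
have : 0 <= e^-1 * (e * f p - g p) ^+ 2 by rewrite mulr_ge0 ?sqr_ge0 // ltW.
have -> : e^-1 * (e * f p - g p) ^+ 2 = e * f p ^+ 2 - 2 * f p * g p + e^-1 * g p ^+ 2.
  by field; rewrite gt_eqF.
by nra.
Qed.

Lemma sqint_fatou (u : nat -> T -> R) y (c : \bar R) (N : nat) :
  (forall n, measurable_fun setT (u n)) -> measurable_fun setT y ->
  {ae mu, forall p, u n p @[n --> \oo] --> y p} ->
  (forall n, (N <= n)%N -> (sqint (u n) <= c)%E) -> (sqint y <= c)%E.
Proof.
move=> mu_ my uy uc.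
(* Shifted, because the bound is assumed only from [N] on. *)
pose F n p := ((u (n + N)%N p) ^+ 2)%:E : \bar R.
have mF n : measurable_fun setT (F n) by exact: measurable_sqrE.
have F0 n p : setT p -> (0 <= F n p)%E by move=> _; rewrite lee_fin sqr_ge0.
have lF : measurable_fun setT (fun p => limn_einf (F^~ p)).
  rewrite /limn_einf; apply: measurableT_comp; first exact: oppe_measurable.
  by apply: measurable_fun_limn_esup => n; apply: measurableT_comp => //; exact: oppe_measurable.
apply: (@le_trans _ _ (\int[mu]_p limn_einf (F^~ p))%E).
  apply: ae_ge0_le_integral => //.
  - by move=> p _; rewrite lee_fin sqr_ge0.
  - exact: measurable_sqrE.
  - move=> p _; rewrite limn_einf_lim; apply: lime_ge; first exact: is_cvg_einfs.
    by apply: nearW => n; apply: le_ereal_inf_tmp => _ [k _ <-]; exact: F0.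
  - apply: filterS uy => p up _.
    have /cvg_limn_einf_sup[-> _] // : F ^~ p @ \oo --> (y p ^+ 2)%:E.
    apply: cvg_EFin; first exact: nearW.
    have up' : u (n + N)%N p @[n --> \oo] --> y p by rewrite (cvg_shiftn N (u^~ p)).
    rewrite expr2; apply: cvg_trans (cvgM up' up').
    by apply: near_eq_cvg; apply: nearW => n; rewrite /F /= expr2.
apply: (le_trans (fatou _ _ _ _)) => //.
rewrite limn_einf_lim; apply: lime_le; first exact: is_cvg_einfs.
apply: nearW => n; apply: le_trans (uc (n + N)%N (leq_addl _ _)).
by apply: ereal_inf_lbound; exists n => /=.
Qed.

Lemma sqint_eq0 f : measurable_fun setT f -> sqint f = 0%E -> {ae mu, forall p, f p = 0}.
Proof.
move=> mf q0; have := (ae_eq_integral_abs mu measurableT (measurable_sqrE mf)).1.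
rewrite (eq_integral (fun p => (f p ^+ 2)%:E)) => [/(_ q0)|p _]; last first.
  by rewrite /= ger0_norm // sqr_ge0.
apply: filterS => p /(_ I) /= [] /eqP; by rewrite sqrf_eq0 => /eqP.
Qed.

Lemma cvg_abs_series_bounded (u : nat -> R) (B : R) :
  (forall n, \sum_(0 <= k < n) `|u k.+1 - u k| <= B) -> cvgn u.
Proof.
move=> uB; have : cvgn (series (fun k => u k.+1 - u k)).
  apply: normed_cvg; pose v n : R := \sum_(0 <= k < n) `|u k.+1 - u k|.
  suff : cvgn v by [].
  apply: nondecreasing_is_cvgn; last by exists B => _ [n _ <-]; exact: uB.
  by apply/nondecreasing_seqP => n; rewrite /v big_nat_recr //= lerDl.
move=> h; suff -> : u = cst (u 0%N) \+ series (fun k => u k.+1 - u k).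
  by apply: is_cvgD h; exact: is_cvg_cst.
by apply/funext => n; rewrite /= -[series _]/(series (telescope u)) -eq_sum_telescope.
Qed.

End square_integral.

(** * Partial sums and completeness *)

Section riesz_fischer.
Variables (dd : measure_display) (T : measurableType dd) (R : realType).
Variables (mu : {measure set T -> \bar R}) (phi : nat -> T -> R).
Hypothesis mphi : forall j, measurable_fun setT (phi j).
Hypothesis orth : forall i j, \int[mu]_p (phi i p * phi j p) = (i == j)%:R.

(** The sums start at [1], like those in [is_laplace_pow]: the constant mode is left out. *)
Definition psum (c : nat -> R) n (p : T) := \sum_(1 <= j < n) c j * phi j p.
Definition sqsum (c : nat -> R) n := \sum_(1 <= j < n) c j ^+ 2.

Lemma measurable_psum c n : measurable_fun setT (psum c n).
Proof. by apply: measurable_sum => j; exact: measurable_funM. Qed.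

Lemma sqsum_mono c n p : (n <= p)%N -> sqsum c n <= sqsum c p.
Proof.
move=> np; have [n0|n0] := leqP 1 n; last first.
  by rewrite /sqsum (big_geq (ltnW n0)) sumr_ge0 // => j _; exact: sqr_ge0.
rewrite /sqsum (big_cat_nat n0 np) /= lerDl sumr_ge0 // => j _; exact: sqr_ge0.
Qed.

Lemma sqint_psum c n : sqint mu (psum c n) = (sqsum c n)%:E.
Proof. exact: (int_sum_phi_sqr mphi orth c (iota_uniq _ _)). Qed.

Lemma sqint_psumB c n p : (1 <= n)%N -> (n <= p)%N ->
  sqint mu (psum c p \- psum c n) = (sqsum c p - sqsum c n)%:E.
Proof.
move=> n0 np; rewrite /sqsum (big_cat_nat n0 np) /= [X in X - _]addrC addrK.
rewrite -(int_sum_phi_sqr mphi orth c (iota_uniq _ _)).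
apply: eq_sqint => x /=; by rewrite /psum (big_cat_nat n0 np) /= [X in X - _]addrC addrK.
Qed.

Variables (c : nat -> R) (B : R).
Hypothesis cB : forall n, sqsum c n <= B.

Definition sqlim := limn (sqsum c).

Lemma sqsum_cvg : sqsum c @ \oo --> sqlim.
Proof.
apply: nondecreasing_is_cvgn; first by move=> n p; exact: sqsum_mono.
by exists B => _ [n _ <-].
Qed.

Lemma sqsum_le n : sqsum c n <= sqlim.
Proof.
apply: nondecreasing_cvgn_le; last exact: sqsum_cvg.
by move=> k p; exact: sqsum_mono.
Qed.

(* Along partial sums with [\int g_k^2 <= 2 * 4^-k], [g_k] the consecutive
   differences, [\sum_k 2^k g_k^2] is integrable, which gives almost everywhere
   convergence without assuming the measure finite. *)
Lemma riesz_fischer : exists y : T -> R, measurable_fun setT y /\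
  forall n, (1 <= n)%N -> (sqint mu (y \- psum c n)%R <= (sqlim - sqsum c n)%:E)%E.
Proof.
(* The rate [4^-1 ^+ k] beats the factor [2 ^+ k] in [F], and [k < N k] makes the chosen indices
   tend to infinity. They may fail to increase, so both orders of [N k] and [N k.+1] are treated in
   [gk]. *)
have /boolp.choice [N HN] : forall k, exists n, (k < n)%N /\ sqlim - sqsum c n <= 4^-1 ^+ k.
  move=> k; have e0 : 0 < (4^-1 : R) ^+ k by rewrite exprn_gt0.
  have /cvgrPdist_le /(_ _ e0) [n0 _ h] := sqsum_cvg.
  exists (maxn k.+1 n0); split; first exact: leq_maxl.
  by apply: le_trans (h _ (leq_maxr _ _)); exact: ler_norm.
pose g k := psum c (N k.+1) \- psum c (N k).
have N1 k : (1 <= N k)%N by apply: leq_trans (HN k).1.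
have gk k : (sqint mu (g k) <= (2 * 4^-1 ^+ k)%:E)%E.
  have e : 4^-1 ^+ k.+1 <= 4^-1 ^+ k :> R by rewrite exprS ler_piMl ?exprn_ge0 //; lra.
  have [le|/ltnW le] := leqP (N k) (N k.+1).
    rewrite sqint_psumB // lee_fin; have := (HN k).2; have := sqsum_le (N k.+1).
    have : 0 <= 4^-1 ^+ k :> R by rewrite exprn_ge0.
    by lra.
  rewrite sqint_subC sqint_psumB // lee_fin; have := (HN k.+1).2; have := sqsum_le (N k).
  have : 0 <= 4^-1 ^+ k :> R by rewrite exprn_ge0.
  by lra.
pose F k p := (2 ^+ k * g k p ^+ 2)%:E : \bar R.
have half0 k : 0 <= (2^-1 : R) ^+ k by rewrite exprn_ge0.
have sum_half n : \sum_(0 <= k < n) 2^-1 ^+ k <= 2 :> R.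
  suff -> : \sum_(0 <= k < n) 2^-1 ^+ k = 2 - 2 * 2^-1 ^+ n :> R.
    by rewrite gerBl mulr_ge0.
  elim: n => [|n IH]; first by rewrite big_geq // expr0 mulr1 subrr.
  by rewrite big_nat_recr //= IH exprS; lra.
have mg k : measurable_fun setT (g k).
  by apply: measurable_funB; exact: measurable_psum.
have mF k : measurable_fun setT (F k).
  by apply/measurable_EFinP; apply: measurable_funM => //; exact: measurable_funX.
have F0 k p : (0 <= F k p)%E by rewrite lee_fin mulr_ge0 ?sqr_ge0 ?exprn_ge0.
have IF k : (\int[mu]_p F k p <= (2 * 2^-1 ^+ k)%:E)%E.
  under eq_integral do rewrite /F EFinM.
  rewrite ge0_integralZl //=; last 2 first.
  - exact: measurable_sqrE.
  - by move=> p _; rewrite lee_fin sqr_ge0.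
  apply: le_trans (lee_wpmul2l _ (gk k)) _; first by rewrite lee_fin exprn_ge0.
  rewrite -EFinM lee_fin mulrCA -exprMn.
  by have -> : 2 * 4^-1 = 2^-1 :> R by lra.
have SF : (\int[mu]_p (\sum_(k <oo) F k p) <= 4%:E)%E.
  rewrite integral_nneseries //; apply: lime_le.
    by apply: is_cvg_nneseries => k _ _; exact: integral_ge0.
  apply: nearW => n; apply: (@le_trans _ _ (\sum_(0 <= k < n) (2 * 2^-1 ^+ k)%:E)%E).
    by apply: lee_sum => k _; exact: IF.
  rewrite sumEFin lee_fin -mulr_sumr; have := sum_half n; lra.
have msum : measurable_fun setT (fun p => \sum_(k <oo) F k p)%E.
  exact: ge0_emeasurable_sum.
have sum0 p : (0 <= \sum_(k <oo) F k p)%E by apply: nneseries_ge0.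
have iF : mu.-integrable setT (fun p => \sum_(k <oo) F k p)%E.
  apply/integrableP; split => //.
  rewrite (eq_integral (fun p => \sum_(k <oo) F k p)%E) => [|p _]; last by rewrite gee0_abs.
  by apply: le_lt_trans SF _; exact: ltry.
(* The upper limit is measurable as it stands; it agrees with the limit wherever the sequence
   converges, which is almost everywhere. *)
pose y p := fine (limn_esup (fun k => (psum c (N k) p)%:E)).
have my : measurable_fun setT y.
  apply: measurableT_comp; first exact: fine_measurable.
  by apply: measurable_fun_limn_esup => k; apply/measurable_EFinP; exact: measurable_psum.
have ylim : {ae mu, forall p, psum c (N k) p @[k --> \oo] --> y p}.
  apply: filterS (integrable_ae measurableT iF) => p /(_ I) pfin.
  have : cvgn (fun k => psum c (N k) p).
    apply: (@cvg_abs_series_bounded _ _ (2 + fine (\sum_(k <oo) F k p)%E)) => n.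
    apply: (@le_trans _ _ (\sum_(0 <= k < n) (2^-1 ^+ k + 2 ^+ k * g k p ^+ 2))).
      apply: ler_sum => k _; rewrite -/(g k p); set t := g k p.
      have a0 : 0 < (2 : R) ^+ k by rewrite exprn_gt0.
      have ai0 : 0 <= 2^-1 ^+ k :> R by [].
      (* The arithmetic-geometric inequality bounds [|t|] by the geometric term plus the weighted
         square, which is summable almost everywhere. *)
      have : 0 <= (2 ^+ k)^-1 * (2 ^+ k * `|t| - 1) ^+ 2 by rewrite mulr_ge0 ?sqr_ge0 // invr_ge0 ltW.
      have -> : (2 ^+ k)^-1 * (2 ^+ k * `|t| - 1) ^+ 2 = 2 ^+ k * `|t| ^+ 2 - 2 * `|t| + (2 ^+ k)^-1.
        by field; rewrite gt_eqF.
      rewrite exprVn real_normK ?num_real //; have := normr_ge0 t; set a := _ ^-1; nra.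
    rewrite big_split /=; apply: lerD => //.
    rewrite -lee_fin fineK // -sumEFin.
    by apply: (@nneseries_lim_ge R (F^~ p) predT 0%N n) => k _ _; exact: F0.
  move=> /cvg_ex [l hl].
  have /cvg_limn_einf_sup[_] : (fun k => (psum c (N k) p)%:E) @ \oo --> l%:E.
    by apply: cvg_EFin; [exact: nearW|exact: hl].
  by rewrite /y => -> /=.
exists y; split => // n n1.
(* Fatou along the subsequence with [n] fixed gives the error bound for every partial sum. *)
apply: (@sqint_fatou _ _ _ mu (fun k => psum c (N k) \- psum c n) _ _ n).
- by move=> k; apply: measurable_funB; exact: measurable_psum.
- by apply: measurable_funB => //; exact: measurable_psum.
- by apply: filterS ylim => p yp; apply: cvgB => //; exact: cvg_cst.
move=> k nk; have nN : (n <= N k)%N by apply: leq_trans nk (ltnW (HN k).1).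
by rewrite sqint_psumB // lee_fin lerB // sqsum_le.
Qed.
End riesz_fischer.

(** * Expansions in L2: Parseval and uniqueness *)

Section approximation.
Variables (dd : measure_display) (T : measurableType dd) (R : realType).
Variables (mu : {measure set T -> \bar R}) (phi : nat -> T -> R).
Hypothesis mphi : forall j, measurable_fun setT (phi j).
Hypothesis orth : forall i j, \int[mu]_p (phi i p * phi j p) = (i == j)%:R.
Notation psum := (psum phi).
Implicit Types (y : T -> R) (c : nat -> R).

(** The errors are extended reals dominated by a real null sequence; [fine] of them would read an
    infinite error as [0]. *)
Definition l2_expansion y c := measurable_fun setT y /\
  exists2 e : nat -> R, e @ \oo --> (0 : R) &
    forall n, (1 <= n)%N -> (sqint mu (y \- psum c n)%R <= (e n)%:E)%E.

Lemma cvg0_le (e : nat -> R) (x a b : R) : e @ \oo --> (0 : R) ->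
  (\forall n \near \oo, x <= a + b * e n) -> x <= a.
Proof.
move=> e0 xe; have : a + b * e n @[n --> \oo] --> a.
  by rewrite -[X in _ --> X]addr0 -(mulr0 b); apply: cvgD; [exact: cvg_cst|apply: cvgM; [exact: cvg_cst|]].
move=> h; have <- := cvg_lim (@Rhausdorff R) h.
by apply: limr_ge => //; apply/cvg_ex; exists a.
Qed.

(** Removes the factor [1 + e] that [sqintD_le] leaves. *)
Lemma ler_onep_scale (x a : R) : (forall e, 0 < e -> x <= (1 + e) * a) -> x <= a.
Proof.
move=> h; have e0 : (fun n => n.+1%:R^-1 : R) @ \oo --> (0 : R) by exact: cvg_harmonic.
apply: (@cvg0_le _ _ _ a e0); apply: nearW => n.
have := h n.+1%:R^-1; rewrite invr_gt0 ltr0n => /(_ isT).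
by rewrite mulrDl mul1r mulrC.
Qed.

Lemma l2_expansion_bounded y c (B : R) : measurable_fun setT y ->
  (forall n, sqsum c n <= B) ->
  (forall n, (1 <= n)%N -> (sqint mu (y \- psum c n)%R <= (sqlim c - sqsum c n)%:E)%E) ->
  l2_expansion y c.
Proof.
move=> my cB h; split => //; exists (fun n => sqlim c - sqsum c n) => //.
by rewrite -(subrr (sqlim c)); apply: cvgB; [exact: cvg_cst|exact: (sqsum_cvg cB)].
Qed.

Lemma l2_expansion_exists c (B : R) : (forall n, sqsum c n <= B) -> exists y, l2_expansion y c.
Proof.
move=> cB; have [y [my h]] := riesz_fischer mphi orth cB.
by exists y; exact: l2_expansion_bounded h.
Qed.

(** Fatou applied to the tails of the partial sums. It identifies a pointwise limit, in particular a
    continuous one, with the L2 limit. *)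
Lemma l2_expansion_pointwise y c (B : R) : (forall n, sqsum c n <= B) ->
  measurable_fun setT y -> (forall p, psum c n p @[n --> \oo] --> y p) -> l2_expansion y c.
Proof.
move=> cB my yp; apply: (l2_expansion_bounded my cB) => n n1.
apply: (@sqint_fatou _ _ _ mu (fun k => psum c k \- psum c n) _ _ n).
- by move=> k; apply: measurable_funB; exact: measurable_psum.
- by apply: measurable_funB => //; exact: measurable_psum.
- by apply: aeW => p; apply: cvgB => //; exact: cvg_cst.
by move=> k nk; rewrite (sqint_psumB mphi orth) // lee_fin lerB // (sqsum_le cB).
Qed.

(** Parseval. [sqintD_le] compares [y] with its partial sums in both directions; for fixed [a] the
    index goes to infinity, and only then does [a] go to [0]. *)
Lemma l2_expansion_norm y c : l2_expansion y c ->
  exists2 l : R, sqint mu y = l%:E & sqsum c @ \oo --> l.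
Proof.
move=> [my [e e0 ye]].
have mS n : measurable_fun setT (psum c n) by exact: measurable_psum.
have mB n : measurable_fun setT (y \- psum c n) by exact: measurable_funB.
have up n (a : R) : (1 <= n)%N -> 0 < a ->
    (sqint mu y <= ((1 + a) * sqsum c n + (1 + a^-1) * e n)%:E)%E.
  move=> n1 a0; rewrite (@eq_sqint _ _ _ _ y (psum c n \+ (y \- psum c n))); last by move=> p /=; rewrite addrC subrK.
  apply: (le_trans (sqintD_le _ (mS n) (mB n) a0)); rewrite [leRHS]EFinD !EFinM.
  rewrite (sqint_psum mphi orth) leeD2l // lee_wpmul2l ?ye // lee_fin addr_ge0 // invr_ge0 ltW //.
have yfin : (sqint mu y < +oo)%E by apply: le_lt_trans (up 1%N 1 isT ltr01) _; exact: ltry.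
have [Q Q0 qy] : exists2 Q, 0 <= Q & sqint mu y = Q%:E.
  have := sqint_ge0 mu y; move: yfin; case: (sqint mu y) => [Q||] // _; rewrite ?lee_fin => Q0.
  by exists Q.
have lo n (a : R) : (1 <= n)%N -> 0 < a -> sqsum c n <= (1 + a) * Q + (1 + a^-1) * e n.
  move=> n1 a0; rewrite -lee_fin -(sqint_psum mphi orth c n).
  rewrite (@eq_sqint _ _ _ _ (psum c n) (y \+ (psum c n \- y))); last by move=> p /=; rewrite addrC subrK.
  apply: (le_trans (sqintD_le _ my _ a0)); first exact: measurable_funB.
  rewrite [leRHS]EFinD !EFinM qy leeD2l // sqint_subC lee_wpmul2l ?ye // lee_fin addr_ge0 // invr_ge0 ltW //.
have cQ n : sqsum c n <= Q.
  apply: ler_onep_scale => a a0; apply: (@cvg0_le _ _ _ (1 + a^-1) e0).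
  exists (maxn 1 n) => // p /= np; apply: le_trans (lo p a _ a0); last first.
    by apply: leq_trans np; exact: leq_maxl.
  by apply: sqsum_mono; apply: leq_trans np; exact: leq_maxr.
exists Q => //; have h := sqsum_cvg cQ; suff -> : Q = sqlim c by [].
apply/eqP; rewrite eq_le; apply/andP; split; last first.
  by apply: limr_le; [apply/cvg_ex; exists (sqlim c)|apply: nearW].
apply: ler_onep_scale => a a0; apply: (@cvg0_le _ _ _ (1 + a^-1) e0).
exists 1%N => // p /= p1; have := up p a p1 a0; rewrite qy lee_fin => /le_trans; apply.
by rewrite lerD2r ler_wpM2l ?(sqsum_le cQ) // addr_ge0 // ltW.
Qed.

Lemma l2_expansion_unique y y' c : l2_expansion y c -> l2_expansion y' c ->
  {ae mu, forall p, y p = y' p}.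
Proof.
move=> [my [e e0 ye]] [my' [e' e'0 ye']].
have mS n : measurable_fun setT (psum c n) by exact: measurable_psum.
have mB : measurable_fun setT (y \- y') by exact: measurable_funB.
have le n : (1 <= n)%N -> (sqint mu (y \- y')%R <= (2 * (e n + e' n))%:E)%E.
  move=> n1; rewrite (@eq_sqint _ _ _ _ (y \- y') ((y \- psum c n) \+ (psum c n \- y'))); last first.
    by move=> p /=; rewrite addrA subrK.
  apply: (le_trans (sqintD_le _ _ _ ltr01)); try exact: measurable_funB.
  rewrite invr1 mulrDr [leRHS]EFinD !EFinM (sqint_subC _ (psum c n)).
  by apply: leeD; rewrite lee_wpmul2l ?ye ?ye' // lee_fin.
have : (sqint mu (y \- y')%R <= 0)%E.
  have := sqint_ge0 mu (y \- y'); move: le; case: (sqint mu _) => [q||] // le _; last first.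
    by have := le 1%N isT; rewrite leye_eq.
  rewrite lee_fin; apply: (@cvg0_le (fun n => e n + e' n) _ _ 2).
    by rewrite -(addr0 0); exact: cvgD.
  by exists 1%N => // n /= n1; rewrite add0r -lee_fin; exact: le.
rewrite le_eqVlt ltNge sqint_ge0 orbF => /eqP /(sqint_eq0 mB).
by apply: filterS => p /= /eqP; rewrite subr_eq0 => /eqP.
Qed.

End approximation.

Lemma sqintB_lty (dd : measure_display) (T : measurableType dd) (R : realType)
    (mu : {measure set T -> \bar R}) (f g : T -> R) :
  measurable_fun setT f -> measurable_fun setT g ->
  (sqint mu f < +oo)%E -> (sqint mu g < +oo)%E -> (sqint mu (f \- g)%R < +oo)%E.
Proof.
move=> mf mg qf qg; apply: le_lt_trans (sqintD_le _ mf _ ltr01) _.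
  exact: measurableT_comp.
have -> : sqint mu (fun p => - g p) = sqint mu g by apply: eq_integral => p _; rewrite sqrrN.
by rewrite lte_add_pinfty // lte_mul_pinfty // ?lee_fin ?addr_ge0 ?invr_ge0.
Qed.

(** * Complex-valued functions and powers of the Laplacian *)

Section complex_valued.
Variables (R : realType) (d : nat) (M : compactRiemannianManifold R d).
Variable vol : {measure set (borel M) -> \bar R}.
Implicit Types x y : M -> R[i].

Definition re x : borel M -> R := fun p => complex.Re (x p).
Definition im x : borel M -> R := fun p => complex.Im (x p).

Lemma Re_sum (I : Type) (s : seq I) (F : I -> R[i]) :
  complex.Re (\sum_(i <- s) F i) = \sum_(i <- s) complex.Re (F i).
Proof. by apply: (big_morph (@complex.Re R)) => // -[? ?] [? ?]. Qed.

Lemma Im_sum (I : Type) (s : seq I) (F : I -> R[i]) :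
  complex.Im (\sum_(i <- s) F i) = \sum_(i <- s) complex.Im (F i).
Proof. by apply: (big_morph (@complex.Im R)) => // -[? ?] [? ?]. Qed.

Lemma Re_mulC (z : R[i]) (a : R) : complex.Re (z * a%:C%C) = complex.Re z * a.
Proof. by case: z => u v /=; rewrite mulr0 subr0. Qed.

Lemma Im_mulC (z : R[i]) (a : R) : complex.Im (z * a%:C%C) = complex.Im z * a.
Proof. by case: z => u v /=; rewrite mulr0 add0r. Qed.

Lemma Re_sub (z w : R[i]) : complex.Re (z - w) = complex.Re z - complex.Re w.
Proof. by case: z w => ? ? [? ?]. Qed.

Lemma Im_sub (z w : R[i]) : complex.Im (z - w) = complex.Im z - complex.Im w.
Proof. by case: z w => ? ? [? ?]. Qed.

Lemma cabs_sqr (z : R[i]) : cabs z ^+ 2 = complex.Re z ^+ 2 + complex.Im z ^+ 2.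
Proof. by case: z => u v; rewrite /cabs /= sqr_sqrtr // addr_ge0 // sqr_ge0. Qed.

Lemma cabs_ge0 (z : R[i]) : 0 <= cabs z.
Proof. by case: z => u v; rewrite /cabs /= sqrtr_ge0. Qed.

Lemma L2norm_ge0 x : 0 <= L2norm vol x.
Proof. by rewrite fine_ge0 // Lnorm_ge0. Qed.

Lemma L2norm_sqr x : measurable_fun setT (re x) -> measurable_fun setT (im x) ->
  L2norm vol x ^+ 2 = fine (sqint vol (re x) + sqint vol (im x))%E.
Proof.
move=> mr mi; rewrite /L2norm unlock /Lnorm.
have -> : (\int[vol]_p (`|(cabs (x p))%:E| `^ 2))%E = (sqint vol (re x) + sqint vol (im x))%E.
  rewrite -ge0_integralD //=.
  - apply: eq_integral => p _; rewrite -EFinD -cabs_sqr ger0_norm ?cabs_ge0 //.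
    by rewrite powR_mulrn // cabs_ge0.
  - by move=> p _; rewrite lee_fin sqr_ge0.
  - exact: measurable_sqrE.
  - by move=> p _; rewrite lee_fin sqr_ge0.
  - exact: measurable_sqrE.
have := adde_ge0 (sqint_ge0 vol (re x)) (sqint_ge0 vol (im x)).
(* When the integral is infinite both sides take the default value [0]. *)
case: (_ + _)%E => [q||] //; last by rewrite poweRyr ?invr_eq0 //= expr0n.
by rewrite lee_fin => q0; rewrite poweR_EFin /= powR12_sqrt // sqr_sqrtr.
Qed.

Lemma L2P x : L2 vol x <->
  [/\ measurable_fun setT (re x), measurable_fun setT (im x),
      (sqint vol (re x) < +oo)%E & (sqint vol (im x) < +oo)%E].
Proof.
rewrite /L2; split => [[/Lfun2P[? ?] /Lfun2P[? ?]]|[? ? ? ?]]; first by split.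
by split; apply/Lfun2P; split.
Qed.

Variables (mu : nat -> R) (phi : nat -> M -> R).
Hypothesis mphi : forall j, measurable_fun [set: borel M] (phi j : borel M -> R).
Hypothesis orth : forall i j, \int[vol]_p (phi i p * phi j p) = (i == j)%:R.

Definition cre s x j := complex.Re (coef vol phi j x) * mu j `^ (2 * s).
Definition cim s x j := complex.Im (coef vol phi j x) * mu j `^ (2 * s).

Let partial_sum s x n p := \sum_(1 <= j < n) coef vol phi j x * (mu j `^ (2 * s) * phi j p)%:C%C.

Lemma re_partial_sum s x y n p :
  re (fun p => y p - partial_sum s x n p) p = (re y \- psum (T := borel M) phi (cre s x) n) p.
Proof.
rewrite /re Re_sub Re_sum /psum; congr (_ - _); apply: eq_bigr => j _.
by rewrite Re_mulC /cre mulrA.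
Qed.

Lemma im_partial_sum s x y n p :
  im (fun p => y p - partial_sum s x n p) p = (im y \- psum (T := borel M) phi (cim s x) n) p.
Proof.
rewrite /im Im_sub Im_sum /psum; congr (_ - _); apply: eq_bigr => j _.
by rewrite Im_mulC /cim mulrA.
Qed.

(** From left to right, membership of [y] in L2 makes the errors finite, and only then does
    convergence of [L2norm], a [fine], say anything about the integrals. From right to left the two
    error sequences are combined under a square root. *)
Lemma is_laplace_powP s x y : is_laplace_pow vol mu phi s x y <->
  l2_expansion vol phi (re y) (cre s x) /\ l2_expansion vol phi (im y) (cim s x).
Proof.
have mS c n := measurable_psum mphi c n.
pose r n := fun p => y p - partial_sum s x n p.
have rr n : re (r n) = re y \- psum (T := borel M) phi (cre s x) n.
  by apply/funext => p; exact: re_partial_sum.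
have ri n : im (r n) = im y \- psum (T := borel M) phi (cim s x) n.
  by apply/funext => p; exact: im_partial_sum.
have nr n : measurable_fun setT (re y) -> measurable_fun setT (im y) ->
    L2norm vol (r n) ^+ 2 = fine (sqint vol (re y \- psum (T := borel M) phi (cre s x) n)%R +
                                  sqint vol (im y \- psum (T := borel M) phi (cim s x) n)%R)%E.
  by move=> mr mi; rewrite L2norm_sqr ?rr ?ri //; exact: measurable_funB.
split.
  move=> [/L2P[mr mi qr qi] h].
  have h2 : L2norm vol (r n) ^+ 2 @[n --> \oo] --> (0 : R).
    rewrite -(mulr0 0); apply: cvg_trans (cvgM h h).
    by apply: near_eq_cvg; apply: nearW => n /=; rewrite expr2.
  have fin n : ((sqint vol (re y \- psum (T := borel M) phi (cre s x) n)%R +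
                 sqint vol (im y \- psum (T := borel M) phi (cim s x) n)%R) =
                (L2norm vol (r n) ^+ 2)%:E)%E.
    rewrite nr // fineK // ge0_fin_numE; last exact: adde_ge0 (sqint_ge0 _ _) (sqint_ge0 _ _).
    by rewrite lte_add_pinfty // sqintB_lty // (sqint_psum mphi orth) ltry.
  split; (split => //; exists (fun n => L2norm vol (r n) ^+ 2) => // n _).
    by rewrite -fin leeDl // sqint_ge0.
  by rewrite -fin leeDr // sqint_ge0.
move=> [hr hi].
have [l1 q1 _] := l2_expansion_norm mphi orth hr.
have [l2 sqint' _] := l2_expansion_norm mphi orth hi.
case: (hr) => mr [e1 e10 h1]; case: (hi) => mi [e2 e20 h2]; split.
  by apply/L2P; split => //; rewrite ?q1 ?sqint' ltry.
have lim : Num.sqrt (e1 n + e2 n) @[n --> \oo] --> (0 : R).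
  have e12 : e1 n + e2 n @[n --> \oo] --> (0 : R) by rewrite -(addr0 0); exact: cvgD.
  by have := cvg_comp _ _ e12 (@sqrt_continuous R 0); rewrite sqrtr0.
apply: (squeeze_cvgr _ (cvg_cst 0) lim).
exists 1%N => // n /= n1; rewrite L2norm_ge0 /=.
rewrite -[leLHS](ger0_norm (L2norm_ge0 _)) -sqrtr_sqr ler_wsqrtr // nr //.
have := h1 n n1; have := h2 n n1.
have := sqint_ge0 vol (re y \- psum (T := borel M) phi (cre s x) n).
have := sqint_ge0 vol (im y \- psum (T := borel M) phi (cim s x) n).
case: (sqint vol _) => [a||] //; case: (sqint vol _) => [b||] // _ _.
by rewrite !lee_fin /= => *; exact: lerD.
Qed.

Lemma laplace_powP s x B : (forall n, sqsum (cre s x) n <= B) ->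
  (forall n, sqsum (cim s x) n <= B) ->
  is_laplace_pow vol mu phi s x (laplace_pow vol mu phi s x).
Proof.
move=> rB iB; have [u hu] := l2_expansion_exists mphi orth rB.
have [v hv] := l2_expansion_exists mphi orth iB.
rewrite /laplace_pow; apply: (@xgetPex _ (fun=> 0) [set y | is_laplace_pow vol mu phi s x y]).
exists (fun p => Complex (u p) (v p)); apply: (is_laplace_powP s x _).2.
by split; [exact: hu|exact: hv].
Qed.

Lemma L2norm_laplace_pow s x y : is_laplace_pow vol mu phi s x y ->
  sqsum (cre s x) n + sqsum (cim s x) n @[n --> \oo] --> L2norm vol y ^+ 2.
Proof.
move=> /is_laplace_powP[hr hi].
have [l1 q1 c1] := l2_expansion_norm mphi orth hr.
have [l2 sqint' c2] := l2_expansion_norm mphi orth hi.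
by rewrite (L2norm_sqr hr.1 hi.1) q1 sqint' /=; exact: cvgD.
Qed.

Lemma is_laplace_pow_unique s x y y' : is_laplace_pow vol mu phi s x y ->
  is_laplace_pow vol mu phi s x y' -> {ae vol, forall p, y p = y' p}.
Proof.
move=> /is_laplace_powP[hr hi] /is_laplace_powP[hr' hi'].
have := l2_expansion_unique mphi hr hr'.
have := l2_expansion_unique mphi hi hi'.
apply: filterS2 => p; rewrite /re /im.
by case: (y p) (y' p) => [? ?] [? ?] /= -> ->.
Qed.

End complex_valued.

(** * The sharp inequality *)

Section inequalities.
Variable R : realType.

(** Normalise by [A] and multiply the bounds [t l / A <= expR (t l / A - 1)], raised to the [lam l]:
    the exponents sum to [0]. If [A = 0] every [t l] vanishes, and there is an index because the
    weights sum to [1]. *)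
Lemma weighted_am_gm (m : nat) (lam t : 'I_m -> R) : (forall l, 0 < lam l) ->
  \sum_l lam l = 1 -> (forall l, 0 <= t l) ->
  \prod_l t l `^ lam l <= \sum_l lam l * t l.
Proof.
move=> lam0 lam1 t0; set A := \sum_l _.
have A0 : 0 <= A by apply: sumr_ge0 => l _; rewrite mulr_ge0 // ltW.
have [A1|A1] := ltrP 0 A; last first.
  have {A1 A0} /eqP A0 : A == 0 by rewrite eq_le A1.
  have [l|/= ml] := pickP (fun _ : 'I_m => true).
    have /psumr_eq0P/(_ l isT)/eqP : A = 0 by [].
    move=> h; rewrite (bigD1 l) //=.
    have tl0 : t l = 0.
      have := h (fun i _ => mulr_ge0 (ltW (lam0 i)) (t0 i)).
      by rewrite mulf_eq0 gt_eqF //= => /eqP.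
    by rewrite tl0 powR0 ?gt_eqF // mul0r A0.
  by move: lam1; rewrite big1 => [/esym/eqP|i _]; [rewrite oner_eq0|have := ml i].
have -> : A = \prod_l (A `^ lam l * expR ((t l / A - 1) * lam l)).
  rewrite big_split /= -powR_sum // lam1 powRr1 ?(ltW A1) // -expR_sum.
  under eq_bigr do rewrite mulrBl mul1r mulrAC.
  rewrite sumrB lam1 -mulr_suml.
  under eq_bigr do rewrite mulrC.
  by rewrite -/A divff ?gt_eqF // subrr expR0 mulr1.
apply: ler_prod => l _; rewrite powR_ge0 /= expRM -powRM ?expR_ge0 ?(ltW A1) //.
apply: powR_mono; rewrite ?(ltW (lam0 _)) //.
by rewrite -ler_pdivrMl // mulrC; have := expR_ge1Dx (t l / A - 1); lra.
Qed.

(** Cauchy-Schwarz with [p] dominated termwise by a product, so that weights can be distributed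
    without square roots. In the induction the cross term is bounded by the arithmetic-geometric
    inequality. *)
Lemma sqr_sum_le (J : seq nat) (p s t : nat -> R) : (forall j, 0 <= s j) ->
  (forall j, 0 <= t j) -> (forall j, j \in J -> p j ^+ 2 <= s j * t j) ->
  (\sum_(j <- J) p j) ^+ 2 <= (\sum_(j <- J) s j) * (\sum_(j <- J) t j).
Proof.
move=> s0 t0; elim: J => [|i J IH] pst; first by rewrite !big_nil expr0n mulr0.
have {pst IH} [pi IH] := (pst i (mem_head i J), IH (fun j jJ => pst j (mem_behead (s := i :: J) jJ))).
rewrite !big_cons; move: IH.
set P := \sum_(j <- J) p j; set A := \sum_(j <- J) s j; set B := \sum_(j <- J) t j => IH.
have A0 : 0 <= A by apply: sumr_ge0.
have B0 : 0 <= B by apply: sumr_ge0.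
have : 2 * (P * p i) <= A * t i + B * s i.
  have [//|lt] := lerP (2 * (P * p i)) (A * t i + B * s i).
  have h0 : 0 <= A * t i + B * s i by rewrite addr_ge0 ?mulr_ge0.
  have h1 : (A * t i + B * s i) ^+ 2 < (2 * (P * p i)) ^+ 2 by rewrite ltrXn2r // nnegrE (le_trans h0) ?ltW.
  have h2 : P ^+ 2 * p i ^+ 2 <= (A * B) * (s i * t i) by rewrite ler_pM ?sqr_ge0.
  have h3 := sqr_ge0 (A * t i - B * s i).
  have h4 : (A * t i + B * s i) ^+ 2 = (A * t i - B * s i) ^+ 2 + 4 * ((A * B) * (s i * t i)) by ring.
  have h5 : (2 * (P * p i)) ^+ 2 = 4 * (P ^+ 2 * p i ^+ 2) by ring.
  by rewrite h4 h5 in h1; lra.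
move=> hi.
have -> : (p i + P) ^+ 2 = p i ^+ 2 + 2 * (P * p i) + P ^+ 2 by ring.
have -> : (s i + A) * (t i + B) = s i * t i + (A * t i + B * s i) + A * B by ring.
by apply: lerD => //; apply: lerD.
Qed.

End inequalities.

Lemma uniform_cauchy_limit (R : realType) (T : topologicalType) (u : nat -> T -> R)
    (e : nat -> R) : (forall n, continuous (u n)) -> e @ \oo --> (0 : R) ->
  (forall n p x, (1 <= n)%N -> (n <= p)%N -> `|u p x - u n x| <= e n) ->
  exists2 y : T -> R, continuous y & forall x, u n x @[n --> \oo] --> y x.
Proof.
move=> uc e0 ue.
have cv x : cvgn (u^~ x).
  apply/cauchy_cvgP/cauchy_exP => eps eps0.
  have /cvgrPdist_lt /(_ _ eps0) [n1 _ h1] := e0.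
  pose N := maxn 1 n1; have N1 : (1 <= N)%N by exact: leq_maxl.
  exists (u N x); exists N => // p /= Np; rewrite /ball /= distrC.
  apply: le_lt_trans (ue N p x N1 Np) _.
  have := h1 N (leq_maxr _ _); rewrite sub0r normrN; exact: le_lt_trans (ler_norm _).
pose y x := limn (u^~ x).
have yl x : u n x @[n --> \oo] --> y x by exact: cv.
exists y => // x.
have ye n z : (1 <= n)%N -> `|y z - u n z| <= e n.
  move=> n1.
  have lim : `|u p z - u n z| @[p --> \oo] --> `|y z - u n z|.
    by apply: cvg_norm; apply: cvgB => //; exact: cvg_cst.
  rewrite -(cvg_lim (@Rhausdorff R) lim); apply: limr_le.
    by apply/cvg_ex; eexists; exact: lim.
  by exists n => // p /= np; exact: ue.
apply/cvgrPdist_lt => eps eps0.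
have e3 : 0 < eps / 3 by rewrite divr_gt0.
have /cvgrPdist_lt /(_ _ e3) [n1 _ h1] := e0.
pose N := maxn 1 n1; have N1 : (1 <= N)%N by exact: leq_maxl.
have eN : e N < eps / 3.
  have := h1 N (leq_maxr _ _); rewrite sub0r normrN; exact: le_lt_trans (ler_norm _).
have /cvgrPdist_lt /(_ _ e3) := uc N x; apply: filterS => z uz.
have := ye N x N1; have := ye N z N1 => hz hx.
have -> : y x - y z = (y x - u N x) + ((u N x - u N z) - (y z - u N z)) by ring.
apply: le_lt_trans (ler_normD _ _) _; have := ler_normB (u N x - u N z) (y z - u N z); lra.
Qed.

Lemma Rintegral_psum (dd : measure_display) (T : measurableType dd) (R : realType)
    (mu : {measure set T -> \bar R}) (phi : nat -> T -> R)
    (mphi : forall j, measurable_fun setT (phi j))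
    (orth : forall i j, \int[mu]_p (phi i p * phi j p) = (i == j)%:R) c n i :
  \int[mu]_p (psum phi c n p * phi i p) = if (1 <= i < n)%N then c i else 0.
Proof.
have ip := integrable_phi mphi orth.
have intE j : (\int[mu]_x (phi j x * phi i x)%:E)%E = ((j == i)%:R)%:E.
  by rewrite -orth /Rintegral fineK //; exact: integrable_fin_num (ip j i).
rewrite /Rintegral.
have -> : (fun p => (psum phi c n p * phi i p)%:E) =
   (fun p => \sum_(j <- index_iota 1 n) (c j)%:E * (phi j p * phi i p)%:E)%E.
  apply/funext => p; rewrite /psum mulr_suml -sumEFin; apply: eq_bigr => j _.
  by rewrite -EFinM mulrA.
rewrite integral_sum //=; last by move=> j; apply: integrableZl => //; exact: ip.
rewrite (eq_bigr (fun j => (c j * (j == i)%:R)%:E)); last first.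
  by move=> j _; rewrite integralZl ?intE ?EFinM //; exact: ip.
rewrite sumEFin /= -mem_index_iota; case: ifPn => hi.
  rewrite (bigD1_seq i) ?iota_uniq //= eqxx mulr1 big1 ?addr0 // => j /negbTE ->.
  by rewrite mulr0.
rewrite big1_seq // => j /= jn; have [ji|] := eqVneq j i; last by rewrite mulr0.
by rewrite -ji jn in hi.
Qed.

(** * From the constant to the inequality and back *)

Section sharp_inequality.
Variables (R : realType) (d : nat) (M : compactRiemannianManifold R d).
Variable vol : {measure set (borel M) -> \bar R}.
Variables (mu : nat -> R) (phi : nat -> M -> R).
Hypothesis mphi : forall j, measurable_fun [set: borel M] (phi j : borel M -> R).
Hypothesis cphi : forall j, continuous (phi j).
Hypothesis orth : forall i j, \int[vol]_p (phi i p * phi j p) = (i == j)%:R.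
Hypothesis mu_ge1 : forall j, (1 <= j)%N -> mu 1%N <= mu j.
Hypothesis mu1 : 0 < mu 1%N.
Variables (m : nat) (r lam : 'I_m.+1 -> R) (k : R).
Hypotheses (hr : forall l, r l <= r ord_max) (kr : k <= r ord_max).
Hypotheses (hlam : forall j, 0 < lam j) (hlam1 : \sum_(j < m.+1) lam j = 1).

Let mu_gt0 j : (1 <= j)%N -> 0 < mu j.
Proof. by move=> /mu_ge1; exact: lt_le_trans. Qed.

Let wgt (h : 'I_m.+1 -> R) (x : R) := \sum_(l < m.+1) h l * x `^ (4 * r l).

Let wgt_ge0 (h : 'I_m.+1 -> R) x : (forall l, 0 < h l) -> 0 <= wgt h x.
Proof. by move=> h0; apply: sumr_ge0 => l _; rewrite mulr_ge0 ?powR_ge0 // ltW. Qed.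

Let wgt_gt0 (h : 'I_m.+1 -> R) x : (forall l, 0 < h l) -> 0 < x -> 0 < wgt h x.
Proof.
move=> h0 x0; rewrite /wgt big_ord_recl ltr_pwDl ?mulr_gt0 ?powR_gt0 //.
by apply: sumr_ge0 => l _; rewrite mulr_ge0 ?powR_ge0 // ltW.
Qed.

Let S (xi : M) h n := \sum_(1 <= j < n) mu j `^ (4 * k) * phi j xi ^+ 2 / wgt h (mu j).

Let term_ge0 xi (h : 'I_m.+1 -> R) j : (forall l, 0 < h l) -> 0 <= mu j `^ (4 * k) * phi j xi ^+ 2 / wgt h (mu j).
Proof.
by move=> h0; exact: divr_ge0 (mulr_ge0 (powR_ge0 _ _) (sqr_ge0 _)) (wgt_ge0 _ h0).
Qed.

Let prod_gt0 (h : 'I_m.+1 -> R) : (forall l, 0 < h l) -> 0 < \prod_(l < m.+1) h l `^ lam l.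
Proof. by move=> h0; apply: prodr_gt0 => l _; rewrite powR_gt0. Qed.

(** Bounding the constant amounts to bounding finite sums uniformly; upper and lower bounds on it
    are both obtained in this form. *)
Lemma sharp_const_le (b : R) : (sharp_const mu phi r lam k <= b%:E)%E <->
  forall xi (h : 'I_m.+1 -> R) n, (forall l, 0 < h l) -> \prod_(l < m.+1) h l `^ lam l * S xi h n <= b.
Proof.
split=> [le xi h n h0|le].
  rewrite -lee_fin; apply: le_trans le; apply: (@le_trans _ _
    ((\prod_(l < m.+1) h l `^ lam l)%:E *
     \sum_(1 <= j <oo) (mu j `^ (4 * k) * phi j xi ^+ 2 / wgt h (mu j))%:E)%E).
    rewrite EFinM lee_wpmul2l // ?lee_fin ?(ltW (prod_gt0 h0)) // /S -sumEFin.
    by apply: nneseries_lim_ge => j _ _; rewrite lee_fin term_ge0.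
  apply: le_trans (ereal_sup_ubound _); last by exists xi.
  by apply: ereal_sup_ubound; exists h.
apply: ge_ereal_sup => _ [xi _ <-]; apply: ge_ereal_sup => _ [h h0 <-].
have P0 := prod_gt0 h0; rewrite -(mulfVK (lt0r_neq0 P0) b) (mulrC (b / _)) EFinM.
rewrite lee_wpmul2l // ?lee_fin ?(ltW P0) //; apply: lime_le.
  by apply: is_cvg_nneseries => j _ _; rewrite lee_fin term_ge0.
apply: nearW => n; rewrite sumEFin lee_fin ler_pdivlMr // mulrC; exact: le.
Qed.

Lemma sharp_const_ge0 : (0 <= sharp_const mu phi r lam k)%E.
Proof.
have h0 : forall l : 'I_m.+1, 0 < (fun=> 1 : R) l by [].
apply: le_trans (ereal_sup_ubound _); last by exists point.
apply: le_trans (ereal_sup_ubound _); last by exists (fun=> 1).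
apply: mule_ge0; first by rewrite lee_fin ltW // prod_gt0.
by apply: nneseries_ge0 => j _ _; rewrite lee_fin term_ge0.
Qed.

Variable C : R.
Hypothesis SC : forall xi (h : 'I_m.+1 -> R) n, (forall l, 0 < h l) -> \prod_(l < m.+1) h l `^ lam l * S xi h n <= C.

Let SC' xi (h : 'I_m.+1 -> R) n : (forall l, 0 < h l) -> S xi h n <= C / \prod_(l < m.+1) h l `^ lam l.
Proof. by move=> h0; rewrite ler_pdivlMr ?prod_gt0 // mulrC SC. Qed.

Let C0 : 0 <= C.
Proof.
have h0 : forall l : 'I_m.+1, 0 < (fun=> 1 : R) l by [].
by apply: le_trans (SC point 0 h0); rewrite mulr_ge0 ?(ltW (prod_gt0 _)) // /S big_geq.
Qed.

Let cf s (a : nat -> R) j := a j * mu j `^ (2 * s).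
(** The square sum of [a] with weight [wgt h]; the square root puts it in the form of a [sqsum],
    with its monotonicity and limit. *)
Let W h (a : nat -> R) := sqsum (fun j => a j * Num.sqrt (wgt h (mu j))).
Let ps (a : nat -> R) n (xi : M) := psum (T := borel M) phi (cf k a) n xi.

Let sqr_powR (x s : R) : (x `^ (2 * s)) ^+ 2 = x `^ (4 * s).
Proof.
by rewrite -powR_mulrn ?powR_ge0 // -powRrM; congr (_ `^ _); ring.
Qed.

Let W_sqsum (h : 'I_m.+1 -> R) a n : (forall l, 0 < h l) -> W h a n = \sum_(l < m.+1) h l * sqsum (cf (r l) a) n.
Proof.
move=> h0; rewrite /W /sqsum; under [RHS]eq_bigr do rewrite mulr_sumr.
rewrite exchange_big /=; apply: eq_bigr => j _.
rewrite exprMn sqr_sqrtr ?wgt_ge0 // /wgt mulr_sumr; apply: eq_bigr => l _.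
by rewrite /cf exprMn sqr_powR mulrCA.
Qed.

(** Cauchy-Schwarz with the weight split evenly between the coefficients and the values at [xi]. For
    [h = 1], where the product of powers is [1], it is a uniform Cauchy estimate; for [n = 1], where
    [ps] and [W] vanish, it is the pointwise inequality for an arbitrary [h]. *)
Let ps_sqr (h : 'I_m.+1 -> R) a n p xi : (forall l, 0 < h l) -> (1 <= n)%N -> (n <= p)%N ->
  (ps a p xi - ps a n xi) ^+ 2 <= (W h a p - W h a n) * S xi h p.
Proof.
move=> h0 n1 np.
rewrite /ps /psum /W /sqsum (big_cat_nat n1 np) /= [X in X - _]addrC addrK.
rewrite [X in (X - _) * _](big_cat_nat n1 np) /= [X in (X - _) * _]addrC addrK.
apply: le_trans (@sqr_sum_le _ _ _ (fun j => (a j * Num.sqrt (wgt h (mu j))) ^+ 2) (fun j => mu j `^ (4 * k) * phi j xi ^+ 2 / wgt h (mu j)) _ _ _) _.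
- by move=> j; exact: sqr_ge0.
- by move=> j; exact: term_ge0.
- move=> j; rewrite mem_index_iota => /andP[nj _].
  have w0 := wgt_gt0 h0 (mu_gt0 (leq_trans n1 nj)).
  rewrite [X in _ <= X * _]exprMn sqr_sqrtr ?(ltW w0) //.
  move: w0; set w := wgt h (mu j) => w0.
  rewrite -[leRHS]mulrA [w * _]mulrC divfK ?(gt_eqF w0) //.
  by rewrite /cf 2!exprMn sqr_powR -[leLHS]mulrA.
apply: ler_wpM2l; first by apply: sumr_ge0 => j _; exact: sqr_ge0.
rewrite /S (big_cat_nat n1 np) /= lerDr; apply: sumr_ge0 => j _; exact: term_ge0.
Qed.

Let one_gt0 : forall l : 'I_m.+1, 0 < (fun=> 1 : R) l.
Proof. by []. Qed.

Let continuous_limit a B : (forall n, W (fun=> 1) a n <= B) ->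
  exists2 y : M -> R, continuous y & forall xi, ps a n xi @[n --> \oo] --> y xi.
Proof.
move=> WB; pose e n := Num.sqrt ((sqlim (fun j => a j * Num.sqrt (wgt (fun=> 1) (mu j))) - W (fun=> 1) a n) * C).
apply: (@uniform_cauchy_limit _ _ (ps a) e).
- move=> n x; apply: (cvg_sumr (F := nbhs x)) => j _.
  exact: (cvgM (cvg_cst _) (@cphi j x)).
- have h : (sqlim (fun j => a j * Num.sqrt (wgt (fun=> 1) (mu j))) - W (fun=> 1) a n) * C @[n --> \oo] --> (0 : R).
    rewrite -(mul0r C); apply: cvgM; last exact: cvg_cst.
    by rewrite -(subrr (sqlim (fun j => a j * Num.sqrt (wgt (fun=> 1) (mu j))))); apply: cvgB; [exact: cvg_cst|exact: (sqsum_cvg WB)].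
  by have := cvg_comp _ _ h (@sqrt_continuous R 0); rewrite sqrtr0.
move=> n p x n1 np; rewrite -sqrtr_sqr ler_wsqrtr //.
apply: (le_trans (@ps_sqr (fun=> 1) a n p x one_gt0 n1 np)); apply: ler_pM.
- by rewrite subr_ge0 sqsum_mono.
- by apply: sumr_ge0 => j _; exact: term_ge0.
- by rewrite lerD2r (sqsum_le WB).
have := @SC' x (fun=> 1) p one_gt0; rewrite big1 ?divr1 // => l _; by rewrite powR1.
Qed.

(** The [mu j] with positive index are bounded below by [mu 1], so the top power controls every
    smaller one, including negative powers. *)
Let cf_bound a s B : s <= r ord_max -> (forall n, sqsum (cf (r ord_max) a) n <= B) ->
  forall n, sqsum (cf s a) n <= mu 1%N `^ (- (4 * (r ord_max - s))) * B.
Proof.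
move=> sr aB n; apply: (@le_trans _ _ (mu 1%N `^ (- (4 * (r ord_max - s))) * sqsum (cf (r ord_max) a) n)); last first.
  by rewrite ler_wpM2l ?powR_ge0.
rewrite /sqsum mulr_sumr !big_seq; apply: ler_sum => j; rewrite mem_index_iota => /andP[j1 _].
have j0 := mu_gt0 j1; rewrite /cf !exprMn !sqr_powR mulrCA ler_wpM2l ?sqr_ge0 //.
have -> : 4 * s = - (4 * (r ord_max - s)) + 4 * r ord_max by ring.
rewrite powRD ?(gt_eqF j0) ?implybT // ler_wpM2r ?powR_ge0 // powRN_mono ?mu_ge1 //.
by rewrite mulr_ge0 // subr_ge0.
Qed.

Let Hs_bounded x : Hs vol mu phi (2 * r ord_max) x -> exists B, forall n,
  sqsum (cre vol mu phi (r ord_max) x) n <= B /\ sqsum (cim vol mu phi (r ord_max) x) n <= B.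
Proof.
move=> [_]; set X := (\sum_(1 <= j <oo) _)%E => Xoo.
have X0 j : (0 <= (cabs (coef vol phi j x) ^+ 2 * mu j `^ (2 * (2 * r ord_max)))%:E)%E.
  by rewrite lee_fin mulr_ge0 ?sqr_ge0 ?powR_ge0.
have Xfin : X \is a fin_num by rewrite ge0_fin_numE // nneseries_ge0.
exists (fine X) => n.
have le : \sum_(1 <= j < n) cabs (coef vol phi j x) ^+ 2 * mu j `^ (2 * (2 * r ord_max)) <= fine X.
  by rewrite -lee_fin fineK // -sumEFin; apply: nneseries_lim_ge => j _ _; exact: X0.
split; apply: le_trans le; apply: ler_sum => j _; rewrite /cre /cim exprMn sqr_powR cabs_sqr.
  by rewrite (_ : 2 * (2 * r ord_max) = 4 * r ord_max) ?ler_wpM2r ?powR_ge0 ?lerDl ?sqr_ge0 //; ring.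
by rewrite (_ : 2 * (2 * r ord_max) = 4 * r ord_max) ?ler_wpM2r ?powR_ge0 ?lerDr ?sqr_ge0 //; ring.
Qed.

Let continuous_complex (u v : M -> R) : continuous u -> continuous v ->
  continuous ((fun p => Complex (u p) (v p)) : M -> R[i]^o).
Proof.
move=> uc vc p; apply/cvgrPdist_lt => -[e e']; rewrite ltcE /= => /andP[/eqP -> e0].
have e2 : 0 < e / 2 by rewrite divr_gt0.
have /cvgrPdist_lt /(_ _ e2) hu := uc p; have /cvgrPdist_lt /(_ _ e2) hv := vc p.
apply: filterS2 hu hv => q uq vq; rewrite normc_def ltcE /= eqxx /=.
set a := u p - u q in uq *; set b := v p - v q in vq *.
apply: (@le_lt_trans _ _ (`|a| + `|b|)); last by lra.
rewrite -[leRHS]ger0_norm ?addr_ge0 // -sqrtr_sqr ler_wsqrtr //.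
have -> : (`|a| + `|b|) ^+ 2 = `|a| ^+ 2 + `|b| ^+ 2 + 2 * (`|a| * `|b|) by ring.
by rewrite !real_normK ?num_real // lerDl !mulr_ge0.
Qed.

(** Real and imaginary parts are added before the norms enter, so each [N l ^+ 2] is spent on both
    at once. *)
Let cabs_bound (x : M -> R[i]) N (y1 y2 : M -> R) h xi : (forall l, 0 < h l) ->
  (forall xi, ps (fun j => complex.Re (coef vol phi j x)) n xi @[n --> \oo] --> y1 xi) ->
  (forall xi, ps (fun j => complex.Im (coef vol phi j x)) n xi @[n --> \oo] --> y2 xi) ->
  (forall l n, sqsum (cre vol mu phi (r l) x) n + sqsum (cim vol mu phi (r l) x) n <= N l ^+ 2) ->
  y1 xi ^+ 2 + y2 xi ^+ 2 <= (\sum_l h l * N l ^+ 2) * (C / \prod_(l < m.+1) h l `^ lam l).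
Proof.
move=> h0 l1 l2 hN.
set a := (fun j => complex.Re _) in l1; set b := (fun j => complex.Im _) in l2.
have lim : ps a n xi * ps a n xi + ps b n xi * ps b n xi @[n --> \oo] --> y1 xi * y1 xi + y2 xi * y2 xi.
  by apply: cvgD; [exact: (cvgM (l1 xi) (l1 xi))|exact: (cvgM (l2 xi) (l2 xi))].
rewrite !expr2 -(cvg_lim (@Rhausdorff R) lim); apply: limr_le.
  by apply/cvg_ex; eexists; exact: lim.
exists 1%N => // n /= n1; rewrite -!expr2.
have ha := @ps_sqr h a 1%N n xi h0 isT n1; have hb := @ps_sqr h b 1%N n xi h0 isT n1.
have p1 c : ps c 1%N xi = 0 by rewrite /ps /psum big_geq.
have W1 c : W h c 1%N = 0 by rewrite /W /sqsum big_geq.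
rewrite !p1 !W1 !subr0 in ha hb; apply: (le_trans (lerD ha hb)); rewrite -mulrDl.
have W0 c : 0 <= W h c n by apply: sumr_ge0 => j _; exact: sqr_ge0.
apply: ler_pM.
- by rewrite addr_ge0.
- by apply: sumr_ge0 => j _; exact: term_ge0.
- rewrite !W_sqsum // -big_split /=; apply: ler_sum => l _.
  by rewrite -mulrDr ler_wpM2l ?(ltW (h0 _)) //; exact: hN.
exact: SC'.
Qed.

Lemma laplace_pow_sup_le x : Hs vol mu phi (2 * r ord_max) x ->
  exists2 y, continuous_repr vol (laplace_pow vol mu phi k x) y &
    supnorm y <= Num.sqrt (C * \prod_(j < m.+1) lam j `^ (- lam j)) *
      \prod_(j < m.+1) L2norm vol (laplace_pow vol mu phi (r j) x) `^ lam j.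
Proof.
move=> /Hs_bounded[B hB].
set a := (fun j => complex.Re (coef vol phi j x)).
set b := (fun j => complex.Im (coef vol phi j x)).
have hs s : s <= r ord_max -> exists B, (forall n, sqsum (cre vol mu phi s x) n <= B) /\
    (forall n, sqsum (cim vol mu phi s x) n <= B).
  move=> sr; exists (mu 1%N `^ (- (4 * (r ord_max - s))) * B); split => n.
    by apply: (@cf_bound a) => // p; have [] := hB p.
  by apply: (@cf_bound b) => // p; have [] := hB p.
have hD s : s <= r ord_max -> is_laplace_pow vol mu phi s x (laplace_pow vol mu phi s x).
  by move=> /hs[B' [h1 h2]]; exact: (laplace_powP mphi orth h1 h2).
pose N l := L2norm vol (laplace_pow vol mu phi (r l) x).
have N0 l : 0 <= N l by exact: L2norm_ge0.
have hN l n : sqsum (cre vol mu phi (r l) x) n + sqsum (cim vol mu phi (r l) x) n <= N l ^+ 2.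
  have h := L2norm_laplace_pow mphi orth (hD _ (hr l)).
  rewrite /N -(cvg_lim (@Rhausdorff R) h).
  apply: (@nondecreasing_cvgn_le R (fun n => sqsum (cre vol mu phi (r l) x) n + sqsum (cim vol mu phi (r l) x) n)).
    by move=> i j ij; apply: lerD; exact: sqsum_mono.
  by apply/cvg_ex; eexists; exact: h.
have sq0 c n : 0 <= sqsum c n :> R by apply: sumr_ge0 => j _; exact: sqr_ge0.
have Wa n : W (fun=> 1) a n <= \sum_l N l ^+ 2.
  rewrite W_sqsum //; apply: ler_sum => l _; rewrite mul1r.
  by apply: le_trans (hN l n); rewrite lerDl.
have Wb n : W (fun=> 1) b n <= \sum_l N l ^+ 2.
  rewrite W_sqsum //; apply: ler_sum => l _; rewrite mul1r.
  by apply: le_trans (hN l n); rewrite lerDr.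
have [y1 y1c l1] := continuous_limit Wa; have [y2 y2c l2] := continuous_limit Wb.
have [B' [hB1 hB2]] := hs k kr.
exists (fun p => Complex (y1 p) (y2 p)).
  split; first exact: continuous_complex.
  apply: (is_laplace_pow_unique mphi orth (hD k kr)).
  apply: (proj2 (@is_laplace_powP R d M vol mu phi mphi orth k x (fun p => Complex (y1 p) (y2 p)))); split.
    apply: (l2_expansion_pointwise mphi orth hB1); last exact: l1.
    exact: measurable_continuous.
  apply: (l2_expansion_pointwise mphi orth hB2); last exact: l2.
  exact: measurable_continuous.
set Q := \prod_(j < m.+1) lam j `^ _; set P := \prod_(j < m.+1) _ `^ _.
set K := Num.sqrt _.
have Q0 : 0 <= Q by apply: prodr_ge0 => l _; exact: powR_ge0.
have KP0 : 0 <= K * P by rewrite mulr_ge0 ?sqrtr_ge0 // prodr_ge0 // => l _; exact: powR_ge0.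
apply: ge_sup; first by exists (cabs (Complex (y1 point) (y2 point))); exists point.
move=> _ [xi _ <-]; rewrite -[leLHS]ger0_norm ?cabs_ge0 // -sqrtr_sqr cabs_sqr /=.
rewrite -[leRHS]ger0_norm // -sqrtr_sqr ler_wsqrtr //.
(* The weights chosen below divide by the [N l]. If one of them is [0], all coefficients of positive
   index vanish and so does the value at [xi]. *)
have [/existsP[l /eqP Nl]|/existsPn Nn0] := boolP [exists l, N l == 0].
  have z c : (forall n, sqsum (cf (r l) c) n <= 0) -> forall n, ps c n xi = 0.
    move=> h n; rewrite /ps /psum big_nat big1 // => j /andP[j1 jn].
    have /eqP : sqsum (cf (r l) c) j.+1 == 0 by rewrite eq_le h sq0.
    rewrite /sqsum big_nat_recr //= => /eqP; rewrite paddr_eq0 ?sqr_ge0 //; last exact: (sq0 _ j).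
    move=> /andP[_]; rewrite sqrf_eq0 /cf mulf_eq0 (gt_eqF (powR_gt0 _ (mu_gt0 j1))) orbF => /eqP ->.
    by rewrite !mul0r.
  have [za zb] : (forall n, ps a n xi = 0) /\ (forall n, ps b n xi = 0).
    split; apply: z => n; have := hN l n; rewrite Nl expr0n /=.
      by apply: le_trans; rewrite lerDl.
    by apply: le_trans; rewrite lerDr.
  have -> : y1 xi = 0.
    rewrite -(cvg_lim (@Rhausdorff R) (l1 xi)) (_ : (fun n => ps a n xi) = cst 0) ?lim_cst //.
    exact/funext.
  have -> : y2 xi = 0.
    rewrite -(cvg_lim (@Rhausdorff R) (l2 xi)) (_ : (fun n => ps b n xi) = cst 0) ?lim_cst //.
    exact/funext.
  by rewrite expr0n /= addr0 sqr_ge0.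
have Np l : 0 < N l by rewrite lt_def Nn0 N0.
(* The weighted sum of the [N l ^+ 2] becomes [1], and dividing [C] by the product of the powers of
   [h] produces the square of the right-hand side. *)
pose h l := lam l / N l ^+ 2.
have h0 l : 0 < h l by rewrite divr_gt0 ?exprn_gt0.
apply: (le_trans (cabs_bound xi h0 l1 l2 hN)).
have -> : \sum_l h l * N l ^+ 2 = 1.
  by rewrite -hlam1; apply: eq_bigr => l _; rewrite /h divfK // gt_eqF ?exprn_gt0.
rewrite mul1r exprMn sqr_sqrtr ?mulr_ge0 // -mulrA ler_wpM2l // le_eqVlt; apply/orP; left; apply/eqP.
apply: (mulfI (lt0r_neq0 (prod_gt0 h0))); rewrite mulfV ?gt_eqF ?prod_gt0 //.
rewrite /P /Q expr2 -!big_split /= big1 // => l _.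
rewrite -/(N l) -(powRM _ (N0 l) (N0 l)) mulrCA.
rewrite -(powRM _ (ltW (h0 l)) (mulr_ge0 (N0 l) (N0 l))).
by rewrite /h -expr2 divfK ?gt_eqF ?exprn_gt0 // powRN mulVf ?gt_eqF ?powR_gt0.
Qed.

Let sum_trunc (f : nat -> R) n N : (forall j, (n <= j)%N -> f j = 0) -> (n <= N)%N ->
  \sum_(1 <= j < N) f j = \sum_(1 <= j < n) f j.
Proof.
move=> f0 nN; rewrite [RHS](big_nat_widen _ _ _ _ _ nN) [RHS]big_mkcond /=.
by apply: eq_bigr => j _; case: ltnP => // /f0.
Qed.

Let cvg_trunc (u : nat -> R) n l : (forall N, (n <= N)%N -> u N = l) -> u @ \oo --> l.
Proof.
by move=> h; apply: cvg_near_cst; exists n.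
Qed.

Let extremal (xi : M) (h : 'I_m.+1 -> R) n : (forall l, 0 < h l) ->
  exists x y, [/\ Hs0 vol mu phi (2 * r ord_max) x,
    continuous_repr vol (laplace_pow vol mu phi k x) y,
    S xi h n <= supnorm y &
    forall l, L2norm vol (laplace_pow vol mu phi (r l) x) ^+ 2 =
      sqsum (cf (r l) (fun j => mu j `^ (2 * k) * phi j xi / wgt h (mu j))) n].
Proof.
move=> h0; set a := (fun j => mu j `^ (2 * k) * phi j xi / wgt h (mu j)).
pose x (p : M) : R[i] := Complex (psum (T := borel M) phi a n p) 0.
(* The actual coefficients of [x]: they vanish at index [0], which places [x] in [Hs0], and from [n]
   on, so that every series is eventually constant. *)
pose a' j := if (1 <= j < n)%N then a j else 0.
have cx j : coef vol phi j x = Complex (a' j) 0.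
  rewrite /coef /x /=; congr Complex; first exact: Rintegral_psum.
  by rewrite /Rintegral integral0_eq // => p _; rewrite mul0r.
have a'0 s j : (n <= j)%N -> cf s a' j = 0.
  by move=> nj; rewrite /cf /a' [(j < n)%N]ltnNge nj andbF mul0r.
have creE s : cre vol mu phi s x = cf s a' by apply/funext => j; rewrite /cre cx.
have cimE s : cim vol mu phi s x = fun=> 0 by apply/funext => j; rewrite /cim cx /= mul0r.
have cfE s j : (1 <= j < n)%N -> cf s a' j = cf s a j by rewrite /cf /a' => ->.
have sqE s N : (n <= N)%N -> sqsum (cf s a') N = sqsum (cf s a) n.
  move=> nN; rewrite /sqsum (sum_trunc _ nN) => [|j /(a'0 s) ->]; last by rewrite expr0n.
  by apply: eq_big_nat => j hj; rewrite cfE.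
have sq0 N : sqsum (fun=> 0 : R) N = 0 by rewrite /sqsum big1 // => j _; rewrite expr0n.
have psE s N p : (n <= N)%N -> psum (T := borel M) phi (cf s a') N p = psum (T := borel M) phi (cf s a) n p.
  move=> nN; rewrite /psum (sum_trunc _ nN) => [|j /(a'0 s) ->]; last by rewrite mul0r.
  by apply: eq_big_nat => j hj; rewrite cfE.
have sqB s N : sqsum (cf s a') N <= sqsum (cf s a) n.
  by rewrite -(sqE s (maxn N n)) ?leq_maxr // sqsum_mono // leq_maxl.
pose y (p : M) : R[i] := Complex (psum (T := borel M) phi (cf k a) n p) 0.
have psc s : continuous (fun p : M => psum (T := borel M) phi (cf s a) n p).
  move=> p; apply: (cvg_sumr (F := nbhs p)) => j _.
  exact: (cvgM (cvg_cst _) (@cphi j p)).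
have hD s : is_laplace_pow vol mu phi s x (laplace_pow vol mu phi s x).
  apply: (@laplace_powP _ _ _ _ _ _ mphi orth _ _ (sqsum (cf s a) n)) => N.
    by rewrite creE.
  by rewrite cimE sq0; apply: sumr_ge0 => j _; exact: sqr_ge0.
exists x, y; split.
- split; last first.
    by rewrite cx /a' ltn0.
  split.
    apply/L2P; split.
    + exact: measurable_psum.
    + exact: measurable_cst.
    + by rewrite (sqint_psum mphi orth) ltry.
    + by rewrite /sqint integral0_eq // => p _; rewrite /im /= expr0n.
  apply: (@le_lt_trans _ _ (sqsum (cf (r ord_max) a) n)%:E); last exact: ltry.
  apply: lime_le.
    by apply: is_cvg_nneseries => j _ _; rewrite lee_fin mulr_ge0 ?sqr_ge0 ?powR_ge0.
  apply: nearW => N; rewrite sumEFin lee_fin; apply: le_trans (sqB _ N).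
  apply: ler_sum => j _; rewrite cabs_sqr cx /= expr0n addr0 /cf exprMn sqr_powR.
  by rewrite mulrA (_ : 2 * 2 = 4) //; ring.
- split; first by apply: continuous_complex; [exact: psc|move=> p; exact: cvg_cst].
  apply: (is_laplace_pow_unique mphi orth (hD k)).
  apply: (proj2 (@is_laplace_powP R d M vol mu phi mphi orth k x y)); split.
    rewrite creE; apply: (l2_expansion_pointwise mphi orth (sqB k)); first exact: measurable_psum.
    by move=> p; apply: (@cvg_trunc _ n) => N nN; exact: psE.
  rewrite cimE; apply: (@l2_expansion_pointwise _ _ _ _ _ mphi orth _ _ 0).
  + by move=> N; rewrite sq0.
  + exact: measurable_cst.
  + by move=> p; apply: (@cvg_trunc _ 0%N) => N _; rewrite /psum big1 // => j _; rewrite mul0r.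
- have yE p : cabs (y p) = `|psum (T := borel M) phi (cf k a) n p|.
    by rewrite -[LHS]ger0_norm ?cabs_ge0 // -sqrtr_sqr cabs_sqr /= expr0n addr0 sqrtr_sqr.
  have -> : S xi h n = cabs (y xi).
    rewrite yE ger0_norm /psum.
      apply: eq_bigr => j _; rewrite /cf /a -sqr_powR expr2; ring.
    apply: sumr_ge0 => j _; have := @term_ge0 xi h j h0.
    by rewrite -sqr_powR /cf /a; congr (0 <= _); ring.
  (* The value at [xi] lies below [sup] only if the set is bounded; compactness supplies the
     bound. *)
  have [|||pm _ pmax] := @compact_EVT_max M R (fun p : M => `|psum (T := borel M) phi (cf k a) n p|) [set: M].
  + by exists point.
  + exact: carrier_compact.
  + by apply: continuous_subspaceT => p; apply: cvg_norm; exact: psc.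
  apply: ub_le_sup; last by exists xi.
  by exists `|psum (T := borel M) phi (cf k a) n pm| => _ [p _ <-]; rewrite yE; apply: pmax; rewrite inE.
move=> l; have := L2norm_laplace_pow mphi orth (hD (r l)); rewrite creE cimE => lim.
apply: (@cvg_unique R (@Rhausdorff R) _ _ _ _ lim); apply: (@cvg_trunc _ n) => N nN.
by rewrite sq0 addr0 sqE.
Qed.

(** A point with [phi 1 != 0] gives an extremal function with positive value, which forces
    [0 <= K']; the bound on [K' ^+ 2] can then be turned back into one on [K']. *)
Lemma sharp_const_lower K' : (exists xi, phi 1%N xi != 0) ->
  (forall x y, Hs0 vol mu phi (2 * r ord_max) x ->
    continuous_repr vol (laplace_pow vol mu phi k x) y ->
    supnorm y <= K' * \prod_(j < m.+1) L2norm vol (laplace_pow vol mu phi (r j) x) `^ lam j) ->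
  0 <= K' /\ forall xi (h : 'I_m.+1 -> R) n, (forall l, 0 < h l) ->
    \prod_(l < m.+1) h l `^ lam l * S xi h n <= K' ^+ 2 * \prod_(l < m.+1) lam l `^ lam l.
Proof.
move=> [xi1 phi1] hK.
have key xi (h : 'I_m.+1 -> R) n : (forall l, 0 < h l) -> exists P, [/\ 0 <= P, S xi h n <= K' * P &
    \prod_(l < m.+1) h l `^ lam l * P ^+ 2 <= S xi h n * \prod_(l < m.+1) lam l `^ lam l].
  move=> h0; have [x [y [hx hy Sy hN]]] := extremal xi n h0.
  pose N l := L2norm vol (laplace_pow vol mu phi (r l) x).
  have N0 l : 0 <= N l by exact: L2norm_ge0.
  exists (\prod_(j < m.+1) N j `^ lam j); split.
  - by apply: prodr_ge0 => l _; exact: powR_ge0.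
  - exact: le_trans Sy (hK x y hx hy).
  (* The weighted sum of the [N l ^+ 2] is the weighted square sum of the extremal coefficients,
     which collapses to [S] because they carry the inverse weight. *)
  have -> : S xi h n = \sum_l lam l * (h l * N l ^+ 2 / lam l).
    transitivity (\sum_l h l * N l ^+ 2); last first.
      by apply: eq_bigr => l _; rewrite [RHS]mulrC divfK // gt_eqF.
    under eq_bigr do rewrite hN.
    rewrite -W_sqsum // /W /S /sqsum; apply: eq_big_nat => j /andP[j1 _].
    have w0 := wgt_gt0 h0 (mu_gt0 j1); rewrite exprMn sqr_sqrtr ?(ltW w0) // -sqr_powR.
    by field; rewrite gt_eqF.
  have t0 l : 0 <= h l * N l ^+ 2 / lam l by rewrite !mulr_ge0 ?sqr_ge0 ?invr_ge0 // ltW.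
  have := ler_wpM2r (ltW (prod_gt0 hlam)) (weighted_am_gm hlam hlam1 t0).
  apply: le_trans; rewrite -big_split expr2 -!big_split /= le_eqVlt; apply/orP; left.
  apply/eqP; apply: eq_bigr => l _; rewrite -(powRM _ (N0 l) (N0 l)) -expr2.
  rewrite -(powRM _ (ltW (h0 l)) (sqr_ge0 _)) -(powRM _ (t0 l) (ltW (hlam l))).
  by rewrite divfK // gt_eqF.
have S0 xi (h : 'I_m.+1 -> R) n : (forall l, 0 < h l) -> 0 <= S xi h n.
  by move=> h0; apply: sumr_ge0 => j _; exact: term_ge0.
split.
  have [P [P0 SP _]] := key xi1 _ 2%N one_gt0.
  have : 0 < S xi1 (fun=> 1) 2%N.
    rewrite /S big_nat1 divr_gt0 ?wgt_gt0 ?mu_gt0 // mulr_gt0 ?powR_gt0 ?mu_gt0 //.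
    by rewrite lt_def sqr_ge0 sqrf_eq0 phi1.
  move=> /lt_le_trans /(_ SP) KP; rewrite leNgt; apply/negP => K0.
  by move: KP; rewrite ltNge mulr_le0_ge0 // ltW.
move=> xi h n h0; have [P [P0 SP PS]] := key xi h n h0.
have L0 := ltW (prod_gt0 hlam); have H0 := ltW (prod_gt0 h0).
move: (S0 xi h n h0) SP PS; set s := S xi h n; set L := \prod_(l < m.+1) lam l `^ _ in L0 *.
set H := \prod_(l < m.+1) _ in H0 * => s0 SP PS.
have [s1|s1] := ltrP 0 s; last first.
  have -> : s = 0 by apply/eqP; rewrite eq_le s1.
  by rewrite mulr0 mulr_ge0 ?sqr_ge0.
(* [H * s ^+ 2] is at most [H * (K' * P) ^+ 2], hence at most [K' ^+ 2 * L * s]; one factor [s]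
   cancels. *)
rewrite -(ler_pM2r s1) -mulrA -expr2.
apply: (@le_trans _ _ (H * (K' * P) ^+ 2)).
  by rewrite ler_wpM2l // lerXn2r // nnegrE // (le_trans s0).
by rewrite exprMn mulrCA -[leRHS]mulrA (mulrC L) ler_wpM2l // sqr_ge0.
Qed.

End sharp_inequality.

Theorem theorem12 (R : realType) (d : nat) (M : compactRiemannianManifold R d)
    (vol : {measure set (borel M) -> \bar R}) (hvol : is_volume vol)
    (mu : nat -> R) (phi : nat -> M -> R)
    (hbasis : laplace_spectral_basis vol mu phi)
    (m : nat) (hm : (1 <= m)%N) (r lam : 'I_m.+1 -> R) (k : R)
    (hr : forall i j : 'I_m.+1, (i < j)%N -> r i < r j)
    (hlam : forall j, 0 < lam j) (hlam1 : \sum_(j < m.+1) lam j = 1)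
    (hk : k + (2 * d%:R - 1) / 4 <= \sum_(j < m.+1) lam j * r j) :
  let C := sharp_const mu phi r lam k in
  let K := Num.sqrt (fine C * \prod_(j < m.+1) lam j `^ (- lam j)) in
  let D := laplace_pow vol mu phi in
  [/\ C \is a fin_num,
      forall x, Hs0 vol mu phi (2 * r ord_max) x ->
        exists2 y, continuous_repr vol (D k x) y &
          supnorm y <= K * \prod_(j < m.+1) L2norm vol (D (r j) x) `^ lam j
    & forall K' : R,
        (forall x y, Hs0 vol mu phi (2 * r ord_max) x ->
           continuous_repr vol (D k x) y ->
           supnorm y <= K' * \prod_(j < m.+1) L2norm vol (D (r j) x) `^ lam j) ->
        K <= K'].
Proof.
move=> C K D.
have [mu00 mu1 mu_mono eig [orth _]] := hbasis.
have homo i j : (i <= j)%N -> mu i <= mu j by apply: (proj1 (nondecreasing_seqP mu)).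
have mu_ge0 j : 0 <= mu j by rewrite -mu00 homo.
have cphi j : continuous (phi j) by exact: smooth_continuous (eig j).1.
have mphi j : measurable_fun [set: borel M] (phi j : borel M -> R) by exact: measurable_continuous.
have [xi1 phi1] : exists xi, phi 1%N xi != 0.
  apply: contrapT => h; have phi0 p : phi 1%N p = 0.
    by apply: contrapT => /eqP p0; apply: h; exists p.
  have /eqP := orth 1%N 1%N; rewrite /Rintegral integral0_eq ?eqxx /= ?(eq_sym 0) ?oner_eq0 //.
  by move=> p _; rewrite phi0 mulr0.
(* In dimension [0] the Laplacian is an empty sum, which contradicts a positive eigenvalue. *)
have d0 : (0 < d)%N.
  have [d0|//] := posnP d; have [c hc cp] := atlas_cover xi1.
  have := (eig 1%N).2 c xi1 hc cp; rewrite /laplace_chart big1 => [/eqP|i _]; last first.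
    by have := leq_ltn_trans (leq0n i) (ltn_ord i); rewrite {1}d0.
  by rewrite mulr0 oppr0 eq_sym mulf_eq0 sqrf_eq0 (gt_eqF mu1) (negbTE phi1).
have rmax l : r l <= r ord_max.
  have [lt|ge] := ltnP l m; first by apply: ltW; apply: hr.
  suff -> : l = ord_max by [].
  by apply: val_inj => /=; apply/eqP; rewrite eqn_leq -ltnS ltn_ord.
have kr : k <= r ord_max.
  have : \sum_(j < m.+1) lam j * r j <= r ord_max.
    rewrite -[leRHS]mul1r -hlam1 mulr_suml; apply: ler_sum => l _.
    by rewrite ler_wpM2l // ltW.
  have : (1 : R) <= d%:R by rewrite ler1n.
  by move: hk; set s := \sum_(j < m.+1) _; set e := d%:R; set b := r ord_max; lra.
have [C1 C10 hC1] := global_weyl d0 hvol mu_ge0 eig orth mu1.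
have [B B0 hB] := weighted_sum_bounded hlam hlam1 mu (ltW C10) mu1 d0 hm hr hk.
have CB : (C <= B%:E)%E.
  apply/sharp_const_le => xi h n h0; apply: hB => //.
  - exact: iota_uniq.
  - move=> J T uJ sJ T0 muT.
    (* [growth] ranges over all [T > 0], the Weyl bound over [T] at least [mu 1]; a nonempty list of
       positive indices forces the latter. *)
    case: J uJ sJ muT => [|j J] uJ sJ muT; first by rewrite big_nil mulr_ge0 ?exprn_ge0 ?ltW.
    apply: hC1 => //; apply: le_trans (muT j (mem_head j J)).
    by apply: homo; have := sJ j (mem_head j J); rewrite mem_index_iota => /andP[].
  - by move=> j; exact: sqr_ge0.
  - by move=> j; rewrite mem_index_iota => /andP[j1 _]; exact: homo.
have C0 : (0 <= C)%E by exact: sharp_const_ge0.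
have Cfin : C \is a fin_num by rewrite ge0_fin_numE // (le_lt_trans CB) ?ltry.
have SC : (sharp_const mu phi r lam k <= (fine C)%:E)%E by rewrite fineK.
split=> //.
  move=> x [hx _].
  exact: (laplace_pow_sup_le mphi cphi orth (fun j => homo 1%N j) mu1 rmax kr hlam hlam1 ((sharp_const_le _ _ _ _ _ _).1 SC) hx).
move=> K' hK.
have [K0 low] := sharp_const_lower mphi cphi orth (fun j => homo 1%N j) mu1 hlam hlam1 (ex_intro _ xi1 phi1) hK.
have le : fine C <= K' ^+ 2 * \prod_(l < m.+1) lam l `^ lam l.
  by rewrite -lee_fin fineK //; apply/sharp_const_le.
rewrite /K -[K'](ger0_norm K0) -sqrtr_sqr ler_wsqrtr //.
have -> : \prod_(j < m.+1) lam j `^ (- lam j) = (\prod_(l < m.+1) lam l `^ lam l)^-1.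
  by rewrite -prodfV; apply: eq_bigr => l _; rewrite powRN.
by rewrite ler_pdivrMr //; apply: prodr_gt0 => l _; rewrite powR_gt0.
Qed.
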